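(* For all $k,m,n \in \mathbb N \cup \{\infty\}$ with $4 \leq k \leq m \leq n$, there exist finitely generated, recursively presented groups $G$ and $H$ with $H \leqslant G$ such that $$\operatorname{asdim}(G) = k,\qquad \operatorname{asdim}_{AN}(G) = m,\qquad \operatorname{asdim}_{AN}(H) = n.$$
   Context: For a metric space $X$ and $n\in\mathbb N$: $\operatorname{asdim}(X)\le n$ means that for every $r>0$ there is a cover of $X$ by sets of uniformly bounded diameter such that every ball of radius $r$ meets at most $n+1$ members of the cover. $\operatorname{asdim}_{AN}(X)\le n$ (asymptotic Assouad–Nagata dimension) means that there exist $C>0$ and $r_0>0$ such that for every $r\ge r_0$ there is a cover of $X$ by sets of diameter at most $Cr$ such that every ball of radius $r$ meets at most $n+1$ members of the cover. $\operatorname{asdim}(X)$ and $\operatorname{asdim}_{AN}(X)$ are the least such $n$ (or $\infty$ if none exists). For a finitely generated group these are computed with respect to the word metric of a finite generating set (the values do not depend on the choice). *)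

(* Defs.v *)
From Stdlib Require Import Reals List Arith Lia.
Import ListNotations.
Open Scope R_scope.

Definition enat := option nat.
Definition enat_le (a b : enat) : Prop :=
  match a, b with
  | _, None => True
  | None, Some _ => False
  | Some x, Some y => (x <= y)%nat
  end.

Definition dim_is (P : nat -> Prop) (d : enat) : Prop :=
  match d with
  | Some k => P k /\ (forall j, (j < k)%nat -> ~ P j)
  | None => forall j, ~ P j
  end.

(* ---------- Asymptotic dimensions of a metric space ----------
   A metric space is given through its distance-bound relation
   dle x y t  :<->  d(x,y) <= t.  Balls are closed balls. *)
Section AsDim.
Variable X : Type.
Variable dle : X -> X -> R -> Prop.

Definition is_cover (F : (X -> Prop) -> Prop) : Prop :=
  forall x, exists U, F U /\ U x.

Definition ball_meets (x : X) (r : R) (U : X -> Prop) : Prop :=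
  exists y, dle x y r /\ U y.

Definition mult_le (F : (X -> Prop) -> Prop) (r : R) (n : nat) : Prop :=
  forall (x : X) (Us : list (X -> Prop)), NoDup Us ->
    (forall U, In U Us -> F U /\ ball_meets x r U) ->
    (length Us <= n + 1)%nat.

Definition diam_le (F : (X -> Prop) -> Prop) (D : R) : Prop :=
  forall U, F U -> forall x y, U x -> U y -> dle x y D.

Definition asdim_le (n : nat) : Prop :=
  forall r, 0 < r ->
    exists F, is_cover F /\ (exists D, diam_le F D) /\ mult_le F r n.

Definition asdimAN_le (n : nat) : Prop :=
  exists C r0, 0 < C /\ 0 < r0 /\
    forall r, r0 <= r ->
      exists F, is_cover F /\ diam_le F (C * r) /\ mult_le F r n.
End AsDim.
Arguments asdim_le {X} dle n.
Arguments asdimAN_le {X} dle n.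

Record group := Group {
  gcar :> Type;
  gmul : gcar -> gcar -> gcar;
  gone : gcar;
  ginv : gcar -> gcar;
  gmulA : forall x y z, gmul x (gmul y z) = gmul (gmul x y) z;
  gmul1 : forall x, gmul gone x = x;
  gmulV : forall x, gmul (ginv x) x = gone
}.
Arguments gmul {g}.
Arguments gone {g}.
Arguments ginv {g}.

Definition letter := (nat * bool)%type.
Definition word := list letter.
Definition inv_letter (l : letter) : letter := (fst l, negb (snd l)).

Definition valid {G : group} (S : list G) (w : word) : Prop :=
  forall l, In l w -> (fst l < length S)%nat.

Definition eval_letter {G : group} (S : list G) (l : letter) : G :=
  let g := nth (fst l) S gone in if snd l then ginv g else g.

Definition eval {G : group} (S : list G) (w : word) : G :=
  fold_right (fun l acc => gmul (eval_letter S l) acc) gone w.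

Definition generates {G : group} (S : list G) (P : G -> Prop) : Prop :=
  forall g, P g <-> exists w, valid S w /\ eval S w = g.

Definition subgroup {G : group} (P : G -> Prop) : Prop :=
  P gone /\ (forall x y, P x -> P y -> P (gmul x y)) /\ (forall x, P x -> P (ginv x)).

Definition word_dle {G : group} (S : list G) (g h : G) (t : R) : Prop :=
  exists w, valid S w /\ INR (length w) <= t /\ eval S w = gmul (ginv g) h.

Definition sub_word_dle {G : group} (P : G -> Prop) (T : list G)
  (x y : {g : G | P g}) (t : R) : Prop :=
  word_dle T (proj1_sig x) (proj1_sig y) t.

(* ---------- Group presentations ----------
   The congruence on words generated by free cancellation and by
   insertion/deletion of relators; w ~ [] iff w lies in the normal
   closure of R in the free group. *)
Inductive rel_eq (Rl : word -> Prop) : word -> word -> Prop :=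
| re_refl : forall w, rel_eq Rl w w
| re_sym : forall u v, rel_eq Rl u v -> rel_eq Rl v u
| re_trans : forall u v w, rel_eq Rl u v -> rel_eq Rl v w -> rel_eq Rl u w
| re_cancel : forall u v l, rel_eq Rl (u ++ l :: inv_letter l :: v) (u ++ v)
| re_rel : forall u v r, Rl r -> rel_eq Rl (u ++ r ++ v) (u ++ v).

Inductive PR : Type :=
| PRzero : PR
| PRsucc : PR
| PRproj : nat -> PR
| PRcomp : PR -> list PR -> PR
| PRrec : PR -> PR -> PR.

Fixpoint pr_eval (p : PR) (xs : list nat) {struct p} : nat :=
  match p with
  | PRzero => 0%nat
  | PRsucc => S (hd 0%nat xs)
  | PRproj i => nth i xs 0%nat
  | PRcomp f gs => pr_eval f (map (fun g => pr_eval g xs) gs)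
  | PRrec f g =>
      match xs with
      | [] => pr_eval f []
      | n :: ys => nat_rect (fun _ => nat) (pr_eval f ys)
                     (fun k acc => pr_eval g (k :: acc :: ys)) n
      end
  end.

(* Recursively enumerable sets of naturals (Kleene normal form:
   projection of a primitive recursive relation). *)
Definition re_set (A : nat -> Prop) : Prop :=
  exists p : PR, forall a, A a <-> exists t, pr_eval p [a; t] <> 0%nat.

Definition cpair (a b : nat) : nat := ((a + b) * (a + b + 1) / 2 + b)%nat.
Fixpoint code (w : word) : nat :=
  match w with
  | [] => 0%nat
  | (i, b) :: w' => S (cpair (2 * i + (if b then 1 else 0)) (code w'))
  end.

Definition re_words (Rl : word -> Prop) : Prop :=
  exists A, re_set A /\ forall w, Rl w <-> A (code w).

Definition rec_presented {G : group} (S : list G) : Prop :=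
  exists Rl : word -> Prop, re_words Rl /\ (forall r, Rl r -> valid S r) /\
    forall w, valid S w -> (eval S w = gone <-> rel_eq Rl w []).

(* Main.v *)
Require Import Defs.
From Stdlib Require Import Reals List ZArith Lia Lra Bool Arith FinFun.
From Stdlib Require Import Classical ClassicalEpsilon FunctionalExtensionality PropExtensionality.
Import ListNotations.
Open Scope nat_scope.

(** Let [c = k - 2]. The group [G] is generated by [a], [b], [t], [q] and [c] further letters. Modulo
    a central subgroup it is the subgroup of [F(a,t,q) x F(b,t,q) x Z^c] in which the letters [t] and [q]
    act on both free groups at once; [a] and [b] commute modulo it, and the commutator of [a]
    with a conjugate of [b] depends only on the position of the conjugating word, where [t] moves by
    4 and [q] moves by 1. The central subgroup is a sum of cyclic groups indexed by pairs [(s, i)] with [i < s],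
    generated by the commutators at the positions [4 * slot s i], which are comparable to a rapidly
    growing sequence [Dn s]. [H] is generated by all letters but [q].

    In [H] the element [z] of the coordinate [(s, i)] has length about [slot s i + sqrt |z|]. At scale
    [Dn s] a cyclic group of order [Dn s ^ 4] therefore looks like a line, and it adds 1 to the
    Assouad-Nagata dimension. It adds nothing to [asdim], since it is finite and only finitely many
    coordinates are visible at a given scale. The number of nontrivial coordinates is [n - k] in each window
    [s]. In [G], the three positions that follow [4 * slot s i] carry the powers with exponents
    [B], [B^2], [B^3]. For [i < m - k] we take [B = 0] and nothing changes; for the other [i] we take
    [B = Dn s], so that base [Dn s] digits express every [z] by a word of length linear in [slot s i],
    and the coordinate disappears. For [k = oo] all coordinates are infinite cyclic.

    Upper bounds: over an interval of heights of the tree of [F(a,t,q)], measuring central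
    coordinates from the bottom of the tree makes them Lipschitz, and slabs in the remaining
    coordinates give coloured covers of columns; two families of columns are glued by letting
    a missing colour move through consecutive zones of heights. Lower bounds: products of powers of
    [a], [b], the commuting letters and visible central elements form a grid of the expected
    dimension, and a cover of too small multiplicity would yield functions separating
    opposite faces without a common sign change, against a mod 2 cup product computation.
    The relators are all trivial words, which form a primitive recursive set. *)

(** An undistorted coordinate of order [Dn s ^ 4] has word length of order [Dn s ^ 2]. Relative to
    the scale [Dn s] this is unbounded, so no constant [C] absorbs it; but it is far below
    [Dn (S s) = Dn s ^ 8], so at the scale of a window all older windows together are negligible. A
    number below [Dn s ^ 4] has four digits in base [Dn s], hence four positions per coordinate and
    a letter t that jumps over them. All orders are powers of 2, so that slab patterns whose period
    is a power of 2 descend to every cyclic group that is long enough. When [n] is infinite and [m]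
    is finite, unboundedly many distorted coordinates are visible at one scale; the slots
    [Dn s * 2 ^ i] grow geometrically so that the sum of their costs is still linear. The
    commutators of a with conjugates of b supply infinitely many central generators from finitely
    many letters, at the price of a cocycle: a step changes a central coordinate by a term that
    grows with the number of letters a already present. This cross term is what prevents a direct
    product cover and leads to columns over one of the two trees. *)

Definition vp (p : nat) (w : word) : Prop := forall l, In l w -> fst l < p.
Definition winv (w : word) : word := rev (map inv_letter w).

Lemma letter_eq_dec (x y : letter) : {x = y} + {x <> y}.
Proof. decide equality; [apply bool_dec | apply Nat.eq_dec]. Defined.

Lemma inv_letterK l : inv_letter (inv_letter l) = l.
Proof. destruct l as [i b]; unfold inv_letter; simpl; now rewrite negb_involutive. Qed.

Lemma vp_nil p : vp p [].
Proof. intros l []. Qed.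

Lemma vp_app p u v : vp p (u ++ v) <-> vp p u /\ vp p v.
Proof.
  unfold vp; split.
  - intros H; split; intros l Hl; apply H, in_or_app; tauto.
  - intros [H1 H2] l Hl; apply in_app_or in Hl; firstorder.
Qed.

Lemma vp_cons p l w : vp p (l :: w) <-> fst l < p /\ vp p w.
Proof.
  unfold vp; split.
  - intros H; split; [apply H; now left | intros x Hx; apply H; now right].
  - intros [H1 H2] x [<-|Hx]; auto.
Qed.

Lemma vp_winv p w : vp p w -> vp p (winv w).
Proof.
  intros H l Hl; unfold winv in Hl.
  apply in_rev, in_map_iff in Hl; destruct Hl as [x [<- Hx]]; exact (H x Hx).
Qed.

Lemma vp_rev p w : vp p w -> vp p (rev w).
Proof. intros H l Hl; apply H, in_rev, Hl. Qed.

Lemma vp_mono p q w : p <= q -> vp p w -> vp q w.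
Proof. intros Hpq H l Hl; specialize (H l Hl); lia. Qed.

Lemma winv_length w : length (winv w) = length w.
Proof. unfold winv; now rewrite length_rev, length_map. Qed.

Lemma winv_app u v : winv (u ++ v) = winv v ++ winv u.
Proof. unfold winv; now rewrite map_app, rev_app_distr. Qed.

Lemma winv_cons l w : winv (l :: w) = winv w ++ [inv_letter l].
Proof. reflexivity. Qed.

Lemma winvK w : winv (winv w) = w.
Proof.
  induction w as [|l w IH]; [reflexivity|].
  rewrite winv_cons, winv_app, IH; simpl; now rewrite inv_letterK.
Qed.

(** * Groups of words modulo a congruence *)

Record word_congruence (E : word -> word -> Prop) : Prop := {
  wc_refl : forall u, E u u;
  wc_sym : forall u v, E u v -> E v u;
  wc_trans : forall u v w, E u v -> E v w -> E u w;
  wc_app : forall u u' v v', E u u' -> E v v' -> E (u ++ v) (u' ++ v');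
  wc_cancel : forall l, E [l; inv_letter l] []
}.

Section Quotient.
Variable E : word -> word -> Prop.
Hypothesis HE : word_congruence E.
Variable p : nat.

Let Erefl := wc_refl E HE.
Let Esym := wc_sym E HE.
Let Etrans := wc_trans E HE.
Let Eapp := wc_app E HE.

Lemma E_winv_r w : E (w ++ winv w) [].
Proof.
  induction w as [|l w IH]; [apply Erefl|].
  rewrite winv_cons. replace ((l :: w) ++ winv w ++ [inv_letter l])
    with ([l] ++ ((w ++ winv w) ++ [inv_letter l])) by (simpl; now rewrite <- app_assoc).
  eapply Etrans; [apply Eapp; [apply Erefl | apply Eapp; [apply IH | apply Erefl]]|].
  apply (wc_cancel E HE).
Qed.

Lemma E_winv_l w : E (winv w ++ w) [].
Proof. pose proof (E_winv_r (winv w)) as H; now rewrite winvK in H. Qed.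

Lemma E_cancel_l u v w : E (u ++ v) (u ++ w) -> E v w.
Proof.
  intros H.
  assert (H1 : forall x, E x (winv u ++ (u ++ x))).
  { intros x; rewrite app_assoc. apply Esym.
    eapply Etrans; [apply Eapp; [apply E_winv_l | apply Erefl]|]. apply Erefl. }
  eapply Etrans; [apply H1|]. eapply Etrans; [|apply Esym, H1].
  apply Eapp; [apply Erefl | exact H].
Qed.

Lemma E_move u v w : E (u ++ v) w <-> E v (winv u ++ w).
Proof.
  split; intros H.
  - apply (E_cancel_l u). eapply Etrans; [apply H|]. rewrite app_assoc. apply Esym.
    eapply Etrans; [apply Eapp; [apply E_winv_r | apply Erefl]|]. apply Erefl.
  - eapply Etrans; [apply Eapp; [apply Erefl | apply H]|]. rewrite app_assoc.
    eapply Etrans; [apply Eapp; [apply E_winv_r | apply Erefl]|]. apply Erefl.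
Qed.

Lemma E_winv u v : E u v -> E (winv u) (winv v).
Proof.
  intros H. apply (E_cancel_l u). eapply Etrans; [apply E_winv_r|]. apply Esym.
  eapply Etrans; [apply Eapp; [apply H | apply Erefl]|]. apply E_winv_r.
Qed.

(** Classes are kept as predicates: extensionality and proof irrelevance turn equivalence of
    representatives into equality, which the group laws require. *)
Definition qcar : Type := {P : word -> Prop | exists w, vp p w /\ P = E w}.

Definition qcls (w : word) (H : vp p w) : qcar :=
  exist _ (E w) (ex_intro _ w (conj H eq_refl)).

Definition qrep (g : qcar) : word :=
  proj1_sig (constructive_indefinite_description _ (proj2_sig g)).

Lemma qrep_vp g : vp p (qrep g).
Proof. unfold qrep; destruct constructive_indefinite_description as [w [H1 H2]]; exact H1. Qed.

Lemma qrep_val g : proj1_sig g = E (qrep g).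
Proof. unfold qrep; destruct constructive_indefinite_description as [w [H1 H2]]; exact H2. Qed.

Lemma qrep_inj g h : E (qrep g) (qrep h) -> g = h.
Proof.
  intros H. apply eq_sig_hprop; [intros; apply proof_irrelevance|].
  rewrite !qrep_val. extensionality x. apply propositional_extensionality.
  split; intros Hx; [apply (Etrans _ (qrep g)); auto | apply (Etrans _ (qrep h)); auto].
Qed.

Lemma qrep_cls w H : E (qrep (qcls w H)) w.
Proof.
  pose proof (qrep_val (qcls w H)) as H1; simpl in H1.
  change (E (qrep (qcls w H)) w). rewrite <- H1. apply Erefl.
Qed.

Definition qmul (g h : qcar) : qcar :=
  qcls (qrep g ++ qrep h) (proj2 (vp_app p _ _) (conj (qrep_vp g) (qrep_vp h))).
Definition qone : qcar := qcls [] (vp_nil p).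
Definition qinv (g : qcar) : qcar := qcls (winv (qrep g)) (vp_winv p _ (qrep_vp g)).

Lemma qrep_mul g h : E (qrep (qmul g h)) (qrep g ++ qrep h).
Proof. apply qrep_cls. Qed.

Lemma qmulA x y z : qmul x (qmul y z) = qmul (qmul x y) z.
Proof.
  apply qrep_inj.
  eapply Etrans; [apply qrep_mul|].
  eapply Etrans; [apply Eapp; [apply Erefl | apply qrep_mul]|]. apply Esym.
  eapply Etrans; [apply qrep_mul|].
  eapply Etrans; [apply Eapp; [apply qrep_mul | apply Erefl]|].
  rewrite app_assoc; apply Erefl.
Qed.

Lemma qmul1 x : qmul qone x = x.
Proof.
  apply qrep_inj. eapply Etrans; [apply qrep_mul|].
  eapply Etrans; [apply Eapp; [apply qrep_cls | apply Erefl]|]. apply Erefl.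
Qed.

Lemma qmulV x : qmul (qinv x) x = qone.
Proof.
  apply qrep_inj. eapply Etrans; [apply qrep_mul|].
  eapply Etrans; [apply Eapp; [apply qrep_cls | apply Erefl]|].
  eapply Etrans; [apply E_winv_l|]. apply Esym, qrep_cls.
Qed.

Definition qgroup : group := Group qcar qmul qone qinv qmulA qmul1 qmulV.

Definition qgen (i : nat) : qgroup :=
  match lt_dec i p with
  | left H => qcls [(i, false)] (proj2 (vp_cons p (i, false) []) (conj H (vp_nil p)))
  | right _ => qone
  end.

Definition qgens (p' : nat) : list qgroup := map qgen (seq 0 p').

Lemma qgens_length p' : length (qgens p') = p'.
Proof. unfold qgens; now rewrite length_map, length_seq. Qed.

Lemma qgens_valid p' w : valid (qgens p') w <-> vp p' w.
Proof. unfold valid, vp; now rewrite qgens_length. Qed.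

Lemma qrep_letter p' l : p' <= p -> fst l < p' -> E (qrep (eval_letter (qgens p') l)) [l].
Proof.
  intros Hp Hl. unfold eval_letter, qgens.
  rewrite (nth_indep _ _ (qgen 0)) by now rewrite length_map, length_seq.
  rewrite map_nth, seq_nth by exact Hl. simpl plus.
  assert (H : E (qrep (qgen (fst l))) [(fst l, false)]).
  { unfold qgen; destruct (lt_dec (fst l) p); [apply qrep_cls | lia]. }
  destruct l as [i []]; simpl in *.
  - eapply Etrans; [apply qrep_cls|]. apply (E_winv _ _ H).
  - exact H.
Qed.

Lemma qrep_eval p' w : p' <= p -> vp p' w -> E (qrep (eval (qgens p') w)) w.
Proof.
  intros Hp; induction w as [|l w IH]; intros Hw; [apply qrep_cls|].
  apply vp_cons in Hw; destruct Hw as [Hl Hw].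
  eapply Etrans; [apply qrep_mul|].
  change (l :: w) with ([l] ++ w). apply Eapp; [now apply qrep_letter | now apply IH].
Qed.

Lemma qeval_eq p' w g : p' <= p -> vp p' w -> (eval (qgens p') w = g <-> E w (qrep g)).
Proof.
  intros Hp Hw; split.
  - intros <-. apply Esym, qrep_eval; auto.
  - intros H. apply qrep_inj. eapply Etrans; [apply qrep_eval; auto | exact H].
Qed.

Lemma qgens_generate : generates (qgens p) (fun _ => True).
Proof.
  intros g; split; [intros _ | auto].
  exists (qrep g); split; [apply qgens_valid, qrep_vp|].
  apply qeval_eq; auto using qrep_vp.
Qed.

Definition qsub (p' : nat) (g : qgroup) : Prop := exists w, vp p' w /\ E (qrep g) w.

Lemma qsub_generate p' : p' <= p -> generates (qgens p') (qsub p').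
Proof.
  intros Hp g; split.
  - intros [w [Hw H]]; exists w; split; [now apply qgens_valid|].
    apply qeval_eq; auto.
  - intros [w [Hw H]]; apply (qgens_valid p') in Hw; exists w; split; [exact Hw|].
    apply Esym; apply qeval_eq in H; auto.
Qed.

Lemma qsub_subgroup p' : subgroup (qsub p').
Proof.
  split; [|split].
  - exists []; split; [apply vp_nil | apply qrep_cls].
  - intros x y [u [Hu H1]] [v [Hv H2]]. exists (u ++ v); split; [now apply vp_app|].
    eapply Etrans; [apply qrep_mul | now apply Eapp].
  - intros x [u [Hu H1]]. exists (winv u); split; [now apply vp_winv|].
    eapply Etrans; [apply qrep_cls | now apply E_winv].
Qed.

Lemma qword_dle p' g h t : p' <= p ->
  (word_dle (qgens p') g h t <->
   exists w, vp p' w /\ (INR (length w) <= t)%R /\ E (qrep g ++ w) (qrep h)).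
Proof.
  intros Hp; split; intros [w [Hw [Hl H]]]; exists w.
  - apply (qgens_valid p') in Hw; repeat split; auto.
    apply qeval_eq in H; auto. apply E_move.
    eapply Etrans; [exact H|]. eapply Etrans; [apply qrep_mul|].
    apply Eapp; [apply qrep_cls | apply Erefl].
  - split; [now apply qgens_valid|]. split; [exact Hl|].
    apply qeval_eq; auto. apply E_move in H.
    eapply Etrans; [exact H|]. apply Esym. eapply Etrans; [apply qrep_mul|].
    apply Eapp; [apply qrep_cls | apply Erefl].
Qed.

Lemma rel_eq_sound (Rl : word -> Prop) u v :
  (forall r, Rl r -> E r []) -> rel_eq Rl u v -> E u v.
Proof.
  intros HR H; induction H as [w|u v _ IH|u v w _ IH1 _ IH2|u v l|u v r Hr].
  - apply Erefl.
  - now apply Esym.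
  - now apply (Etrans u v w).
  - apply Eapp; [apply Erefl|]. change (l :: inv_letter l :: v) with ([l; inv_letter l] ++ v).
    apply (Eapp _ [] _ _); [apply (wc_cancel E HE) | apply Erefl].
  - apply Eapp; [apply Erefl|]. apply (Eapp _ [] _ _); [now apply HR | apply Erefl].
Qed.

Lemma qgens_rec_presented p' : p' <= p ->
  re_words (fun w => vp p' w /\ E w []) -> rec_presented (qgens p').
Proof.
  intros Hp Hre. exists (fun w => vp p' w /\ E w []). split; [exact Hre|]. split.
  - intros r [H _]; now apply qgens_valid.
  - intros w Hw; apply (qgens_valid p') in Hw.
    assert (H1 : eval (qgens p') w = gone <-> E w []).
    { rewrite qeval_eq by auto.
      split; intros H; (eapply Etrans; [exact H|]); [|apply Esym]; apply qrep_cls. }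
    rewrite H1. split.
    + intros H. pose proof (re_rel (fun w => vp p' w /\ E w []) [] [] w (conj Hw H)) as H2.
      simpl in H2; now rewrite app_nil_r in H2.
    + intros H; apply (rel_eq_sound (fun w => vp p' w /\ E w [])); [tauto | exact H].
Qed.

(* The common shape of the word metrics on the group and on its subgroup generated by the
   letters below [p']: points are represented by words, distances are lengths of connecting words. *)
Definition word_model (X : Type) (dle : X -> X -> R -> Prop) (p' : nat) (rp : X -> word) : Prop :=
  (forall x, vp p' (rp x)) /\ (forall w, vp p' w -> exists x, E (rp x) w) /\
  (forall x y t, dle x y t <->
     exists w, vp p' w /\ (INR (length w) <= t)%R /\ E (rp x ++ w) (rp y)).

Lemma qgroup_model : exists rp, word_model qgroup (word_dle (qgens p)) p rp.
Proof.
  exists qrep; split; [apply qrep_vp|]. split.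
  - intros w Hw; exists (qcls w Hw); apply qrep_cls.
  - intros; now apply qword_dle.
Qed.

Lemma qsub_model p' : p' <= p ->
  exists rp, word_model {g : qgroup | qsub p' g} (sub_word_dle (qsub p') (qgens p')) p' rp.
Proof.
  intros Hp.
  exists (fun x : {g : qgroup | qsub p' g} => proj1_sig (constructive_indefinite_description
    (fun w => vp p' w /\ E (qrep (proj1_sig x)) w) (proj2_sig x))).
  split; [|split].
  - intros x; destruct constructive_indefinite_description as [w [H1 H2]]; exact H1.
  - intros w Hw.
    assert (Hs : qsub p' (qcls w (vp_mono _ _ _ Hp Hw)))
      by (exists w; split; [exact Hw | apply qrep_cls]).
    exists (exist _ _ Hs).
    destruct constructive_indefinite_description as [w' [H1 H2]]; simpl in *.
    eapply Etrans; [apply Esym, H2 | apply qrep_cls].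
  - intros x y t. unfold sub_word_dle. rewrite qword_dle by exact Hp.
    destruct (constructive_indefinite_description _ (proj2_sig x)) as [wx [Hx1 Hx2]].
    destruct (constructive_indefinite_description _ (proj2_sig y)) as [wy [Hy1 Hy2]]; simpl.
    split; intros [w [Hw [Hl H]]]; exists w; repeat split; auto.
    + eapply Etrans; [apply Eapp; [apply Esym, Hx2 | apply Erefl]|].
      eapply Etrans; [exact H | exact Hy2].
    + eapply Etrans; [apply Eapp; [apply Hx2 | apply Erefl]|].
      eapply Etrans; [exact H | apply Esym, Hy2].
Qed.

End Quotient.

(** * Free reduction and weighted letter counts *)

Definition push (l : letter) (st : word) : word :=
  match st with
  | h :: tl => if letter_eq_dec h (inv_letter l) then tl else l :: st
  | [] => [l]
  end.

Definition step (A : letter -> bool) (st : word) (l : letter) : word :=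
  if A l then push l st else st.

(* Reduced words are stacks: the last letter comes first. *)
Definition run (A : letter -> bool) (w st : word) : word := fold_left (step A) w st.

Fixpoint reduced (st : word) : Prop :=
  match st with
  | [] => True
  | l :: st' => match st' with [] => True | h :: _ => h <> inv_letter l end /\ reduced st'
  end.

Definition sg (b : bool) : Z := if b then (-1)%Z else 1%Z.

Lemma sg_neg b : sg (negb b) = (- sg b)%Z.
Proof. now destruct b. Qed.

Lemma reduced_push l st : reduced st -> reduced (push l st).
Proof.
  destruct st as [|h st]; simpl; [auto|]. intros [H1 H2].
  destruct (letter_eq_dec h (inv_letter l)); [exact H2|]. simpl; auto.
Qed.

Lemma push_push l st : reduced st -> push (inv_letter l) (push l st) = st.
Proof.
  destruct st as [|h st]; simpl.
  - intros _. destruct (letter_eq_dec l (inv_letter (inv_letter l))) as [_|H]; [reflexivity|].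
    now rewrite inv_letterK in H.
  - intros [H1 H2]. destruct (letter_eq_dec h (inv_letter l)) as [->|Hn].
    + destruct st as [|h' st]; [reflexivity|]. simpl.
      rewrite inv_letterK in *. destruct (letter_eq_dec h' l) as [->|]; [|reflexivity].
      simpl in H1; contradiction.
    + simpl. rewrite inv_letterK. destruct (letter_eq_dec l l); [reflexivity|contradiction].
Qed.

Lemma push_reduced l st : reduced (l :: st) -> push l st = l :: st.
Proof.
  destruct st as [|h st]; simpl; [reflexivity|]. intros [H _].
  destruct (letter_eq_dec h (inv_letter l)); [contradiction|reflexivity].
Qed.

Section Run.
Variable A : letter -> bool.
Hypothesis HA : forall l, A (inv_letter l) = A l.

Lemma run_app u v st : run A (u ++ v) st = run A v (run A u st).
Proof. apply fold_left_app. Qed.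

Lemma reduced_run w st : reduced st -> reduced (run A w st).
Proof.
  revert st; induction w as [|l w IH]; intros st H; [exact H|].
  apply IH. unfold step; destruct (A l); [now apply reduced_push | exact H].
Qed.

Lemma run_in w st l : In l (run A w st) -> In l st \/ (In l w /\ A l = true).
Proof.
  revert st; induction w as [|x w IH]; intros st H; simpl in *; [auto|].
  apply IH in H. destruct H as [H|[H1 H2]]; [|tauto].
  unfold step in H; destruct (A x) eqn:Ax; [|tauto].
  destruct st as [|h st]; simpl in H.
  - destruct H as [<-|[]]; tauto.
  - destruct (letter_eq_dec h (inv_letter x)); simpl in H; [simpl; tauto|].
    destruct H as [<-|H]; simpl; tauto.
Qed.

Lemma run_length w st : length (run A w st) <= length st + length w.
Proof.
  revert st; induction w as [|x w IH]; intros st; simpl; [lia|].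
  eapply Nat.le_trans; [apply IH|].
  unfold step, push; destruct (A x); destruct st as [|h st]; simpl; try lia.
  destruct letter_eq_dec; simpl; lia.
Qed.

Lemma step_inv l st : reduced st -> step A (step A st l) (inv_letter l) = st.
Proof.
  intros H; unfold step; rewrite HA. destruct (A l); [now apply push_push | reflexivity].
Qed.

Lemma run_winv w st : reduced st -> run A (winv w) (run A w st) = st.
Proof.
  revert st; induction w as [|l w IH]; intros st H; [reflexivity|].
  rewrite winv_cons, run_app. simpl run at 3. simpl.
  change (fold_left (step A) w (step A st l)) with (run A w (step A st l)).
  assert (reduced (step A st l)) by (unfold step; destruct (A l); auto using reduced_push).
  rewrite IH by assumption. now apply step_inv.
Qed.

(** A word acts on reduced stacks only through its reduced form: this is the free group acting on
    its Cayley tree. *)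
Lemma run_rev_run w st : reduced st -> run A w st = run A (rev (run A w [])) st.
Proof.
  intros Hst; induction w as [|l w IH] using rev_ind; [reflexivity|].
  rewrite !run_app, IH. change (run A [l]) with (fun s => step A s l). cbn beta.
  destruct (A l) eqn:Al.
  2:{ unfold step; rewrite Al; reflexivity. }
  assert (S : forall s, step A s l = push l s) by (intros s; unfold step; now rewrite Al).
  rewrite !S.
  pose proof (reduced_run w [] I) as HR.
  destruct (run A w []) as [|h R] eqn:ER; [simpl; now rewrite S|].
  simpl push at 2. destruct (letter_eq_dec h (inv_letter l)) as [->|Hn].
  - simpl rev. rewrite run_app. change (run A [inv_letter l]) with (fun s => step A s (inv_letter l)).
    cbn beta. rewrite <- S. rewrite <- (inv_letterK l) at 2.
    apply step_inv. now apply reduced_run.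
  - change (rev (l :: h :: R)) with (rev (h :: R) ++ [l]). rewrite run_app.
    symmetry. apply S.
Qed.

Lemma run_rev_reduced st : reduced st -> (forall l, In l st -> A l = true) ->
  run A (rev st) [] = st.
Proof.
  induction st as [|l st IH]; intros H1 H2; [reflexivity|].
  simpl rev. rewrite run_app, IH; [|apply H1 | intros; apply H2; now right].
  simpl. unfold step. rewrite H2 by now left. now apply push_reduced.
Qed.

Lemma run_cong u u' v v' :
  run A u [] = run A u' [] -> run A v [] = run A v' [] -> run A (u ++ v) [] = run A (u' ++ v') [].
Proof.
  intros H1 H2. rewrite !run_app, <- H1.
  assert (HR := reduced_run u [] I).
  now rewrite (run_rev_run v), (run_rev_run v'), H2.
Qed.

Lemma run_id w : (forall l, In l w -> A l = false) -> forall st, run A w st = st.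
Proof.
  induction w as [|l w IH]; intros H st; [reflexivity|].
  change (run A (l :: w) st) with (run A w (step A st l)).
  unfold step; rewrite H by now left. apply IH; intros; apply H; now right.
Qed.

End Run.

Section Sums.
Variable sh : letter -> Z.
Hypothesis sh_inv : forall l, sh (inv_letter l) = (- sh l)%Z.

Fixpoint possum (w : word) : Z :=
  match w with [] => 0%Z | l :: w' => (sh l + possum w')%Z end.

(* Positions of letters are measured from the end of the word: the letter [l] in
   [u ++ l :: v] sits at position [- possum (l :: v)]. *)
Fixpoint lsum (m : letter -> Z) (phi : Z -> Z) (w : word) : Z :=
  match w with
  | [] => 0%Z
  | l :: w' => (m l * phi (possum w) + lsum m phi w')%Z
  end.

Lemma possum_app u v : possum (u ++ v) = (possum u + possum v)%Z.
Proof. induction u as [|l u IH]; simpl; [reflexivity | rewrite IH; lia]. Qed.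

Lemma possum_winv u : possum (winv u) = (- possum u)%Z.
Proof.
  induction u as [|l u IH]; [reflexivity|].
  rewrite winv_cons, possum_app, IH. simpl. rewrite sh_inv. lia.
Qed.

Lemma lsum_app m phi u v :
  lsum m phi (u ++ v) = (lsum m (fun p => phi (p + possum v)) u + lsum m phi v)%Z.
Proof.
  induction u as [|l u IH]; [reflexivity|].
  cbn [app lsum]. rewrite IH. change (l :: u ++ v) with ((l :: u) ++ v).
  rewrite possum_app. ring.
Qed.

Lemma lsum_ext m phi psi w : (forall p, phi p = psi p) -> lsum m phi w = lsum m psi w.
Proof. intros H; induction w as [|l w IH]; simpl; [reflexivity | now rewrite IH, H]. Qed.

Lemma lsum_zero m phi w : (forall l, In l w -> m l = 0%Z) -> lsum m phi w = 0%Z.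
Proof.
  induction w as [|l w IH]; intros H; [reflexivity|].
  cbn [lsum]. rewrite IH by (intros; apply H; now right). rewrite H by now left. ring.
Qed.

Lemma lsum_zero_fun m phi w : (forall p, phi p = 0%Z) -> lsum m phi w = 0%Z.
Proof. intros H; induction w as [|l w IH]; simpl; [reflexivity | rewrite IH, H; ring]. Qed.

Lemma lsum_scale m phi k w : lsum m (fun p => k * phi p)%Z w = (k * lsum m phi w)%Z.
Proof. induction w as [|l w IH]; simpl; [lia | rewrite IH; ring]. Qed.

Variables (A : letter -> bool) (m : letter -> Z).
Hypothesis HA : forall l, A (inv_letter l) = A l.
Hypothesis HAs : forall l, A l = false -> sh l = 0%Z.
Hypothesis HAm : forall l, A l = false -> m l = 0%Z.
Hypothesis m_inv : forall l, m (inv_letter l) = (- m l)%Z.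
Hypothesis m_sh : forall l, m l <> 0%Z -> sh l = 0%Z.

Lemma possum_run w : possum w = possum (rev (run A w [])).
Proof.
  induction w as [|l w IH] using rev_ind; [reflexivity|].
  rewrite run_app, possum_app, IH. simpl. unfold step.
  destruct (A l) eqn:Al; [|rewrite HAs by exact Al; lia].
  destruct (run A w []) as [|h R]; simpl; [lia|].
  destruct (letter_eq_dec h (inv_letter l)) as [->|Hn].
  - rewrite possum_app. simpl. rewrite sh_inv. lia.
  - simpl. rewrite !possum_app. simpl. lia.
Qed.

(** A cancelled pair carries opposite weights at the same position, because by [m_sh] a letter of
    nonzero weight does not move. *)
Lemma lsum_run w phi : lsum m phi w = lsum m phi (rev (run A w [])).
Proof.
  revert phi; induction w as [|l w IH] using rev_ind; intros phi; [reflexivity|].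
  rewrite run_app, lsum_app, IH. simpl. unfold step.
  destruct (A l) eqn:Al.
  2:{ rewrite HAm, HAs by exact Al.
      rewrite (lsum_ext _ _ phi) by (intros; f_equal; lia). lia. }
  destruct (run A w []) as [|h R]; [reflexivity|]. simpl push.
  destruct (letter_eq_dec h (inv_letter l)) as [->|Hn].
  - simpl rev. rewrite lsum_app. cbn [lsum possum]. rewrite m_inv, sh_inv.
    rewrite (lsum_ext _ _ phi) by (intros; f_equal; lia).
    destruct (Z.eq_dec (m l) 0) as [E|E]; [rewrite E; lia|].
    rewrite (m_sh l E). simpl. lia.
  - simpl rev. rewrite !lsum_app. simpl. ring.
Qed.

Lemma possum_divide g w : (forall l, In l w -> (g | sh l)%Z) -> (g | possum w)%Z.
Proof.
  induction w as [|l w IH]; intros H; [apply Z.divide_0_r|].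
  cbn [possum]. apply Z.divide_add_r; [apply H; now left | apply IH; intros; apply H; now right].
Qed.

Lemma possum_bound w K : (forall l, In l w -> (Z.abs (sh l) <= K)%Z) ->
  (Z.abs (possum w) <= K * Z.of_nat (length w))%Z.
Proof.
  induction w as [|l w IH]; intros H; [simpl; lia|].
  cbn [possum length]. assert (H1 := H l (or_introl eq_refl)).
  assert (H2 : (Z.abs (possum w) <= K * Z.of_nat (length w))%Z)
    by (apply IH; intros; apply H; now right). lia.
Qed.

(** [P] records what is known about the positions of suffixes, for example divisibility by a step
    size or a bound on their size. *)
Lemma lsum_bound phi w M (P : Z -> Prop) :
  (0 <= M)%Z -> (forall l, Z.abs (m l) <= 1)%Z ->
  (forall u v, w = u ++ v -> P (possum v)) ->
  (forall p, P p -> (Z.abs (phi p) <= M)%Z) ->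
  (Z.abs (lsum m phi w) <= M * Z.of_nat (length w))%Z.
Proof.
  intros HM Hm HP Hphi. induction w as [|l w IH]; [simpl; lia|].
  cbn [lsum length].
  assert (H1 : (Z.abs (lsum m phi w) <= M * Z.of_nat (length w))%Z).
  { apply IH; intros u v E; apply (HP (l :: u)); simpl; now rewrite E. }
  assert (H2 := Hphi _ (HP [] (l :: w) eq_refl)). specialize (Hm l).
  assert (Z.abs (m l * phi (possum (l :: w))) <= M)%Z by (rewrite Z.abs_mul; nia). lia.
Qed.

Lemma lsum_vanish phi w (P : Z -> Prop) :
  (forall u v, w = u ++ v -> P (possum v)) -> (forall p, P p -> phi p = 0%Z) ->
  lsum m phi w = 0%Z.
Proof.
  intros HP Hphi. induction w as [|l w IH]; [reflexivity|].
  cbn [lsum]. rewrite (Hphi (possum (l :: w))) by exact (HP [] (l :: w) eq_refl).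
  rewrite IH; [lia|]. intros u v E; apply (HP (l :: u)); simpl; now rewrite E.
Qed.

End Sums.

(** * The groups *)

Fixpoint Dn (s : nat) : nat := match s with 0 => 4 | S s' => Dn s' ^ 8 end.

(* Letters: 0 is a, 1 is b, 2 is t, then [c] letters generating a free abelian factor,
   and [3 + c] is q. *)
Definition shift (c : nat) (l : letter) : Z :=
  if fst l =? 2 then (4 * sg (snd l))%Z else if fst l =? 3 + c then sg (snd l) else 0%Z.
Definition inU (c : nat) (l : letter) : bool := (fst l =? 0) || (fst l =? 2) || (fst l =? 3 + c).
Definition inV (c : nat) (l : letter) : bool := (fst l =? 1) || (fst l =? 2) || (fst l =? 3 + c).
Definition mlet (i : nat) (l : letter) : Z := if fst l =? i then sg (snd l) else 0%Z.

Definition Ured (c : nat) (w : word) : word := run (inU c) w [].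
Definition Vred (c : nat) (w : word) : word := run (inV c) w [].
Definition pos (c : nat) (w : word) : Z := possum (shift c) w.
Definition asum (c : nat) (phi : Z -> Z) (w : word) : Z := lsum (shift c) (mlet 0) phi w.
Definition bsum (c : nat) (f : Z -> Z) (q : Z) (w : word) : Z :=
  lsum (shift c) (mlet 1) (fun p => f (q - p)%Z) w.
Definition expo (i : nat) (w : word) : Z := lsum (fun _ => 0%Z) (mlet i) (fun _ => 1%Z) w.

(* The sum of [f (pos b - pos a)] over the pairs consisting of a letter a followed by a letter b. *)
Fixpoint cent (c : nat) (f : Z -> Z) (w : word) : Z :=
  match w with
  | [] => 0%Z
  | l :: w' => (mlet 0 l * bsum c f (pos c w) w' + cent c f w')%Z
  end.

(* The commutator of a with the conjugate of b by a word of position p contributes [fsi p] to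
   the central coordinate (s, i): position 4 * slot s i gives the generator and the next three
   positions, which only q can reach, give its powers with exponents B, B^2, B^3. *)
Definition slot (s i : nat) : nat := Dn s * 2 ^ i.

Definition fsi (B : nat -> nat -> Z) (s i : nat) (p : Z) : Z :=
  let q := (p - 4 * Z.of_nat (slot s i))%Z in
  if ((0 <=? q) && (q <? 4))%Z then (B s i ^ q)%Z else 0%Z.

Record weq (c : nat) (N B : nat -> nat -> Z) (u v : word) : Prop := {
  weq_U : Ured c u = Ured c v;
  weq_V : Vred c u = Vred c v;
  weq_e : forall i, 3 <= i < 3 + c -> expo i u = expo i v;
  weq_Z : forall s i, (N s i | cent c (fsi B s i) u - cent c (fsi B s i) v)%Z
}.

(** * Invariance of the weighted counts under free cancellation *)

Section Invariants.
Variable c : nat.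

Lemma shift_inv l : shift c (inv_letter l) = (- shift c l)%Z.
Proof.
  destruct l as [i b]; unfold shift, inv_letter; cbn [fst snd]. rewrite sg_neg.
  destruct (i =? 2), (i =? 3 + c); lia.
Qed.
Lemma inU_inv l : inU c (inv_letter l) = inU c l. Proof. reflexivity. Qed.
Lemma inV_inv l : inV c (inv_letter l) = inV c l. Proof. reflexivity. Qed.
Lemma mlet_inv i l : mlet i (inv_letter l) = (- mlet i l)%Z.
Proof.
  destruct l as [j b]; unfold mlet, inv_letter; cbn [fst snd]. rewrite sg_neg.
  destruct (j =? i); lia.
Qed.
Lemma inU_shift l : inU c l = false -> shift c l = 0%Z.
Proof. unfold inU, shift. destruct (fst l =? 0), (fst l =? 2), (fst l =? 3 + c); simpl; congruence. Qed.
Lemma inV_shift l : inV c l = false -> shift c l = 0%Z.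
Proof. unfold inV, shift. destruct (fst l =? 1), (fst l =? 2), (fst l =? 3 + c); simpl; congruence. Qed.
Lemma inU_m l : inU c l = false -> mlet 0 l = 0%Z.
Proof. unfold inU, mlet. destruct (fst l =? 0); simpl; congruence. Qed.
Lemma inV_m l : inV c l = false -> mlet 1 l = 0%Z.
Proof. unfold inV, mlet. destruct (fst l =? 1); simpl; congruence. Qed.
Lemma mlet_shift i l : i < 2 -> mlet i l <> 0%Z -> shift c l = 0%Z.
Proof.
  unfold mlet, shift. intros Hi. destruct (Nat.eqb_spec (fst l) i); [|congruence].
  destruct (Nat.eqb_spec (fst l) 2); [lia|]. destruct (Nat.eqb_spec (fst l) (3 + c)); [lia|]. reflexivity.
Qed.
Lemma mlet_abs i l : (Z.abs (mlet i l) <= 1)%Z.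
Proof. unfold mlet; destruct (fst l =? i), (snd l); simpl; lia. Qed.

Lemma pos_app u v : pos c (u ++ v) = (pos c u + pos c v)%Z.
Proof. apply possum_app. Qed.
Lemma pos_winv u : pos c (winv u) = (- pos c u)%Z.
Proof. apply possum_winv, shift_inv. Qed.
Lemma pos_V w : pos c w = pos c (rev (Vred c w)).
Proof. apply possum_run; auto using shift_inv, inV_shift. Qed.
Lemma asum_U w phi : asum c phi w = asum c phi (rev (Ured c w)).
Proof.
  apply lsum_run; auto using shift_inv, inU_shift, inU_m; intros l;
    [apply mlet_inv | apply mlet_shift; lia].
Qed.
Lemma bsum_V w f q : bsum c f q w = bsum c f q (rev (Vred c w)).
Proof.
  apply lsum_run; auto using shift_inv, inV_shift, inV_m; intros l;
    [apply mlet_inv | apply mlet_shift; lia].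
Qed.
Lemma asum_app phi u v : asum c phi (u ++ v) = (asum c (fun p => phi (p + pos c v)%Z) u + asum c phi v)%Z.
Proof. apply lsum_app. Qed.
Lemma bsum_app f q u v : bsum c f q (u ++ v) = (bsum c f (q - pos c v)%Z u + bsum c f q v)%Z.
Proof.
  unfold bsum; rewrite lsum_app. f_equal. apply lsum_ext. intros; f_equal. unfold pos. lia.
Qed.
Lemma expo_app i u v : expo i (u ++ v) = (expo i u + expo i v)%Z.
Proof. apply lsum_app. Qed.
Lemma expo_cons i l w : expo i (l :: w) = (mlet i l + expo i w)%Z.
Proof. unfold expo; cbn [lsum]; cbv beta; lia. Qed.
Lemma expo_winv i u : expo i (winv u) = (- expo i u)%Z.
Proof.
  induction u as [|l u IH]; [reflexivity|].
  rewrite winv_cons, expo_app, IH, !expo_cons, mlet_inv.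
  change (expo i []) with 0%Z. lia.
Qed.

Lemma asum_ext phi psi w : (forall p, phi p = psi p) -> asum c phi w = asum c psi w.
Proof. apply lsum_ext. Qed.

(** The last summand is the cocycle of the central extension. It depends on [u] only through [Ured]
    and on [v] only through [Vred], which makes [weq] compatible with concatenation. *)
Lemma cent_app f u v : cent c f (u ++ v) =
  (cent c f u + cent c f v + asum c (fun p => bsum c f (p + pos c v) v)%Z u)%Z.
Proof.
  induction u as [|l u IH]; [unfold asum; cbn [app cent lsum]; lia|].
  cbn [app cent]. rewrite IH, bsum_app. change (l :: u ++ v) with ((l :: u) ++ v).
  rewrite pos_app. unfold asum; cbn [lsum].
  replace (pos c (l :: u) + pos c v - pos c v)%Z with (pos c (l :: u)) by lia.
  unfold pos. ring.
Qed.

Lemma weq_congruence N B : word_congruence (weq c N B).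
Proof.
  split.
  - intros u; split; auto. intros; rewrite Z.sub_diag; apply Z.divide_0_r.
  - intros u v [H1 H2 H3 H4]; split; auto; [intros; symmetry; auto|].
    intros s i. rewrite <- Z.divide_opp_r. destruct (H4 s i) as [y Hy]; exists y; lia.
  - intros u v w [H1 H2 H3 H4] [H1' H2' H3' H4']; split; try congruence.
    + intros; rewrite H3, H3'; auto.
    + intros s i. destruct (H4 s i) as [y Hy], (H4' s i) as [y' Hy']. exists (y + y')%Z. lia.
  - intros u u' v v' [H1 H2 H3 H4] [H1' H2' H3' H4']; split.
    + now apply run_cong.
    + now apply run_cong.
    + intros; rewrite !expo_app, H3, H3'; auto.
    + intros s i. rewrite !cent_app.
      rewrite (asum_U u), (asum_U u'), H1.
      rewrite (asum_ext (fun p => bsum c (fsi B s i) (p + pos c v) v)%Z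
        (fun p => bsum c (fsi B s i) (p + pos c v') v')%Z).
      2:{ intros p; rewrite (bsum_V v), (bsum_V v'), (pos_V v), (pos_V v'), H2'; reflexivity. }
      destruct (H4 s i) as [y Hy], (H4' s i) as [y' Hy']. exists (y + y')%Z. lia.
  - intros l. split.
    + unfold Ured, run; simpl. apply step_inv; [apply inU_inv | exact I].
    + unfold Vred, run; simpl. apply step_inv; [apply inV_inv | exact I].
    + intros i _. rewrite !expo_cons, mlet_inv.
      change (expo i []) with 0%Z. lia.
    + intros s i. exists 0%Z. cbn [cent]. unfold bsum; cbn [lsum].
      rewrite mlet_inv. destruct l as [[|[|j]] b]; unfold mlet; simpl; lia.
Qed.

End Invariants.

Lemma run_congruence A : (forall l, A (inv_letter l) = A l) ->
  word_congruence (fun u v => run A u [] = run A v []).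
Proof.
  intros HA; split; auto.
  - intros; congruence.
  - intros; now apply run_cong.
  - intros l. unfold run; simpl. apply step_inv; [exact HA | exact I].
Qed.

Lemma run_ext A A' w : (forall l, In l w -> A l = A' l) -> forall st, run A w st = run A' w st.
Proof.
  induction w as [|l w IH]; intros H st; [reflexivity|].
  change (run A w (step A st l) = run A' w (step A' st l)).
  unfold step; rewrite H by now left. apply IH; intros; apply H; now right.
Qed.

Lemma run_filter A f w : (forall l, A l = true -> f l = true) ->
  forall st, run A (filter f w) st = run A w st.
Proof.
  intros H; induction w as [|l w IH]; intros st; [reflexivity|].
  change (run A (l :: w) st) with (run A w (step A st l)). simpl.
  destruct (f l) eqn:E; [apply IH|].
  rewrite IH. f_equal. unfold step. destruct (A l) eqn:EA; [|reflexivity].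
  apply H in EA; congruence.
Qed.

Lemma run_sub A A' w : (forall l, A (inv_letter l) = A l) -> (forall l, A' (inv_letter l) = A' l) ->
  (forall l, A' l = true -> A l = true) ->
  run A' w [] = run A' (rev (run A w [])) [].
Proof.
  intros HA HA' Hs; induction w as [|l w IH] using rev_ind; [reflexivity|].
  rewrite !run_app, IH. change (run A [l]) with (fun s => step A s l).
  change (run A' [l]) with (fun s => step A' s l). cbn beta.
  unfold step at 2; destruct (A l) eqn:Al.
  2:{ unfold step; destruct (A' l) eqn:E; [apply Hs in E; congruence | reflexivity]. }
  destruct (run A w []) as [|h R]; [reflexivity|]. simpl push.
  destruct (letter_eq_dec h (inv_letter l)) as [->|Hn].
  - simpl rev. rewrite run_app.
    change (run A' [inv_letter l]) with (fun s => step A' s (inv_letter l)). cbn beta.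
    rewrite <- (inv_letterK l) at 2. apply step_inv; [exact HA' | apply reduced_run; exact I].
  - change (rev (l :: h :: R)) with (rev (h :: R) ++ [l]). rewrite run_app. reflexivity.
Qed.

Lemma run_winv_cancel A x z st : (forall l, A (inv_letter l) = A l) -> reduced st ->
  run A x [] = run A z [] -> run A (winv x ++ z) st = st.
Proof.
  intros HA Hst H. rewrite run_app.
  assert (Hr : reduced (run A (winv x) st)) by now apply reduced_run.
  rewrite (run_rev_run A HA z) by exact Hr. rewrite <- H.
  rewrite <- (run_rev_run A HA x) by exact Hr.
  rewrite <- (winvK x) at 1. now apply run_winv.
Qed.

(** * Lifts from the two trees, visibility of central coordinates, commutators *)

Section Geometry.
Variable c : nat.

Definition isTQ (l : letter) : bool := (fst l =? 2) || (fst l =? 3 + c).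
(** A short lift of the pair of reduced words. In the first tree the inverted t, q part cancels
    against that of the last factor, since both reduced words have the same image in the free group
    on t and q; in the second tree it cancels the image of the first factor. *)
Definition realize (y : word) : word :=
  rev (Ured c y) ++ winv (filter isTQ (rev (Ured c y))) ++ rev (Vred c y).

Lemma isTQ_U l : isTQ l = true -> inU c l = true.
Proof. unfold isTQ, inU. destruct (fst l =? 0), (fst l =? 2), (fst l =? 3 + c); simpl; auto. Qed.
Lemma isTQ_V l : isTQ l = true -> inV c l = true.
Proof. unfold isTQ, inV. destruct (fst l =? 1), (fst l =? 2), (fst l =? 3 + c); simpl; auto. Qed.
Lemma inU_TQ l : inV c l = true -> inU c l = isTQ l.
Proof.
  unfold isTQ, inU, inV. destruct (Nat.eqb_spec (fst l) 0) as [->|]; simpl; [congruence|].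
  reflexivity.
Qed.
Lemma inV_TQ l : inU c l = true -> inV c l = isTQ l.
Proof.
  unfold isTQ, inU, inV. destruct (Nat.eqb_spec (fst l) 1) as [->|]; simpl; [congruence|].
  reflexivity.
Qed.

Lemma Ured_reduced w : reduced (Ured c w). Proof. apply reduced_run; exact I. Qed.
Lemma Vred_reduced w : reduced (Vred c w). Proof. apply reduced_run; exact I. Qed.
Lemma Ured_in w l : In l (Ured c w) -> In l w /\ inU c l = true.
Proof. intros H; apply run_in in H; destruct H as [[]|H]; exact H. Qed.
Lemma Vred_in w l : In l (Vred c w) -> In l w /\ inV c l = true.
Proof. intros H; apply run_in in H; destruct H as [[]|H]; exact H. Qed.
Lemma Ured_rev_Ured w : Ured c (rev (Ured c w)) = Ured c w.
Proof. apply run_rev_reduced; [apply Ured_reduced | intros l Hl; now apply Ured_in in Hl]. Qed.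
Lemma Vred_rev_Vred w : Vred c (rev (Vred c w)) = Vred c w.
Proof. apply run_rev_reduced; [apply Vred_reduced | intros l Hl; now apply Vred_in in Hl]. Qed.

Lemma realize_TQ y : run isTQ (rev (Ured c y)) [] = run isTQ (rev (Vred c y)) [].
Proof.
  unfold Ured, Vred. rewrite <- (run_sub (inU c) isTQ y), <- (run_sub (inV c) isTQ y); auto using isTQ_U, isTQ_V.
Qed.

Lemma realize_U y : Ured c (realize y) = Ured c y.
Proof.
  unfold realize, Ured at 1. rewrite run_app.
  change (run (inU c) (rev (Ured c y)) []) with (Ured c (rev (Ured c y))). rewrite Ured_rev_Ured.
  apply run_winv_cancel; auto using Ured_reduced.
  transitivity (run isTQ (filter isTQ (rev (Ured c y))) []).
  { apply run_ext. intros l Hl; apply filter_In in Hl as [_ Hl]. rewrite Hl. now apply isTQ_U. }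
  rewrite run_filter by auto. rewrite realize_TQ. apply run_ext.
  intros l Hl; apply in_rev, Vred_in in Hl. symmetry; apply inU_TQ; tauto.
Qed.

Lemma realize_V y : Vred c (realize y) = Vred c y.
Proof.
  unfold realize, Vred at 1. rewrite app_assoc, run_app.
  replace (run (inV c) (rev (Ured c y) ++ winv (filter isTQ (rev (Ured c y)))) []) with (@nil letter).
  - apply Vred_rev_Vred.
  - rewrite run_app. symmetry.
    replace (run (inV c) (rev (Ured c y)) [])
      with (run (inV c) (filter isTQ (rev (Ured c y))) []); [apply run_winv; [auto | exact I]|].
    transitivity (run isTQ (filter isTQ (rev (Ured c y))) []).
    { apply run_ext. intros l Hl; apply filter_In in Hl as [_ Hl]. rewrite Hl. now apply isTQ_V. }
    rewrite run_filter by auto. apply run_ext.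
    intros l Hl; apply in_rev, Ured_in in Hl. symmetry; apply inV_TQ; tauto.
Qed.

Lemma realize_vp p y : vp p y -> vp p (realize y).
Proof.
  intros H. unfold realize. rewrite !vp_app. split; [|split].
  - apply vp_rev; intros l Hl; apply H; now apply Ured_in in Hl.
  - apply vp_winv; intros l Hl; apply filter_In in Hl; destruct Hl as [Hl _].
    apply in_rev, Ured_in in Hl; apply H; tauto.
  - apply vp_rev; intros l Hl; apply H; now apply Vred_in in Hl.
Qed.

Lemma filter_length_le' {T} (f : T -> bool) l : length (filter f l) <= length l.
Proof. induction l as [|x l IH]; simpl; [lia|]. destruct (f x); simpl; lia. Qed.

Lemma realize_length y : length (realize y) <= 2 * length (Ured c y) + length (Vred c y).
Proof.
  unfold realize. rewrite !length_app, winv_length, !length_rev.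
  assert (H := filter_length_le' isTQ (rev (Ured c y))). rewrite length_rev in H. lia.
Qed.

Lemma expo_zero i w : (forall l, In l w -> fst l <> i) -> expo i w = 0%Z.
Proof.
  intros H; apply lsum_zero. intros l Hl. unfold mlet.
  destruct (Nat.eqb_spec (fst l) i); [exfalso; now apply (H l) | reflexivity].
Qed.

Lemma inU_not_extra l i : inU c l = true -> 3 <= i < 3 + c -> fst l <> i.
Proof. unfold inU; intros H Hi E; rewrite E in H; apply orb_prop in H as [H|H]; [apply orb_prop in H as [H|H]|]; apply Nat.eqb_eq in H; lia. Qed.
Lemma inV_not_extra l i : inV c l = true -> 3 <= i < 3 + c -> fst l <> i.
Proof. unfold inV; intros H Hi E; rewrite E in H; apply orb_prop in H as [H|H]; [apply orb_prop in H as [H|H]|]; apply Nat.eqb_eq in H; lia. Qed.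

Lemma realize_expo y i : 3 <= i < 3 + c -> expo i (realize y) = 0%Z.
Proof.
  intros Hi. unfold realize. rewrite !expo_app, expo_winv.
  rewrite !expo_zero; [lia| | |]; intros l Hl.
  - apply in_rev, Vred_in in Hl; apply inV_not_extra; tauto.
  - apply filter_In in Hl; destruct Hl as [Hl _]. apply in_rev, Ured_in in Hl; apply inU_not_extra; tauto.
  - apply in_rev, Ured_in in Hl; apply inU_not_extra; tauto.
Qed.

(** Stacks list the last letter first, so the common tail [r] is a common initial part of the two
    words and cancels in the quotient. *)
Lemma red_diff A g h x x' r : (forall l, A (inv_letter l) = A l) ->
  run A g [] = x ++ r -> run A h [] = x' ++ r ->
  run A (winv g ++ h) [] = run A (winv (rev x) ++ rev x') [].
Proof.
  intros HA Hg Hh.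
  pose proof (run_congruence A HA) as HC.
  assert (Eg : run A g [] = run A (rev r ++ rev x) []).
  { rewrite (run_rev_run A HA g) by exact I. now rewrite Hg, rev_app_distr. }
  assert (Eh : run A h [] = run A (rev r ++ rev x') []).
  { rewrite (run_rev_run A HA h) by exact I. now rewrite Hh, rev_app_distr. }
  transitivity (run A (winv (rev r ++ rev x) ++ (rev r ++ rev x')) []).
  { apply run_cong; auto. now apply (E_winv _ HC). }
  rewrite winv_app, <- app_assoc. apply (wc_app _ HC); [reflexivity|].
  rewrite app_assoc. change (rev x') with ([] ++ rev x') at 2.
  apply (wc_app _ HC); [|reflexivity]. apply (E_winv_l _ HC).
Qed.

Lemma red_diff_length A g h x x' r : (forall l, A (inv_letter l) = A l) ->
  run A g [] = x ++ r -> run A h [] = x' ++ r ->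
  length (run A (winv g ++ h) []) <= length x + length x'.
Proof.
  intros HA Hg Hh. rewrite (red_diff A g h x x' r HA Hg Hh).
  eapply Nat.le_trans; [apply run_length|].
  rewrite length_app, winv_length, !length_rev. simpl; lia.
Qed.

(* Positions of words without the letter q are multiples of 4. *)
Definition stepsize (p : nat) : Z := if p <=? 3 + c then 4%Z else 1%Z.

Lemma pos_divide p w : vp p w -> (stepsize p | pos c w)%Z.
Proof.
  intros H. apply possum_divide. intros l Hl; specialize (H l Hl). unfold stepsize, shift.
  destruct (Nat.leb_spec p (3 + c)); [|apply Z.divide_1_l].
  destruct (fst l =? 2); [apply Z.divide_factor_l|].
  destruct (Nat.eqb_spec (fst l) (3 + c)); [lia | apply Z.divide_0_r].
Qed.

Lemma pos_bound w : (Z.abs (pos c w) <= 4 * Z.of_nat (length w))%Z.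
Proof.
  apply possum_bound. intros l _. unfold shift.
  destruct (fst l =? 2), (fst l =? 3 + c), (snd l); simpl; lia.
Qed.

(** Only the positions that words in the letters below [p] can reach are tested. The condition says
    that the coordinate is undistorted for these words: their central value is at most quadratic in
    the length. *)
Definition fbounded (p : nat) (f : Z -> Z) : Prop :=
  forall x, (stepsize p | x)%Z -> (Z.abs (f x) <= 1)%Z.
Definition fvanish (M : Z) (f : Z -> Z) : Prop := forall x, (Z.abs x < M)%Z -> f x = 0%Z.

Lemma bsum_bound p f q w : fbounded p f -> vp p w -> (stepsize p | q)%Z ->
  (Z.abs (bsum c f q w) <= Z.of_nat (length w))%Z.
Proof.
  intros Hf Hw Hq. unfold bsum.
  eapply Z.le_trans; [apply (lsum_bound (shift c)) with (M := 1%Z) (P := fun x => (stepsize p | x)%Z)|].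
  - lia.
  - apply mlet_abs.
  - intros u v ->. apply vp_app in Hw. now apply pos_divide.
  - intros x Hx. apply Hf. now apply Z.divide_sub_r.
  - lia.
Qed.

Lemma cross_bound p f u w : fbounded p f -> vp p u -> vp p w ->
  (Z.abs (asum c (fun x => bsum c f (x + pos c w) w) u)
    <= Z.of_nat (length w) * Z.of_nat (length u))%Z.
Proof.
  intros Hf Hu Hw. unfold asum.
  apply (lsum_bound (shift c)) with (P := fun x => (stepsize p | x)%Z).
  - lia.
  - apply mlet_abs.
  - intros u' v ->. apply vp_app in Hu. now apply pos_divide.
  - intros x Hx. apply (bsum_bound p); auto. apply Z.divide_add_r; auto. now apply pos_divide.
Qed.

Lemma cent_bound p f w : fbounded p f -> vp p w ->
  (Z.abs (cent c f w) <= Z.of_nat (length w) * Z.of_nat (length w))%Z.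
Proof.
  intros Hf. induction w as [|l w IH]; intros Hw; [simpl; lia|].
  assert (Hq := pos_divide p _ Hw). apply vp_cons in Hw. destruct Hw as [_ Hw].
  specialize (IH Hw). cbn [cent length].
  assert (H := bsum_bound p f _ w Hf Hw Hq). assert (H1 := mlet_abs 0 l).
  assert (Z.abs (mlet 0 l * bsum c f (pos c (l :: w)) w) <= Z.of_nat (length w))%Z
    by (rewrite Z.abs_mul; nia). lia.
Qed.

Lemma bsum_vanish M f q w : fvanish M f -> (Z.abs q + 4 * Z.of_nat (length w) < M)%Z ->
  bsum c f q w = 0%Z.
Proof.
  intros Hf HM. apply lsum_vanish with (P := fun x => (Z.abs x <= 4 * Z.of_nat (length w))%Z).
  - intros u v ->. assert (H := pos_bound v). rewrite length_app. unfold pos in H. lia.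
  - intros x Hx. apply Hf. lia.
Qed.

Lemma cross_vanish M f u w : fvanish M f ->
  (4 * Z.of_nat (length u) + 8 * Z.of_nat (length w) < M)%Z ->
  asum c (fun x => bsum c f (x + pos c w) w) u = 0%Z.
Proof.
  intros Hf HM. apply lsum_vanish with (P := fun x => (Z.abs x <= 4 * Z.of_nat (length u))%Z).
  - intros u' v ->. assert (H := pos_bound v). rewrite length_app. unfold pos in H. lia.
  - intros x Hx. apply (bsum_vanish M); auto. assert (H := pos_bound w). lia.
Qed.

(** Every letter moves by at most 4, so within a word two positions differ by at most 8 times the
    length: a short word cannot reach the support of [f]. *)
Lemma cent_vanish M f w : fvanish M f -> (8 * Z.of_nat (length w) < M)%Z -> cent c f w = 0%Z.
Proof.
  intros Hf. induction w as [|l w IH]; intros HM; [reflexivity|].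
  cbn [cent length] in *. rewrite IH by lia.
  rewrite (bsum_vanish M); [lia|exact Hf|].
  assert (H := pos_bound (l :: w)). cbn [length] in H. lia.
Qed.

Lemma bsum_winv f q w : pos c w = 0%Z -> bsum c f q (winv w) = (- bsum c f q w)%Z.
Proof.
  intros Hp. pose proof (run_congruence (inV c) (inV_inv c)) as HC.
  assert (H : bsum c f q (w ++ winv w) = 0%Z).
  { rewrite bsum_V. replace (Vred c (w ++ winv w)) with (@nil letter); [reflexivity|].
    symmetry. apply (E_winv_r _ HC). }
  rewrite bsum_app, pos_winv, Hp in H. replace (q - - 0)%Z with q in H by lia. lia.
Qed.

Lemma asum_winv phi w : pos c w = 0%Z -> asum c phi (winv w) = (- asum c phi w)%Z.
Proof.
  intros Hp. pose proof (run_congruence (inU c) (inU_inv c)) as HC.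
  assert (H : asum c phi (w ++ winv w) = 0%Z).
  { rewrite asum_U. replace (Ured c (w ++ winv w)) with (@nil letter); [reflexivity|].
    symmetry. apply (E_winv_r _ HC). }
  rewrite asum_app, pos_winv, Hp in H.
  rewrite (asum_ext _ _ phi) in H by (intros; f_equal; lia). lia.
Qed.

Lemma bsum_free f q w : (forall l, In l w -> fst l <> 1) -> bsum c f q w = 0%Z.
Proof.
  intros H; apply lsum_zero. intros l Hl; unfold mlet.
  destruct (Nat.eqb_spec (fst l) 1); [exfalso; now apply (H l) | reflexivity].
Qed.
Lemma asum_free phi w : (forall l, In l w -> fst l <> 0) -> asum c phi w = 0%Z.
Proof.
  intros H; apply lsum_zero. intros l Hl; unfold mlet.
  destruct (Nat.eqb_spec (fst l) 0); [exfalso; now apply (H l) | reflexivity].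
Qed.
Lemma cent_bfree f w : (forall l, In l w -> fst l <> 1) -> cent c f w = 0%Z.
Proof.
  induction w as [|l w IH]; intros H; [reflexivity|]. cbn [cent].
  rewrite IH by (intros; apply H; now right). rewrite bsum_free by (intros; apply H; now right). lia.
Qed.
Lemma cent_afree f w : (forall l, In l w -> fst l <> 0) -> cent c f w = 0%Z.
Proof.
  induction w as [|l w IH]; intros H; [reflexivity|]. cbn [cent].
  rewrite IH by (intros; apply H; now right). unfold mlet.
  destruct (Nat.eqb_spec (fst l) 0); [exfalso; apply (H l); [now left|assumption] | lia].
Qed.
Lemma in_winv l w : In l (winv w) -> exists x, In x w /\ fst x = fst l.
Proof.
  unfold winv; intros H; apply in_rev, in_map_iff in H. destruct H as [x [<- Hx]]. now exists x.
Qed.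

Definition comm (x y : word) : word := x ++ y ++ winv x ++ winv y.

(** The letters a of [x] meet the letters b of both [y] and [winv y], which cancel; those of
    [winv x] meet only [winv y], and the two signs multiply to a plus. *)
Lemma comm_cent f x y :
  (forall l, In l x -> fst l <> 1) -> (forall l, In l y -> fst l <> 0) ->
  pos c x = 0%Z -> pos c y = 0%Z ->
  cent c f (comm x y) = asum c (fun p => bsum c f p y) x.
Proof.
  intros Hx Hy Px Py.
  assert (Hx' : forall l, In l (winv x) -> fst l <> 1)
    by (intros l Hl; apply in_winv in Hl as [z [Hz <-]]; now apply Hx).
  assert (Hy' : forall l, In l (winv y) -> fst l <> 0)
    by (intros l Hl; apply in_winv in Hl as [z [Hz <-]]; now apply Hy).
  assert (H1 : asum c (fun p => bsum c f (p + pos c (y ++ winv x ++ winv y)) (y ++ winv x ++ winv y))%Z x = 0%Z).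
  { apply lsum_zero_fun. intros q.
    rewrite !bsum_app, !pos_app, !pos_winv, Px, Py, (bsum_free f _ (winv x)) by assumption.
    rewrite bsum_winv by exact Py.
    replace (q + (0 + (- 0 + - 0)) - (- 0 + - 0))%Z with q by lia.
    replace (q + (0 + (- 0 + - 0)))%Z with q by lia. lia. }
  assert (H2 : asum c (fun p => bsum c f (p + pos c (winv y)) (winv y))%Z (winv x)
    = asum c (fun p => bsum c f p y) x).
  { rewrite asum_winv by exact Px. rewrite pos_winv, Py.
    rewrite (asum_ext _ _ (fun p => (-1) * bsum c f p y)%Z).
    2:{ intros q. rewrite bsum_winv by exact Py. replace (q + - 0)%Z with q by lia. lia. }
    unfold asum at 1. rewrite lsum_scale. unfold asum. lia. }
  unfold comm. rewrite cent_app.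
  match goal with |- (_ + ?t)%Z = _ => replace t with 0%Z by (symmetry; exact H1) end.
  rewrite cent_app, cent_app, (asum_free _ y) by assumption.
  match goal with |- context [asum c ?g (winv x)] =>
    replace (asum c g (winv x)) with (asum c (fun p => bsum c f p y) x) by (symmetry; exact H2) end.
  rewrite (cent_bfree f x), (cent_bfree f (winv x)), (cent_afree f y), (cent_afree f (winv y)) by assumption.
  lia.
Qed.

Lemma comm_U x y : Ured c y = [] -> Ured c (comm x y) = [].
Proof.
  intros Hy. pose proof (run_congruence (inU c) (inU_inv c)) as HC.
  assert (Hy' := E_winv _ HC y [] Hy).
  change (run (inU c) (comm x y) [] = run (inU c) [] []). unfold comm.
  apply (wc_trans _ HC) with (v := x ++ [] ++ winv x ++ []).
  - apply (wc_app _ HC); [reflexivity|]. apply (wc_app _ HC); [exact Hy|].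
    apply (wc_app _ HC); [reflexivity | exact Hy'].
  - rewrite app_nil_r. simpl. apply (E_winv_r _ HC).
Qed.

Lemma comm_V x y : Vred c x = [] -> Vred c (comm x y) = [].
Proof.
  intros Hx. pose proof (run_congruence (inV c) (inV_inv c)) as HC.
  assert (Hx' := E_winv _ HC x [] Hx).
  change (run (inV c) (comm x y) [] = run (inV c) [] []). unfold comm.
  apply (wc_trans _ HC) with (v := [] ++ y ++ [] ++ winv y).
  - apply (wc_app _ HC); [exact Hx|]. apply (wc_app _ HC); [reflexivity|].
    apply (wc_app _ HC); [exact Hx' | reflexivity].
  - simpl. apply (E_winv_r _ HC).
Qed.

Lemma comm_expo i x y : expo i (comm x y) = 0%Z.
Proof. unfold comm; rewrite !expo_app, !expo_winv; lia. Qed.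

End Geometry.

(** * Central elements and their lengths *)

Lemma Dn_pow_le s : 4 <= Dn s /\ Dn s * Dn s <= Dn (S s).
Proof.
  assert (H4 : 4 <= Dn s).
  { induction s as [|s IH]; [simpl; lia|]. change (Dn (S s)) with (Dn s ^ 8).
    apply Nat.le_trans with (Dn s ^ 1); [simpl; lia | apply Nat.pow_le_mono_r; lia]. }
  split; [exact H4|]. change (Dn (S s)) with (Dn s ^ 8).
  replace (Dn s * Dn s) with (Dn s ^ 2) by (simpl; ring). apply Nat.pow_le_mono_r; lia.
Qed.

Lemma Dn_double s : 4 * Dn s <= Dn (S s).
Proof. destruct (Dn_pow_le s); nia. Qed.

Lemma Dn_gt s : s < Dn s.
Proof. induction s as [|s IH]; [simpl; lia|]. destruct (Dn_pow_le s). assert (H1 := Dn_double s). lia. Qed.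

Lemma Dn_mono s s' : s <= s' -> Dn s <= Dn s'.
Proof. induction 1 as [|s' _ IH]; [lia|]. assert (H1 := Dn_double s'). lia. Qed.

Lemma pow2_Dn s : 2 ^ s <= Dn s.
Proof.
  induction s as [|s IH]; [simpl; lia|]. assert (H := Dn_double s). simpl Nat.pow. lia.
Qed.

Lemma slot_bounds s i : i < s -> Dn s <= slot s i /\ slot s i < Dn s * Dn s.
Proof.
  intros Hi. unfold slot. assert (H := pow2_Dn s). assert (G := Dn_gt s).
  assert (H1 : 2 ^ i < 2 ^ s) by (apply Nat.pow_lt_mono_r; lia).
  assert (H2 : 2 ^ i <> 0) by (apply Nat.pow_nonzero; lia). nia.
Qed.

Lemma slot_lt s i i' : i < i' -> slot s i < slot s i'.
Proof.
  intros Hi. unfold slot. assert (G := Dn_gt s).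
  assert (H1 : 2 ^ i < 2 ^ i') by (apply Nat.pow_lt_mono_r; lia). nia.
Qed.

(** The slots of window [s] lie between [Dn s] and [Dn s ^ 2], and the next window starts no earlier
    than [Dn s ^ 2]. Hence a position determines its coordinate. *)
Lemma slot_inj s i s' i' : i < s -> i' < s' -> slot s i = slot s' i' -> s = s' /\ i = i'.
Proof.
  intros Hi Hi' E. assert (G := slot_bounds s i Hi). assert (G' := slot_bounds s' i' Hi').
  assert (Hm : forall a b, a < b -> Dn a * Dn a <= Dn b).
  { intros a b Hab. assert (H := Dn_mono (S a) b Hab). destruct (Dn_pow_le a). lia. }
  destruct (lt_eq_lt_dec s s') as [[H|H]|H].
  - apply Hm in H; lia.
  - subst. split; [reflexivity|]. destruct (lt_eq_lt_dec i i') as [[H|H]|H]; auto; apply (slot_lt s') in H; lia.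
  - apply Hm in H; lia.
Qed.

Lemma fsi_eval B s i s' i' r : i < s -> i' < s' -> (0 <= r < 4)%Z ->
  fsi B s' i' (4 * Z.of_nat (slot s i) + r) =
  if (s' =? s) && (i' =? i) then (B s i ^ r)%Z else 0%Z.
Proof.
  intros Hi Hi' Hr. unfold fsi.
  destruct (Nat.eq_dec (slot s' i') (slot s i)) as [He|He].
  - destruct (slot_inj s' i' s i Hi' Hi He) as [-> ->]. rewrite !Nat.eqb_refl. cbn [andb].
    replace (4 * Z.of_nat (slot s i) + r - 4 * Z.of_nat (slot s i))%Z with r by lia.
    destruct (Z.leb_spec 0 r), (Z.ltb_spec r 4); try lia. reflexivity.
  - replace ((s' =? s) && (i' =? i)) with false.
    + match goal with |- context [(0 <=? ?q)%Z] => destruct (Z.leb_spec 0 q), (Z.ltb_spec q 4) end; try reflexivity. lia.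
    + symmetry. apply not_true_is_false. intros H. apply andb_prop in H as [H1 H2].
      apply Nat.eqb_eq in H1, H2; subst. contradiction.
Qed.

Lemma fsi_vanish B s i : fvanish (4 * Z.of_nat (slot s i)) (fsi B s i).
Proof.
  intros x Hx. unfold fsi.
  match goal with |- context [(0 <=? ?q)%Z] => destruct (Z.leb_spec 0 q); [exfalso; lia | reflexivity] end.
Qed.

Lemma slot_gt s i : s < slot s i.
Proof.
  unfold slot. assert (G := Dn_gt s). assert (H2 : 2 ^ i <> 0) by (apply Nat.pow_nonzero; lia). nia.
Qed.

Definition lp (i : nat) (k : Z) : word := repeat (i, (k <? 0)%Z) (Z.abs_nat k).

Lemma lp_length i k : length (lp i k) = Z.abs_nat k.
Proof. apply repeat_length. Qed.

Lemma lp_in i k l : In l (lp i k) -> fst l = i.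
Proof. intros H; apply repeat_spec in H; now subst. Qed.

Lemma vp_lp p i k : i < p -> vp p (lp i k).
Proof. intros H l Hl; apply lp_in in Hl; lia. Qed.

Lemma sg_lp k : (Z.of_nat (Z.abs_nat k) * sg (k <? 0) = k)%Z.
Proof. destruct (Z.ltb_spec k 0); simpl; lia. Qed.

Lemma winv_lp i k : winv (lp i k) = lp i (- k).
Proof.
  unfold winv, lp. rewrite map_repeat, rev_repeat.
  replace (Z.abs_nat (- k)) with (Z.abs_nat k) by lia.
  destruct (Z.eq_dec k 0) as [->|Hk]; [reflexivity|].
  f_equal. unfold inv_letter; cbn [fst snd]. f_equal.
  destruct (Z.ltb_spec k 0), (Z.ltb_spec (- k) 0); simpl; lia.
Qed.

Lemma possum_repeat sh l n : possum sh (repeat l n) = (Z.of_nat n * sh l)%Z.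
Proof. induction n as [|n IH]; [reflexivity|]. cbn [repeat possum]. rewrite IH. lia. Qed.

Lemma lsum_repeat sh m phi l n : sh l = 0%Z ->
  lsum sh m phi (repeat l n) = (Z.of_nat n * m l * phi 0)%Z.
Proof.
  intros Hs; induction n as [|n IH]; [reflexivity|].
  change (repeat l (S n)) with (l :: repeat l n). cbn [lsum]. rewrite IH.
  change (l :: repeat l n) with (repeat l (S n)). rewrite possum_repeat, Hs.
  replace (Z.of_nat (S n) * 0)%Z with 0%Z by lia. lia.
Qed.

Section Central.
Variable c : nat.

Lemma pos_lp i k : pos c (lp i k) =
  (if (i =? 2)%nat then 4 * k else if (i =? 3 + c)%nat then k else 0)%Z.
Proof.
  unfold pos, lp. rewrite possum_repeat. unfold shift; cbn [fst snd].
  assert (H := sg_lp k). destruct (i =? 2), (i =? 3 + c); lia.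
Qed.

Lemma expo_lp j i k : expo j (lp i k) = if i =? j then k else 0%Z.
Proof.
  unfold expo, lp. rewrite lsum_repeat by reflexivity. unfold mlet; cbn [fst snd].
  assert (H := sg_lp k). destruct (i =? j); lia.
Qed.

Definition bblk (d : nat) (y : Z) : word := lp 2 (Z.of_nat d) ++ lp 1 y ++ lp 2 (- Z.of_nat d).
Definition ablk (r : nat) (x : Z) : word := lp (3 + c) (- Z.of_nat r) ++ lp 0 x ++ lp (3 + c) (Z.of_nat r).

Lemma run_sandwich A i k v : (forall l, A (inv_letter l) = A l) ->
  (forall l, In l v -> A l = false) -> run A (lp i k ++ v ++ lp i (- k)) [] = [].
Proof.
  intros HA Hv. rewrite !run_app. rewrite (run_id A v Hv). rewrite <- winv_lp.
  now apply run_winv.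
Qed.

Lemma bblk_U d y : Ured c (bblk d y) = [].
Proof.
  apply run_sandwich; [apply inU_inv|]. intros l Hl; apply lp_in in Hl. unfold inU; rewrite Hl. reflexivity.
Qed.
Lemma ablk_V r x : Vred c (ablk r x) = [].
Proof.
  unfold ablk. rewrite <- (Z.opp_involutive (Z.of_nat r)) at 2.
  apply run_sandwich; [apply inV_inv|]. intros l Hl; apply lp_in in Hl. unfold inV; rewrite Hl. reflexivity.
Qed.
Lemma bblk_afree d y l : In l (bblk d y) -> fst l <> 0.
Proof.
  unfold bblk; intros H; apply in_app_or in H as [H|H]; [|apply in_app_or in H as [H|H]]; apply lp_in in H; lia.
Qed.
Lemma ablk_bfree r x l : In l (ablk r x) -> fst l <> 1.
Proof.
  unfold ablk; intros H; apply in_app_or in H as [H|H]; [|apply in_app_or in H as [H|H]]; apply lp_in in H; lia.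
Qed.
Lemma bblk_pos d y : pos c (bblk d y) = 0%Z.
Proof. unfold bblk. rewrite !pos_app, !pos_lp. cbn [Nat.eqb Nat.add]. lia. Qed.
Lemma ablk_pos r x : pos c (ablk r x) = 0%Z.
Proof. unfold ablk. rewrite !pos_app, !pos_lp. rewrite Nat.eqb_refl. cbn [Nat.eqb Nat.add]. lia. Qed.

Lemma bsum_bblk f q d y : bsum c f q (bblk d y) = (y * f (q + 4 * Z.of_nat d))%Z.
Proof.
  unfold bblk. rewrite !bsum_app.
  rewrite (bsum_free c f _ (lp 2 _)), (bsum_free c f _ (lp 2 _)) by (intros l Hl; apply lp_in in Hl; lia).
  rewrite pos_lp. cbn [Nat.eqb]. unfold bsum, lp at 1. rewrite lsum_repeat by reflexivity.
  unfold mlet; cbn [fst snd Nat.eqb]. rewrite sg_lp.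
  replace (q - 4 * - Z.of_nat d - 0)%Z with (q + 4 * Z.of_nat d)%Z by lia. lia.
Qed.

Lemma asum_ablk phi r x : asum c phi (ablk r x) = (x * phi (Z.of_nat r))%Z.
Proof.
  unfold ablk. rewrite !asum_app.
  rewrite (asum_free c _ (lp (3 + c) _)), (asum_free c _ (lp (3 + c) _)) by (intros l Hl; apply lp_in in Hl; lia).
  rewrite pos_lp. rewrite Nat.eqb_refl. cbn [Nat.eqb Nat.add]. unfold asum, lp at 1. rewrite lsum_repeat by reflexivity.
  unfold mlet; cbn [fst snd Nat.eqb]. rewrite sg_lp. simpl. lia.
Qed.

(** Words for elements of the central subgroup: all invariants but the central coordinates are
    trivial. *)
Record cword (p : nat) (w : word) : Prop := {
  cw_vp : vp p w;
  cw_U : Ured c w = [];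
  cw_V : Vred c w = [];
  cw_e : forall i, expo i w = 0%Z
}.

Lemma cword_nil p : cword p [].
Proof. split; auto using vp_nil. Qed.

Lemma cword_app p u v : cword p u -> cword p v -> cword p (u ++ v).
Proof.
  intros [H1 H2 H3 H4] [H1' H2' H3' H4']; split.
  - now apply vp_app.
  - unfold Ured in *. rewrite run_app, H2. exact H2'.
  - unfold Vred in *. rewrite run_app, H3. exact H3'.
  - intros i. rewrite expo_app, H4, H4'. reflexivity.
Qed.

Lemma cword_cent_app f p u v : cword p u -> cent c f (u ++ v) = (cent c f u + cent c f v)%Z.
Proof. intros H. rewrite cent_app, asum_U, (cw_U _ _ H). unfold asum; simpl. lia. Qed.

Lemma cword_cent_app_r f p u v : cword p v -> cent c f (u ++ v) = (cent c f u + cent c f v)%Z.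
Proof.
  intros H. rewrite cent_app. unfold asum. rewrite lsum_zero_fun; [lia|].
  intros q. now rewrite bsum_V, (cw_V _ _ H).
Qed.

Lemma cword_comm p x y : vp p x -> vp p y -> Vred c x = [] -> Ured c y = [] -> cword p (comm x y).
Proof.
  intros Hx Hy HV HU. split.
  - unfold comm. rewrite !vp_app. auto using vp_winv.
  - now apply comm_U.
  - now apply comm_V.
  - intros i. apply comm_expo.
Qed.

Lemma comm_length x y : length (comm x y) = 2 * length x + 2 * length y.
Proof. unfold comm. rewrite !length_app, !winv_length. lia. Qed.

Lemma zcomm p d x y : 3 <= p -> exists w, cword p w /\
  (forall f, cent c f w = (x * y * f (4 * Z.of_nat d))%Z) /\
  length w = 2 * Z.abs_nat x + 2 * Z.abs_nat y + 4 * d.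
Proof.
  intros Hp. exists (comm (ablk 0 x) (bblk d y)).
  assert (Ea : ablk 0 x = lp 0 x) by (unfold ablk; simpl; apply app_nil_r).
  split; [|split].
  - apply cword_comm; auto using ablk_V, bblk_U.
    + rewrite Ea; apply vp_lp; lia.
    + unfold bblk. rewrite !vp_app. repeat split; apply vp_lp; lia.
  - intros f. rewrite comm_cent;
      [|intros l; apply ablk_bfree|intros l; apply bblk_afree|apply ablk_pos|apply bblk_pos].
    rewrite (asum_ext c _ (fun p => y * f (p + 4 * Z.of_nat d))%Z) by (intros; apply bsum_bblk).
    rewrite asum_ablk. simpl Z.of_nat. rewrite Z.add_0_l. lia.
  - rewrite comm_length, Ea. unfold bblk. rewrite !length_app, !lp_length. lia.
Qed.

(** Exponents multiply in a commutator of powers, so a square [r * r] costs a multiple of [r] only.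
    With [r] the integer root, the remainder is at most [2 * r] and a second commutator supplies
    it. *)
Lemma zword_plain p d k : 3 <= p -> exists w, cword p w /\
  (forall f, cent c f w = (k * f (4 * Z.of_nat d))%Z) /\
  (Z.of_nat (length w) <= 8 * Z.sqrt (Z.abs k) + 8 * Z.of_nat d + 2)%Z.
Proof.
  intros Hp. destruct (Z.sqrt_spec (Z.abs k) (Z.abs_nonneg k)) as [H1 H2].
  assert (H0 := Z.sqrt_nonneg (Z.abs k)). set (r := Z.sqrt (Z.abs k)) in *.
  assert (Hs : (Z.abs (Z.sgn k) <= 1)%Z) by (destruct k; simpl; lia).
  destruct (zcomm p d r (Z.sgn k * r) Hp) as [w1 [C1 [E1 L1]]].
  destruct (zcomm p d (Z.abs k - r * r) (Z.sgn k) Hp) as [w2 [C2 [E2 L2]]].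
  exists (w1 ++ w2). split; [now apply cword_app|]. split.
  - intros f. rewrite (cword_cent_app _ _ _ _ C1), E1, E2.
    replace k with (Z.sgn k * Z.abs k)%Z at 4 by (destruct k; simpl; lia). ring.
  - rewrite length_app, L1, L2.
    assert (Z.abs (Z.sgn k * r) <= r)%Z by (rewrite Z.abs_mul; nia). lia.
Qed.

(* Base [D] digits: the letters a at positions 0, -1, -2, -3 contribute D^0, ..., D^3. *)
Lemma zword_short d D k : (0 < D)%Z -> (0 <= k < D ^ 4)%Z -> exists w, cword (4 + c) w /\
  (exists k0 k1 k2 k3, (k = k0 + k1 * D + k2 * D ^ 2 + k3 * D ^ 3)%Z /\
   forall f, cent c f w = (k0 * f (4 * Z.of_nat d) + k1 * f (4 * Z.of_nat d + 1)
      + k2 * f (4 * Z.of_nat d + 2) + k3 * f (4 * Z.of_nat d + 3))%Z) /\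
  (Z.of_nat (length w) <= 8 * D + 4 * Z.of_nat d + 26)%Z.
Proof.
  intros HD Hk.
  set (k0 := (k mod D)%Z). set (q1 := (k / D)%Z).
  set (k1 := (q1 mod D)%Z). set (q2 := (q1 / D)%Z).
  set (k2 := (q2 mod D)%Z). set (k3 := (q2 / D)%Z).
  assert (B0 := Z.mod_pos_bound k D HD). assert (B1 := Z.mod_pos_bound q1 D HD).
  assert (B2 := Z.mod_pos_bound q2 D HD).
  assert (E0 := Z.div_mod k D ltac:(lia)). assert (E1 := Z.div_mod q1 D ltac:(lia)).
  assert (E2 := Z.div_mod q2 D ltac:(lia)).
  fold k0 q1 in E0. fold k1 q2 in E1. fold k2 k3 in E2. fold k0 in B0. fold k1 in B1. fold k2 in B2.
  assert (P1 : (0 <= q1 < D ^ 3)%Z).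
  { split; [apply Z.div_pos; lia|]. apply Z.div_lt_upper_bound; [lia|].
    replace (D * D ^ 3)%Z with (D ^ 4)%Z by ring. lia. }
  assert (P2 : (0 <= q2 < D ^ 2)%Z).
  { split; [apply Z.div_pos; lia|]. apply Z.div_lt_upper_bound; [lia|].
    replace (D * D ^ 2)%Z with (D ^ 3)%Z by ring. lia. }
  assert (B3 : (0 <= k3 < D)%Z).
  { split; [apply Z.div_pos; lia|]. apply Z.div_lt_upper_bound; [lia|].
    replace (D * D)%Z with (D ^ 2)%Z by ring. lia. }
  set (x := ablk 0 k0 ++ ablk 1 k1 ++ ablk 2 k2 ++ ablk 3 k3).
  assert (Hxv : forall r k', vp (4 + c) (ablk r k')).
  { intros r k'. unfold ablk. rewrite !vp_app. repeat split; apply vp_lp; lia. }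
  assert (Hyv : vp (4 + c) (bblk d 1)).
  { unfold bblk. rewrite !vp_app. repeat split; apply vp_lp; lia. }
  assert (HxV : Vred c x = []).
  { unfold x, Vred. rewrite !run_app.
    assert (H : forall r k', run (inV c) (ablk r k') [] = []) by (intros; apply ablk_V).
    now rewrite !H. }
  exists (comm x (bblk d 1)). split; [|split].
  - apply cword_comm; auto using bblk_U. unfold x. rewrite !vp_app. auto.
  - exists k0, k1, k2, k3. split.
    + rewrite E0, E1, E2. ring.
    + intros f. rewrite comm_cent.
      * rewrite (asum_ext c _ (fun p => f (p + 4 * Z.of_nat d))%Z)
          by (intros; rewrite bsum_bblk; lia).
        unfold x. rewrite !asum_app, !pos_app, !ablk_pos, !asum_ablk.
        repeat match goal with |- context [f (?u + 0 + 4 * Z.of_nat d)%Z] => replace (u + 0 + 4 * Z.of_nat d)%Z with (u + 4 * Z.of_nat d)%Z by lia end.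
        replace (Z.of_nat 0 + (0 + (0 + 0)) + 4 * Z.of_nat d)%Z with (4 * Z.of_nat d)%Z by lia.
        replace (Z.of_nat 1 + (0 + 0) + 4 * Z.of_nat d)%Z with (4 * Z.of_nat d + 1)%Z by lia.
        replace (Z.of_nat 2 + 4 * Z.of_nat d)%Z with (4 * Z.of_nat d + 2)%Z by lia.
        replace (Z.of_nat 3 + 4 * Z.of_nat d)%Z with (4 * Z.of_nat d + 3)%Z by lia. lia.
      * unfold x. intros l Hl. do 3 (apply in_app_or in Hl as [Hl|Hl]; [now apply ablk_bfree in Hl|]).
        now apply ablk_bfree in Hl.
      * intros l; apply bblk_afree.
      * unfold x. rewrite !pos_app, !ablk_pos. reflexivity.
      * apply bblk_pos.
  - rewrite comm_length. unfold x, ablk, bblk. rewrite !length_app, !lp_length. lia.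
Qed.

End Central.

Section CentralVectors.
Variables (c p : nat) (N B : nat -> nat -> Z).
Hypothesis HN : forall s i, s <= i -> N s i = 1%Z.

Definition delta (s i : nat) (k : Z) (s' i' : nat) : Z :=
  if (s' =? s) && (i' =? i) then k else 0%Z.

Definition single (s i : nat) (k : Z) (L : nat) : Prop :=
  exists w, cword c p w /\
    (forall s' i', i' < s' -> (N s' i' | cent c (fsi B s' i') w - delta s i k s' i')%Z) /\
    length w <= L.

Lemma single_mod s i k k' L : (N s i | k - k')%Z -> single s i k L -> single s i k' L.
Proof.
  intros H [w [H1 [H2 H3]]]. exists w; repeat split; try apply H1; auto.
  intros s' i' Hi. specialize (H2 s' i' Hi). unfold delta in *.
  destruct ((s' =? s) && (i' =? i)) eqn:E; [|exact H2].
  apply andb_prop in E as [E1 E2]. apply Nat.eqb_eq in E1, E2; subst.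
  destruct H as [x Hx], H2 as [y Hy]. exists (x + y)%Z. lia.
Qed.

Lemma single_plain s i k L : 3 <= p -> i < s ->
  (8 * Z.sqrt (Z.abs k) + 8 * Z.of_nat (slot s i) + 2 <= Z.of_nat L)%Z -> single s i k L.
Proof.
  intros Hp Hi HL. destruct (zword_plain c p (slot s i) k Hp) as [w [H1 [H2 H3]]].
  exists w. split; [exact H1|]. split; [|lia].
  intros s' i' Hi'. rewrite H2. rewrite <- (Z.add_0_r (4 * Z.of_nat (slot s i))).
  rewrite fsi_eval by lia. unfold delta. exists 0%Z.
  destruct ((s' =? s) && (i' =? i)); [rewrite Z.pow_0_r|]; lia.
Qed.

Lemma single_short s i k L : p = 4 + c -> i < s -> B s i = Z.of_nat (Dn s) ->
  (0 <= k < Z.of_nat (Dn s) ^ 4)%Z -> 8 * Dn s + 4 * slot s i + 26 <= L -> single s i k L.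
Proof.
  intros Hp Hi HB Hk HL. assert (HD := Dn_gt s).
  destruct (zword_short c (slot s i) (Z.of_nat (Dn s)) k ltac:(lia) Hk)
    as [w [H1 [[k0 [k1 [k2 [k3 [Ek H2]]]]] H3]]].
  rewrite <- Hp in H1. exists w. split; [exact H1|]. split; [|lia].
  intros s' i' Hi'. rewrite H2. rewrite <- (Z.add_0_r (4 * Z.of_nat (slot s i))) at 1.
  rewrite !fsi_eval by lia. unfold delta. exists 0%Z. rewrite HB.
  destruct ((s' =? s) && (i' =? i)); [|lia]. rewrite Ek, Z.pow_0_r, Z.pow_1_r. lia.
Qed.

Definition slot_dec (x y : nat * nat) : {x = y} + {x <> y}.
Proof. decide equality; apply Nat.eq_dec. Defined.

Definition restr (L : list (nat * nat)) (kap : nat -> nat -> Z) (s i : nat) : Z :=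
  if in_dec slot_dec (s, i) L
  then kap s i else 0%Z.

Lemma cword_list kap (cst : nat * nat -> nat) L : NoDup L ->
  (forall s i, In (s, i) L -> single s i (kap s i) (cst (s, i))) ->
  exists w, cword c p w /\
    (forall s i, i < s -> (N s i | cent c (fsi B s i) w - restr L kap s i)%Z) /\
    length w <= list_sum (map cst L).
Proof.
  induction L as [|[s i] L IH]; intros HL H.
  - exists []. split; [apply cword_nil|]. split; [|simpl; lia].
    intros s i Hi; exists 0%Z; reflexivity.
  - apply NoDup_cons_iff in HL as [Hn HL].
    destruct IH as [w [C1 [E1 L1]]]; [exact HL | intros; apply H; now right |].
    destruct (H s i (or_introl eq_refl)) as [w' [C2 [E2 L2]]].
    exists (w' ++ w). split; [now apply cword_app|]. split.
    + intros s' i' Hi'. rewrite (cword_cent_app _ _ _ _ _ C2).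
      destruct (E1 s' i' Hi') as [x Hx], (E2 s' i' Hi') as [y Hy].
      exists (x + y)%Z. unfold restr, delta in *.
      destruct (in_dec _ (s', i') L) as [Hin|Hout], (in_dec _ (s', i') ((s, i) :: L)) as [Hin'|Hout'].
      * destruct ((s' =? s) && (i' =? i)) eqn:E; [|lia].
        apply andb_prop in E as [E' E'']. apply Nat.eqb_eq in E', E''; subst. contradiction.
      * exfalso; apply Hout'; now right.
      * destruct Hin' as [Heq|]; [|contradiction]. injection Heq as -> ->.
        rewrite !Nat.eqb_refl in Hy. cbn [andb] in Hy. lia.
      * destruct ((s' =? s) && (i' =? i)) eqn:E; [|lia].
        apply andb_prop in E as [E' E'']. apply Nat.eqb_eq in E', E''; subst.
        exfalso; apply Hout'; now left.
    + rewrite length_app. simpl. lia.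
Qed.

Lemma list_sum_bound {T} (f : T -> nat) K L : (forall x, In x L -> f x <= K) ->
  list_sum (map f L) <= length L * K.
Proof.
  induction L as [|x L IH]; intros H; simpl; [lia|].
  assert (f x <= K) by (apply H; now left).
  assert (list_sum (map f L) <= length L * K) by (apply IH; intros; apply H; now right). lia.
Qed.

(** Coordinates with [s <= i] are trivial groups and those outside [L] vanish modulo [N], so the
    finitely many coordinates in [L] determine the element. *)
Lemma cword_exists kap (cst : nat * nat -> nat) L : NoDup L ->
  (forall s i, i < s -> ~ In (s, i) L -> (N s i | kap s i)%Z) ->
  (forall s i, In (s, i) L -> single s i (kap s i) (cst (s, i))) ->
  exists w, cword c p w /\ (forall s i, (N s i | cent c (fsi B s i) w - kap s i)%Z) /\
    length w <= list_sum (map cst L).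
Proof.
  intros HL Hhi H. destruct (cword_list kap cst L HL H) as [w [C1 [E1 W1]]].
  exists w. split; [exact C1|]. split; [|exact W1].
  intros s i. destruct (le_lt_dec s i) as [Hi|Hi]; [rewrite HN by exact Hi; apply Z.divide_1_l|].
  destruct (E1 s i Hi) as [x Hx]. unfold restr in Hx.
  destruct (in_dec slot_dec (s, i) L) as [H1|H1].
  - exists x. lia.
  - destruct (Hhi s i Hi H1) as [y Hy]. exists (x - y)%Z. lia.
Qed.

End CentralVectors.

(** * Coloured covers *)

Section Near.
Variable E : word -> word -> Prop.
Hypothesis HE : word_congruence E.
Variable p : nat.

Definition near (r : nat) (u v : word) : Prop :=
  exists w, vp p w /\ length w <= r /\ E (u ++ w) v.

Lemma near_refl r u : near r u u.
Proof.
  exists []. rewrite app_nil_r. split; [apply vp_nil|]. split; [simpl; lia | apply (wc_refl _ HE)].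
Qed.

Lemma near_sym r u v : near r u v -> near r v u.
Proof.
  intros [w [H1 [H2 H3]]]. exists (winv w). split; [now apply vp_winv|].
  rewrite winv_length. split; [exact H2|].
  apply (wc_trans _ HE) with (v := (u ++ w) ++ winv w).
  - apply (wc_app _ HE); [now apply (wc_sym _ HE) | apply (wc_refl _ HE)].
  - rewrite <- app_assoc. rewrite <- (app_nil_r u) at 2.
    apply (wc_app _ HE); [apply (wc_refl _ HE) | apply (E_winv_r _ HE)].
Qed.

Lemma near_trans r r' u v x : near r u v -> near r' v x -> near (r + r') u x.
Proof.
  intros [w [H1 [H2 H3]]] [w' [H1' [H2' H3']]]. exists (w ++ w').
  split; [now apply vp_app|]. rewrite length_app. split; [lia|].
  rewrite app_assoc. apply (wc_trans _ HE) with (v := v ++ w'); [|exact H3'].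
  apply (wc_app _ HE); [exact H3 | apply (wc_refl _ HE)].
Qed.

Lemma near_mono r r' u v : r <= r' -> near r u v -> near r' u v.
Proof. intros Hr [w [H1 [H2 H3]]]; exists w; repeat split; auto; lia. Qed.

Inductive chain (Dom : word -> Prop) (r : nat) (x : word) : word -> Prop :=
| chain_refl : Dom x -> chain Dom r x x
| chain_step : forall y z, chain Dom r x y -> near r y z -> Dom z -> chain Dom r x z.

Lemma chain_dom Dom r x y : chain Dom r x y -> Dom x /\ Dom y.
Proof. induction 1; tauto. Qed.

Lemma chain_trans Dom r x y z : chain Dom r x y -> chain Dom r y z -> chain Dom r x z.
Proof. intros H1 H2; induction H2; [exact H1 | eapply chain_step; eauto]. Qed.

Lemma chain_sym Dom r x y : chain Dom r x y -> chain Dom r y x.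
Proof.
  induction 1 as [H|y z H1 IH H2 H3]; [now apply chain_refl|].
  apply chain_trans with y; [|exact IH].
  eapply chain_step; [apply chain_refl; exact H3 | now apply near_sym | now apply chain_dom in H1].
Qed.

Lemma chain_sub (Dom Dom' : word -> Prop) r r' x y : r <= r' -> (forall z, Dom z -> Dom' z) ->
  chain Dom r x y -> chain Dom' r' x y.
Proof.
  intros Hr H; induction 1 as [H0|y z H1 IH H2 H3]; [apply chain_refl; auto|].
  eapply chain_step; [exact IH | apply (near_mono r); auto | auto].
Qed.

Lemma chain_inv (Dom P : word -> Prop) r x y : P x ->
  (forall y z, P y -> Dom y -> Dom z -> near r y z -> P z) -> chain Dom r x y -> P y.
Proof.
  intros H0 HP H; induction H as [H|y z H1 IH H2 H3]; [exact H0|].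
  apply (HP y z); auto. now apply chain_dom in H1.
Qed.

Lemma chain_restrict (Dom P : word -> Prop) r x y : P x ->
  (forall y z, P y -> Dom y -> Dom z -> near r y z -> P z) ->
  chain Dom r x y -> chain (fun z => Dom z /\ P z) r x y.
Proof.
  intros H0 HP H. assert (Hy : P y) by exact (chain_inv Dom P r x y H0 HP H).
  induction H as [H|y z H1 IH H2 H3]; [apply chain_refl; auto|].
  assert (P y) by exact (chain_inv Dom P r x y H0 HP H1).
  eapply chain_step; [now apply IH | exact H2 | auto].
Qed.

(** The [r]-components of [Dom] have diameter at most [V]: one colour of a coloured cover by
    separated bounded sets. *)
Definition small (r V : nat) (Dom : word -> Prop) : Prop :=
  forall x y, chain Dom r x y -> near V x y.

(* The scale of [W] exceeds the size of the pieces of [Z]. *)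
Lemma small_union r V V' (Z W : word -> Prop) :
  small r V Z -> small (V + 2 * r) V' W -> small r (2 * (V + r) + V') (fun x => Z x \/ W x).
Proof.
  intros HZ HW x y H.
  (* A chain in the union either stays in [Z] or consists of an initial piece in [Z], a chain in [W]
     and a final piece in [Z]. An excursion into [Z] between two points of [W] costs at most
     [r + V + r], the step allowed in [W]. *)
  assert (H1 : (chain Z r x y /\ Z y) \/
     exists w w' , (w = x \/ exists z, chain Z r x z /\ near r z w) /\ chain W (V + 2 * r) w w' /\
       (w' = y \/ exists z, near r w' z /\ chain Z r z y)).
  { induction H as [[H|H]|y z H1 IH H2 H3].
    - left; split; auto; now apply chain_refl.
    - right; exists x, x. split; [now left|]. split; [now apply chain_refl | now left].
    - destruct IH as [[C Zy]|[w [w' [Hw [C Hw']]]]].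
      + destruct H3 as [H3|H3]; [left; split; auto; eapply chain_step; eauto|].
        right; exists z, z. split; [right; exists y; auto|].
        split; [now apply chain_refl | now left].
      + right. destruct H3 as [H3|H3].
        * exists w, w'. split; [exact Hw|]. split; [exact C|]. right.
          destruct Hw' as [->|[z' [N1 C1]]].
          -- exists z. split; [exact H2 | now apply chain_refl].
          -- exists z'. split; [exact N1 | eapply chain_step; eauto].
        * exists w, z. split; [exact Hw|]. split; [|now left].
          eapply chain_step; [exact C| |exact H3].
          destruct Hw' as [->|[z' [N1 C1]]]; [apply (near_mono r); [lia | exact H2]|].
          apply HZ in C1. apply (near_mono (r + V + r)); [lia|].
          eapply near_trans; [eapply near_trans; eauto | exact H2]. }
  destruct H1 as [[C _]|[w [w' [Hw [C Hw']]]]]; [apply (near_mono V); [lia | now apply HZ]|].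
  apply HW in C. apply (near_mono ((V + r) + V' + (r + V))); [lia|].
  eapply near_trans; [eapply near_trans; [|exact C]|].
  - destruct Hw as [->|[z [C1 N1]]]; [apply near_refl|].
    eapply near_trans; [apply HZ; exact C1 | exact N1].
  - destruct Hw' as [->|[z [N1 C1]]]; [apply near_refl|].
    eapply near_trans; [exact N1 | apply HZ; exact C1].
Qed.

Lemma small_sub r V r' V' (Dom Dom' : word -> Prop) : r <= r' -> V' <= V ->
  (forall x, Dom x -> Dom' x) -> small r' V' Dom' -> small r V Dom.
Proof.
  intros Hr HV H Hs x y C. apply (near_mono V'); [exact HV|]. apply Hs.
  eapply chain_sub; eauto.
Qed.

Variables (X : Type) (dle : X -> X -> R -> Prop) (rp : X -> word).
Hypothesis HM : word_model E X dle p rp.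

(** The members are the [2 * r]-components of the colours. Two points of a ball of radius [r] are
    [2 * r]-near, so the ball meets at most one component of each colour. *)
Lemma colours_cover (K r V : nat) (Dom : nat -> word -> Prop) :
  (forall w, vp p w -> exists k, k < K /\ Dom k w) ->
  (forall k, k < K -> small (2 * r) V (Dom k)) ->
  exists F, is_cover X F /\ diam_le X dle F (INR V) /\
    (forall n, K <= n + 1 -> mult_le X dle F (INR r) n).
Proof.
  intros Hcov Hsm. destruct HM as [M1 [M2 M3]].
  set (cls := fun k x0 y => chain (Dom k) (2 * r) (rp x0) (rp y)).
  exists (fun U => exists k x0, k < K /\ Dom k (rp x0) /\ U = cls k x0). split; [|split].
  - intros x. destruct (Hcov (rp x) (M1 x)) as [k [Hk HD]].
    exists (cls k x). split; [now exists k, x|]. now apply chain_refl.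
  - intros U [k [x0 [Hk [_ ->]]]] x y Hx Hy. apply M3.
    destruct (Hsm k Hk (rp x) (rp y)) as [w [W1 [W2 W3]]].
    { eapply chain_trans; [apply chain_sym; exact Hx | exact Hy]. }
    exists w. split; [exact W1|]. split; [now apply le_INR | exact W3].
  - intros n Hn x Us HU HF.
    set (col := fun U => epsilon (inhabits 0) (fun k => exists x0, k < K /\ Dom k (rp x0) /\ U = cls k x0)).
    assert (Hcol : forall U, In U Us -> exists x0, col U < K /\ Dom (col U) (rp x0) /\ U = cls (col U) x0).
    { intros U HIn. destruct (HF U HIn) as [[k [x0 H]] _].
      apply (epsilon_spec (inhabits 0) (fun k => exists x0, k < K /\ Dom k (rp x0) /\ U = cls k x0)).
      now exists k, x0. }
    assert (Hball : forall U, In U Us -> exists y, near r (rp x) (rp y) /\ U y).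
    { intros U HIn. destruct (HF U HIn) as [_ [y [Hd Hy]]]. exists y; split; [|exact Hy].
      apply M3 in Hd as [w [W1 [W2 W3]]]. exists w. split; [exact W1|]. split; [now apply INR_le | exact W3]. }
    rewrite <- (length_map col).
    apply Nat.le_trans with K; [|exact Hn].
    rewrite <- (length_seq K 0). apply NoDup_incl_length.
    + apply FinFun.Injective_map_NoDup_in; [|exact HU].
      intros U U' HIn HIn' Ec.
      destruct (Hcol U HIn) as [x0 [_ [D0 E0]]], (Hcol U' HIn') as [x1 [_ [D1 E1]]].
      destruct (Hball U HIn) as [y [N0 Hy]], (Hball U' HIn') as [y' [N1 Hy']].
      rewrite <- Ec in D1, E1. set (k := col U) in *. clearbody k. subst U U'. unfold cls in *.
      assert (Hyy : chain (Dom k) (2 * r) (rp x0) (rp x1)).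
      { eapply chain_trans; [|apply chain_sym; exact Hy'].
        eapply chain_step; [exact Hy| |now apply chain_dom in Hy'].
        replace (2 * r) with (r + r) by lia. eapply near_trans; [apply near_sym; exact N0 | exact N1]. }
      extensionality z. apply propositional_extensionality.
      split; intros Hz; (eapply chain_trans; [|exact Hz]); [now apply chain_sym | exact Hyy].
    + intros k Hk. apply in_map_iff in Hk as [U [<- HIn]]. apply in_seq.
      destruct (Hcol U HIn) as [x0 [H _]]. lia.
Qed.

End Near.

(** * Slabs *)

(** The complement of the [P]-periodic slabs of thickness [b] with offset [j * b]. Steps of size at
    most [b] cannot cross a slab, and slabs with different [j] are disjoint, so a number lies in at
    most one of them. *)
Definition off_slab (b P : Z) (j : nat) (x : Z) : Prop := (b <= (x - Z.of_nat j * b) mod P)%Z.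

Definition slab_index (b P x : Z) : nat := Z.to_nat ((x mod P) / b).

Lemma slab_index_spec b P j x : (0 < b)%Z -> (Z.of_nat j * b + b <= P)%Z ->
  slab_index b P x <> j -> off_slab b P j x.
Proof.
  intros Hb HP Hj. unfold off_slab. apply Z.nlt_ge. intros H. apply Hj. unfold slab_index.
  assert (H0 := Z.mod_pos_bound (x - Z.of_nat j * b) P ltac:(lia)).
  set (m := ((x - Z.of_nat j * b) mod P)%Z) in *.
  assert (Hx : (x mod P = m + Z.of_nat j * b)%Z).
  { symmetry. apply Z.mod_unique with ((x - Z.of_nat j * b) / P)%Z; [lia|].
    assert (Hd := Z.div_mod (x - Z.of_nat j * b) P ltac:(lia)). fold m in Hd. lia. }
  rewrite Hx, Z.div_add by lia. rewrite Z.div_small by lia. lia.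
Qed.

Lemma slab_step b P j x x' : (0 < b)%Z -> (0 < P)%Z -> off_slab b P j x -> off_slab b P j x' ->
  (Z.abs (x' - x) <= b)%Z -> ((x' - Z.of_nat j * b) / P = (x - Z.of_nat j * b) / P)%Z.
Proof.
  intros Hb HP H H' Hd. unfold off_slab in *.
  set (a := (x - Z.of_nat j * b)%Z) in *. set (a' := (x' - Z.of_nat j * b)%Z) in *.
  assert (Ea := Z.div_mod a P ltac:(lia)). assert (Ea' := Z.div_mod a' P ltac:(lia)).
  assert (Ba := Z.mod_pos_bound a P HP). assert (Ba' := Z.mod_pos_bound a' P HP).
  assert (Hdd : (Z.abs (a' - a) <= b)%Z) by (unfold a, a'; lia).
  destruct (Z.lt_trichotomy (a' / P) (a / P)) as [Hlt|[Heq|Hlt]]; [exfalso|exact Heq|exfalso]; nia.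
Qed.

Lemma off_slab_period b P j x y : (P | y)%Z -> (0 < P)%Z -> off_slab b P j (x + y) <-> off_slab b P j x.
Proof.
  intros [z ->] HP. unfold off_slab.
  replace (x + z * P - Z.of_nat j * b)%Z with (x - Z.of_nat j * b + z * P)%Z by lia.
  rewrite Z.mod_add by lia. reflexivity.
Qed.

Lemma same_slab_close b P j x x' : (0 < P)%Z ->
  ((x' - Z.of_nat j * b) / P = (x - Z.of_nat j * b) / P)%Z -> (Z.abs (x' - x) <= P)%Z.
Proof.
  intros HP H.
  assert (Ea := Z.div_mod (x - Z.of_nat j * b) P ltac:(lia)).
  assert (Ea' := Z.div_mod (x' - Z.of_nat j * b) P ltac:(lia)).
  assert (Ba := Z.mod_pos_bound (x - Z.of_nat j * b) P HP).
  assert (Ba' := Z.mod_pos_bound (x' - Z.of_nat j * b) P HP). rewrite H in Ea'. lia.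
Qed.

Lemma run_suffix A w x r : length w <= length x ->
  exists x', run A w (x ++ r) = x' ++ r /\ length x <= length x' + length w /\ length x' <= length x + length w.
Proof.
  revert x; induction w as [|l w IH]; intros x H; [exists x; split; [reflexivity | lia]|].
  change (run A (l :: w) (x ++ r)) with (run A w (step A (x ++ r) l)). simpl in H.
  unfold step. destruct (A l).
  - destruct x as [|h x]; [simpl in H; lia|]. simpl in H. simpl push.
    destruct (letter_eq_dec h (inv_letter l)).
    + destruct (IH x ltac:(lia)) as [x' [H1 H2]]. exists x'. simpl. split; [exact H1 | lia].
    + destruct (IH (l :: h :: x) ltac:(simpl; lia)) as [x' [H1 H2]]. exists x'. simpl in *. split; [exact H1 | lia].
  - destruct (IH x ltac:(lia)) as [x' [H1 H2]]. exists x'. simpl. split; [exact H1 | lia].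
Qed.

Lemma run_length_diff A w st :
  length st <= length (run A w st) + length w /\ length (run A w st) <= length st + length w.
Proof.
  revert st; induction w as [|l w IH]; intros st; [simpl; lia|].
  change (run A (l :: w) st) with (run A w (step A st l)).
  assert (Hs : length st <= length (step A st l) + 1 /\ length (step A st l) <= length st + 1).
  { unfold step. destruct (A l); [|lia]. destruct st as [|h st]; simpl; [lia|].
    destruct letter_eq_dec; simpl; lia. }
  specialize (IH (step A st l)). simpl length. lia.
Qed.

Lemma off_slab_zero_step b P j h : (0 < b)%Z -> (0 < P)%Z -> (Z.of_nat j * b + b <= P)%Z ->
  (0 <= h)%Z -> off_slab b P j h ->
  let l := Z.to_nat (Z.of_nat j * b + P * ((h - Z.of_nat j * b) / P)) in
  l = 0 \/ (Z.of_nat l + b <= h)%Z.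
Proof.
  intros Hb HP Hj Hh Ho l. unfold off_slab in Ho.
  assert (Ea := Z.div_mod (h - Z.of_nat j * b) P ltac:(lia)).
  destruct (Z_le_gt_dec (Z.of_nat j * b + P * ((h - Z.of_nat j * b) / P)) 0) as [H|H]; unfold l; lia.
Qed.

(* Tree coordinate: along a chain avoiding slab [j] of the heights, the reduced words share a long initial part. *)
Lemma tree_slab A b P j (st : word) : (0 < b)%Z -> (0 < P)%Z -> (Z.of_nat j * b + b <= P)%Z ->
  off_slab b P j (Z.of_nat (length st)) ->
  exists r, (exists x, st = x ++ r /\ (Z.of_nat (length x) <= P)%Z) /\
  forall st1 st2 w, off_slab b P j (Z.of_nat (length st1)) -> off_slab b P j (Z.of_nat (length st2)) ->
    (Z.of_nat (length w) <= b)%Z -> st2 = run A w st1 ->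
    (exists x, st1 = x ++ r) /\ ((Z.of_nat (length st1) - Z.of_nat j * b) / P = (Z.of_nat (length st) - Z.of_nat j * b) / P)%Z ->
    (exists x, st2 = x ++ r /\ (Z.of_nat (length x) <= P)%Z) /\
    ((Z.of_nat (length st2) - Z.of_nat j * b) / P = (Z.of_nat (length st) - Z.of_nat j * b) / P)%Z.
Proof.
  intros Hb HP Hj Ho.
  set (q := ((Z.of_nat (length st) - Z.of_nat j * b) / P)%Z).
  set (l := Z.to_nat (Z.of_nat j * b + P * q)).
  assert (Hl : forall h, (0 <= h)%Z -> off_slab b P j h -> ((h - Z.of_nat j * b) / P = q)%Z ->
     (l = 0 \/ (Z.of_nat l + b <= h)%Z) /\ (h - Z.of_nat l <= P)%Z).
  { intros h Hh Hoh Hq. split.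
    - assert (H := off_slab_zero_step b P j h Hb HP Hj Hh Hoh). cbv zeta in H. rewrite Hq in H. exact H.
    - assert (Ea := Z.div_mod (h - Z.of_nat j * b) P ltac:(lia)).
      assert (Ba := Z.mod_pos_bound (h - Z.of_nat j * b) P HP). rewrite Hq in Ea. unfold l. lia. }
  assert (Hst := Hl _ (Nat2Z.is_nonneg _) Ho eq_refl).
  exists (skipn (length st - l) st). split.
  { exists (firstn (length st - l) st). rewrite firstn_skipn. split; [reflexivity|].
    rewrite length_firstn. lia. }
  intros st1 st2 w H1 H2 Hw E [[x Ex] Hq].
  assert (Hd := run_length_diff A w st1). rewrite <- E in Hd.
  assert (Hq2 : ((Z.of_nat (length st2) - Z.of_nat j * b) / P = q)%Z).
  { rewrite <- Hq. apply slab_step; auto. lia. }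
  split; [|exact Hq2].
  assert (L1 := Hl _ (Nat2Z.is_nonneg _) H1 Hq). assert (L2 := Hl _ (Nat2Z.is_nonneg _) H2 Hq2).
  assert (Lr : length (skipn (length st - l) st) = l) by (rewrite length_skipn; lia).
  destruct (Nat.eq_dec l 0) as [Hz|Hz].
  - exists st2. split.
    + replace (skipn (length st - l) st) with (@nil letter); [now rewrite app_nil_r|].
      symmetry; apply length_zero_iff_nil; lia.
    + lia.
  - assert (Lx : length st1 = length x + l) by (rewrite Ex, length_app; lia).
    destruct (run_suffix A w x (skipn (length st - l) st)) as [x' [Ex' _]]; [lia|].
    exists x'. rewrite <- Ex in Ex'. split; [congruence|].
    assert (length st2 = length x' + l) by (rewrite E, Ex', length_app; lia). lia.
Qed.

Lemma pigeonhole_avoid (L : list nat) K : length L < K -> exists j, j < K /\ ~ In j L.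
Proof.
  intros H. apply NNPP; intros Hn.
  assert (Hi : incl (seq 0 K) L).
  { intros j Hj. apply in_seq in Hj. apply NNPP; intros Hj'. apply Hn; exists j; split; [lia | exact Hj']. }
  apply NoDup_incl_length in Hi; [|apply seq_NoDup]. rewrite length_seq in Hi. lia.
Qed.

Lemma reduced_suffix x r : reduced (x ++ r) -> reduced r.
Proof. induction x as [|l x IH]; [auto|]. intros H; apply IH. simpl in H. tauto. Qed.

(** * Central coordinates relative to a base word *)

Section Zeta.
Variables (c : nat) (N B : nat -> nat -> Z).
Let E := weq c N B.
Let HE := weq_congruence c N B.

(* The central coordinate measured from the reduced word [r0] of the base tree. *)
Definition zeta (r0 : word) (s i : nat) (g : word) : Z := cent c (fsi B s i) (winv (rev r0) ++ g).

Definition cross (f : Z -> Z) (u w : word) : Z := asum c (fun x => bsum c f (x + pos c w) w)%Z u.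

(** Multiplication by the inverse of the base word leaves [x] as the reduced word in the first tree,
    so only the letters a above the base enter the cross term. *)
Lemma zeta_step r0 x g h w s i : Ured c g = x ++ r0 -> E (g ++ w) h ->
  (N s i | zeta r0 s i h - (zeta r0 s i g + cent c (fsi B s i) w + cross (fsi B s i) (rev x) w))%Z.
Proof.
  intros HU Hw. set (r := winv (rev r0)).
  assert (H1 : E (r ++ (g ++ w)) (r ++ h)).
  { apply (wc_app _ HE); [apply (wc_refl _ HE) | exact Hw]. }
  assert (H2 := weq_Z _ _ _ _ _ H1 s i). rewrite app_assoc, cent_app in H2.
  replace (asum c (fun p => bsum c (fsi B s i) (p + pos c w) w)%Z (r ++ g))
    with (cross (fsi B s i) (rev x) w) in H2.
  - destruct H2 as [z Hz]. exists (- z)%Z. unfold zeta. fold r. lia.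
  - unfold cross. rewrite (asum_U c (rev x)), (asum_U c (r ++ g)). f_equal. f_equal.
    assert (Hr0 : Ured c (rev r0) = [] ++ r0).
    { apply run_rev_reduced.
      - pose proof (Ured_reduced c g) as Hr. rewrite HU in Hr. exact (reduced_suffix x r0 Hr).
      - intros l Hl. apply (Ured_in c g). rewrite HU. apply in_or_app; now right. }
    symmetry. apply (red_diff (inU c) _ _ [] x r0 (inU_inv c) Hr0 HU).
Qed.

Lemma cross_V f u w : cross f u w = cross f u (rev (Vred c w)).
Proof.
  unfold cross. apply asum_ext. intros q. rewrite pos_V, bsum_V. reflexivity.
Qed.

Definition extraword (e : nat -> Z) : word := concat (map (fun i => lp i (e i)) (seq 3 c)).

Lemma extraword_in e l : In l (extraword e) -> 3 <= fst l < 3 + c.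
Proof.
  unfold extraword. intros H. apply in_concat in H as [v [Hv Hl]].
  apply in_map_iff in Hv as [i [<- Hi]]. apply in_seq in Hi. apply lp_in in Hl. lia.
Qed.

Lemma extraword_UV e : Ured c (extraword e) = [] /\ Vred c (extraword e) = [].
Proof.
  split; apply run_id; intros l Hl; apply extraword_in in Hl; unfold inU, inV;
    destruct (Nat.eqb_spec (fst l) 0), (Nat.eqb_spec (fst l) 1), (Nat.eqb_spec (fst l) 2),
      (Nat.eqb_spec (fst l) (3 + c)); try lia; reflexivity.
Qed.

Lemma extraword_expo e i : 3 <= i < 3 + c -> expo i (extraword e) = e i.
Proof.
  intros Hi. unfold extraword.
  assert (H : forall n a, expo i (concat (map (fun i => lp i (e i)) (seq a n))) =
     if (a <=? i) && (i <? a + n) then e i else 0%Z).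
  { induction n as [|n IH]; intros a.
    - cbn [seq map concat]. destruct (Nat.leb_spec a i), (Nat.ltb_spec i (a + 0)); try reflexivity. lia.
    - cbn [seq map concat]. rewrite expo_app, IH, expo_lp.
      destruct (Nat.eqb_spec a i), (Nat.leb_spec a i), (Nat.leb_spec (S a) i),
        (Nat.ltb_spec i (S a + n)), (Nat.ltb_spec i (a + S n)); subst; cbn [andb]; lia. }
  rewrite H. destruct (Nat.leb_spec 3 i), (Nat.ltb_spec i (3 + c)); try lia. reflexivity.
Qed.

Lemma extraword_length e K : (forall i, 3 <= i < 3 + c -> (Z.abs (e i) <= Z.of_nat K)%Z) ->
  length (extraword e) <= c * K.
Proof.
  intros H. unfold extraword.
  assert (Hn : forall n a, 3 <= a -> a + n <= 3 + c ->
     length (concat (map (fun i => lp i (e i)) (seq a n))) <= n * K).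
  { induction n as [|n IH]; intros a Ha Hn; [simpl; lia|].
    cbn [seq map concat]. rewrite length_app, lp_length.
    assert (H1 := H a ltac:(lia)). assert (H2 := IH (S a) ltac:(lia) ltac:(lia)). lia. }
  apply Hn; lia.
Qed.

Lemma cent_app_extra f u e : cent c f (u ++ extraword e) = cent c f u.
Proof.
  rewrite cent_app, (cent_bfree c f (extraword e)).
  - unfold asum. rewrite lsum_zero_fun; [lia|]. intros q; apply bsum_free.
    intros l Hl; apply extraword_in in Hl; lia.
  - intros l Hl; apply extraword_in in Hl; lia.
Qed.

(** The connecting word has three independent parts: [realize] for the two trees, [cw] for the
    central error of that lift, [extraword] for the abelian letters. *)
Lemma realize_near p g h y cw : 3 + c <= p -> vp p y -> E y (winv g ++ h) -> cword c p cw ->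
  (forall s i, (N s i | cent c (fsi B s i) cw - (cent c (fsi B s i) y - cent c (fsi B s i) (realize c y)))%Z) ->
  near E p (length (realize c y) + length cw + length (extraword (fun i => expo i y))) g h.
Proof.
  intros Hp Hy HEy Hcw Hz. set (e := fun i => expo i y).
  exists ((realize c y ++ cw) ++ extraword e). split; [|split].
  - rewrite !vp_app. split; [split; [now apply realize_vp | apply Hcw]|].
    intros l Hl; apply extraword_in in Hl; lia.
  - rewrite !length_app. lia.
  - apply (E_move _ HE). apply (wc_trans _ HE) with y; [|exact HEy].
    destruct (extraword_UV e) as [EU EV].
    split.
    + unfold Ured in *.
      pose proof (run_congruence (inU c) (inU_inv c)) as HC.
      rewrite <- app_assoc.
      transitivity (run (inU c) (y ++ []) []); [|now rewrite app_nil_r].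
      apply (wc_app _ HC); [apply realize_U|]. rewrite run_app.
      change (run (inU c) cw []) with (Ured c cw). rewrite (cw_U _ _ _ Hcw). exact EU.
    + unfold Vred in *.
      pose proof (run_congruence (inV c) (inV_inv c)) as HC.
      rewrite <- app_assoc.
      transitivity (run (inV c) (y ++ []) []); [|now rewrite app_nil_r].
      apply (wc_app _ HC); [apply realize_V|]. rewrite run_app.
      change (run (inV c) cw []) with (Vred c cw). rewrite (cw_V _ _ _ Hcw). exact EV.
    + intros i Hi. rewrite !expo_app, realize_expo, extraword_expo, (cw_e _ _ _ Hcw) by exact Hi. unfold e; lia.
    + intros s i. rewrite cent_app_extra, (cword_cent_app_r _ _ _ _ _ Hcw).
      destruct (Hz s i) as [z Hz']. exists z. lia.
Qed.

End Zeta.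

(** * Coloured covers of columns *)

Section Column.
Variables (c p : nat) (N B : nat -> nat -> Z).
Let E := weq c N B.
Let HE := weq_congruence c N B.
Hypothesis Hp : 3 + c <= p.

Variables (r0 : word) (R rho Vc : nat) (cuts : list (nat * nat)).
Let Kf : nat := 2 + c + length cuts.
Definition column (g : word) : Prop := vp p g /\ exists x, Ured c g = x ++ r0 /\ length x <= R.

(** A step of length [rho] inside a column moves a central coordinate by at most [rho ^ 2] through
    its own value and [rho ^ 2] through the cross term. The period [Pz] is rounded up to a power of
    2 so that it divides every cyclic order that is at least as large. *)
Let bz : Z := (2 * Z.of_nat rho * Z.of_nat rho)%Z.
Let Pz : Z := (2 ^ Z.log2_up (Z.of_nat Kf * bz))%Z.
Let Pt : Z := (Z.of_nat Kf * Z.of_nat rho)%Z.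

(** A cut coordinate whose order is not divisible by [Pz] is a circle with fewer than [Pz] elements
    and is bounded without a slab. *)
Definition colour (j : nat) (g : word) : Prop :=
  off_slab (Z.of_nat rho) Pt j (Z.of_nat (length (Vred c g))) /\
  (forall i, 3 <= i < 3 + c -> off_slab (Z.of_nat rho) Pt j (expo i g)) /\
  (forall s i, In (s, i) cuts -> (Pz | N s i)%Z -> off_slab bz Pz j (zeta c B r0 s i g)).

Hypothesis Hrho : 1 <= rho.
Hypothesis HR : R <= rho.
Hypothesis Hcut_f : forall s i, In (s, i) cuts -> fbounded c p (fsi B s i).
Hypothesis Hcut_N : forall s i e, In (s, i) cuts -> (0 <= e)%Z -> (2 ^ e | N s i)%Z \/ (0 < N s i < 2 ^ e)%Z.
Hypothesis Hcentral : forall kap : nat -> nat -> Z,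
  (forall s i, (16 + 8 * Kf) * rho < slot s i -> i < s -> (N s i | kap s i)%Z) ->
  (forall s i, In (s, i) cuts -> exists y, (Z.abs (kap s i - N s i * y) <=
     Z.of_nat ((6 * Kf + (4 + 2 * Kf) * (4 + 2 * Kf)) * (rho * rho)))%Z) ->
  exists w, cword c p w /\ (forall s i, (N s i | cent c (fsi B s i) w - kap s i)%Z) /\ length w <= Vc.

Lemma bz_pos : (0 < bz)%Z. Proof. unfold bz; nia. Qed.
Lemma Pz_bounds : (Z.of_nat Kf * bz <= Pz)%Z /\ (Pz <= 2 * (Z.of_nat Kf * bz))%Z /\ (0 < Pz)%Z.
Proof.
  assert (Hb := bz_pos).
  assert (H2 : (1 < Z.of_nat Kf * bz)%Z) by (unfold Kf; nia).
  destruct (Z.log2_up_spec _ H2) as [H3 H4].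
  assert (H5 := Z.log2_up_nonneg (Z.of_nat Kf * bz)).
  assert (H6 := Z.log2_up_pos _ H2).
  fold Pz in H4. split; [exact H4|].
  assert (Ep : (Pz = 2 * 2 ^ Z.pred (Z.log2_up (Z.of_nat Kf * bz)))%Z).
  { unfold Pz. rewrite <- Z.pow_succ_r by lia. f_equal. lia. }
  lia.
Qed.

(** There are [Kf - 1] coordinates, namely one tree, [c] exponents and the cuts, and each of them
    forbids at most one of the [Kf] colours. *)
Lemma column_colours g : column g -> exists j, j < Kf /\ colour j g.
Proof.
  intros _. assert (Hb := bz_pos). destruct Pz_bounds as [P1 [P2 P3]].
  set (L := slab_index (Z.of_nat rho) Pt (Z.of_nat (length (Vred c g))) ::
    map (fun i => slab_index (Z.of_nat rho) Pt (expo i g)) (seq 3 c) ++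
    map (fun x => slab_index bz Pz (zeta c B r0 (fst x) (snd x) g)) cuts).
  destruct (pigeonhole_avoid L Kf) as [j [Hj HL]].
  { unfold L, Kf. simpl. rewrite length_app, !length_map, length_seq. lia. }
  exists j. split; [exact Hj|].
  assert (Q1 : (Z.of_nat j * Z.of_nat rho + Z.of_nat rho <= Pt)%Z) by (unfold Pt; nia).
  split; [|split].
  - apply slab_index_spec; [lia | exact Q1|]. intros Heq; apply HL; unfold L; left; exact Heq.
  - intros i Hi. apply slab_index_spec; [lia | exact Q1|]. intros Heq; apply HL; unfold L; right.
    apply in_or_app; left. apply in_map_iff. exists i; split; [exact Heq | apply in_seq; lia].
  - intros s i Hin _. apply slab_index_spec; [exact Hb | nia|]. intros Heq; apply HL; unfold L; right.
    apply in_or_app; right. apply in_map_iff. exists (s, i); split; [exact Heq | exact Hin].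
Qed.

(** Along a chain of one colour no coordinate crosses a slab. Its endpoints therefore differ by a
    controlled amount in every coordinate, and [Hcentral] converts the central difference into a
    word. *)
Lemma column_small j : j < Kf ->
  small E p rho ((4 + (2 + c) * Kf) * rho + Vc) (fun g => column g /\ colour j g).
Proof.
  intros Hj g h Hch. assert (Hb := bz_pos). destruct Pz_bounds as [P1 [P2 P3]].
  assert (Hrz : (0 < Z.of_nat rho)%Z) by lia. assert (HPt : (0 < Pt)%Z) by (unfold Pt, Kf; nia).
  assert (Q1 : (Z.of_nat j * Z.of_nat rho + Z.of_nat rho <= Pt)%Z) by (unfold Pt; nia).
  destruct (chain_dom _ _ _ _ _ _ Hch) as [[[Hgv [xg [Hgu Hgx]]] Cg] [[Hhv [xh [Hhu Hhx]]] Ch]].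
  destruct Cg as [Cg1 [Cg2 Cg3]].
  destruct (tree_slab (inV c) (Z.of_nat rho) Pt j (Vred c g) Hrz HPt Q1 Cg1) as [rv [[xv [Exv Lxv]] Htree]].
  set (blk := fun b P x => ((x - Z.of_nat j * b) / P)%Z).
  (* A cut coordinate is only known modulo its order; the witness [y] lifts it to the integers so
     that it stays between the same two slabs. Coordinates with distant slots do not change at
     all. *)
  set (Inv := fun z : word =>
    ((exists x, Vred c z = x ++ rv /\ (Z.of_nat (length x) <= Pt)%Z) /\
     blk (Z.of_nat rho) Pt (Z.of_nat (length (Vred c z))) = blk (Z.of_nat rho) Pt (Z.of_nat (length (Vred c g)))) /\
    (forall i, 3 <= i < 3 + c -> blk (Z.of_nat rho) Pt (expo i z) = blk (Z.of_nat rho) Pt (expo i g)) /\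
    (forall s i, In (s, i) cuts -> (Pz | N s i)%Z -> exists y,
       blk bz Pz (zeta c B r0 s i z + N s i * y)%Z = blk bz Pz (zeta c B r0 s i g)) /\
    (forall s i, (16 + 8 * Kf) * rho < slot s i -> (N s i | zeta c B r0 s i z - zeta c B r0 s i g)%Z)).
  assert (HInv : Inv h).
  { apply (chain_inv E p (fun g => column g /\ colour j g) Inv rho g h); [| |exact Hch].
    - repeat split; auto.
      + exists xv; auto.
      + intros s i _ _; exists 0%Z. now replace (zeta c B r0 s i g + N s i * 0)%Z with (zeta c B r0 s i g) by lia.
      + intros s i _. rewrite Z.sub_diag. apply Z.divide_0_r.
    - intros z z' [I1 [I2 [I3 I4]]] [[Hzv [xz [Hzu Hzx]]] [Cz1 [Cz2 Cz3]]] [[Hzv' _] [Cz1' [Cz2' Cz3']]] [w [W1 [W2 W3]]].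
      assert (Hlw : (Z.of_nat (length w) <= Z.of_nat rho)%Z) by lia.
      split; [|split; [|split]].
      + destruct I1 as [[x [Ex _]] I1]. apply (Htree (Vred c z) (Vred c z') w); auto.
        * rewrite <- (weq_V _ _ _ _ _ W3). unfold Vred. now rewrite run_app.
        * split; [now exists x | exact I1].
      + intros i Hi. rewrite <- (I2 i Hi). apply slab_step; auto.
        rewrite <- (weq_e _ _ _ _ _ W3 i Hi), expo_app.
        replace (expo i z + expo i w - expo i z)%Z with (expo i w) by lia.
        eapply Z.le_trans; [|exact Hlw]. unfold expo. rewrite <- (Z.mul_1_l (Z.of_nat (length w))).
        apply (lsum_bound (fun _ => 0%Z)) with (P := fun _ => True); auto; try lia.
        apply mlet_abs.
      + intros s i Hin HP. destruct (I3 s i Hin HP) as [y Hy].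
        assert (Hf := Hcut_f s i Hin).
        destruct (zeta_step c N B r0 xz z z' w s i Hzu W3) as [k Hk].
        exists (y - k)%Z. rewrite <- Hy. apply slab_step; auto.
        * apply off_slab_period; auto. now apply Z.divide_mul_l.
        * apply off_slab_period; auto. now apply Z.divide_mul_l.
        * assert (B1 := cent_bound c p (fsi B s i) w Hf W1).
          assert (Hxz : vp p (rev xz)).
          { apply vp_rev. intros l Hl. apply Hzv. apply (Ured_in c). rewrite Hzu. apply in_or_app; now left. }
          (* This uses the bounded height of the column: [xz] has at most [R] letters and
             [R <= rho]. *)
          assert (B2 := cross_bound c p (fsi B s i) (rev xz) w Hf Hxz W1).
          fold (cross c (fsi B s i) (rev xz) w) in B2. rewrite length_rev in B2.
          assert (Hxz2 : (Z.of_nat (length xz) <= Z.of_nat rho)%Z) by lia.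
          assert (Z.of_nat (length w) * Z.of_nat (length w) <= Z.of_nat rho * Z.of_nat rho)%Z by (apply Z.mul_le_mono_nonneg; lia).
          assert (Z.of_nat (length w) * Z.of_nat (length xz) <= Z.of_nat rho * Z.of_nat rho)%Z by (apply Z.mul_le_mono_nonneg; lia).
          unfold bz. lia.
      + intros s i Hs. destruct (I4 s i Hs) as [k1 Hk1].
        destruct (zeta_step c N B r0 xz z z' w s i Hzu W3) as [k Hk].
        assert (HD := Hs). assert (Hv := fsi_vanish B s i).
        rewrite (cent_vanish c _ _ _ Hv) in Hk by nia.
        unfold cross in Hk. rewrite (cross_vanish c _ _ _ _ Hv) in Hk by (rewrite length_rev; nia).
        exists (k1 + k)%Z. lia. }
  destruct HInv as [[[x' [Ex' Lx']] _] [I2 [I3 I4]]].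
  set (y := winv g ++ h).
  assert (Hyv : vp p y) by (apply vp_app; split; [now apply vp_winv | exact Hhv]).
  assert (HgyE : E (g ++ y) h) by (apply (E_move _ HE); apply (wc_refl _ HE)).
  assert (LU : length (Ured c y) <= 2 * rho).
  { assert (H := red_diff_length (inU c) g h xg xh r0 (inU_inv c) Hgu Hhu). unfold Ured, y in *. lia. }
  assert (LV : length (Vred c y) <= 2 * Kf * rho).
  { assert (H := red_diff_length (inV c) g h xv x' rv (inV_inv c) Exv Ex'). unfold Vred, y in *. unfold Pt in *. lia. }
  assert (LR : length (realize c y) <= (4 + 2 * Kf) * rho) by (assert (H := realize_length c y); nia).
  assert (HVr : vp p (rev (Vred c y))) by (apply vp_rev; intros l Hl; apply Hyv; now apply Vred_in in Hl).
  assert (Hxgv : vp p (rev xg)).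
  { apply vp_rev. intros l Hl. apply Hgv. apply (Ured_in c). rewrite Hgu. apply in_or_app; now left. }
  (* The target is the central error of the lift. Its bound consists of the period [Pz], at most
     [4 * Kf * rho ^ 2], a cross term of at most [2 * Kf * rho ^ 2], and the square of the length of
     [realize c y]. *)
  destruct (Hcentral (fun s i => cent c (fsi B s i) y - cent c (fsi B s i) (realize c y))%Z) as [cw [C1 [C2 C3]]].
  - intros s i Hs Hi. destruct (I4 s i Hs) as [k1 Hk1].
    destruct (zeta_step c N B r0 xg g h y s i Hgu HgyE) as [k Hk].
    assert (HD := Hs). assert (Hv := fsi_vanish B s i).
    rewrite (cent_vanish c _ _ (realize c y) Hv) by nia.
    rewrite cross_V in Hk. unfold cross in Hk.
    rewrite (cross_vanish c _ _ _ _ Hv) in Hk by (rewrite !length_rev; nia).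
    exists (k1 - k)%Z. lia.
  - intros s i Hin. assert (Hf := Hcut_f s i Hin).
    destruct (zeta_step c N B r0 xg g h y s i Hgu HgyE) as [k Hk]. rewrite cross_V in Hk.
    assert (B1 := cross_bound c p (fsi B s i) (rev xg) (rev (Vred c y)) Hf Hxgv HVr).
    fold (cross c (fsi B s i) (rev xg) (rev (Vred c y))) in B1. rewrite !length_rev in B1.
    assert (B2 := cent_bound c p (fsi B s i) (realize c y) Hf (realize_vp c p y Hyv)).
    assert (Hz : exists y', (Z.abs (zeta c B r0 s i h + N s i * y' - zeta c B r0 s i g) <= Pz)%Z).
    { destruct (Hcut_N s i (Z.log2_up (Z.of_nat Kf * bz)) Hin (Z.log2_up_nonneg _)) as [HP|HP]; fold Pz in HP.
      - destruct (I3 s i Hin HP) as [y' Hy']. exists y'. now apply (same_slab_close bz Pz j).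
      (* The circle is shorter than the period, so reduction modulo its order already gives the
         bound. *)
      - exists (- ((zeta c B r0 s i h - zeta c B r0 s i g) / N s i))%Z.
        assert (Hd := Z.div_mod (zeta c B r0 s i h - zeta c B r0 s i g) (N s i) ltac:(lia)).
        assert (Hd' := Z.mod_pos_bound (zeta c B r0 s i h - zeta c B r0 s i g) (N s i) ltac:(lia)). lia. }
    destruct Hz as [y' Hy']. exists (- (y' + k))%Z.
    assert (M1 : (Z.of_nat (length (Vred c y)) * Z.of_nat (length xg) <= (2 * Z.of_nat Kf * Z.of_nat rho) * Z.of_nat rho)%Z)
      by (apply Z.mul_le_mono_nonneg; lia).
    assert (M2 : (Z.of_nat (length (realize c y)) * Z.of_nat (length (realize c y)) <=
       ((4 + 2 * Z.of_nat Kf) * Z.of_nat rho) * ((4 + 2 * Z.of_nat Kf) * Z.of_nat rho))%Z)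
      by (apply Z.mul_le_mono_nonneg; lia).
    unfold bz in *. lia.
  - assert (HN := realize_near c N B p g h y cw Hp Hyv (wc_refl _ HE _) C1 C2).
    eapply near_mono; [|exact HN].
    assert (LE : length (extraword c (fun i => expo i y)) <= c * (Kf * rho)).
    { apply extraword_length. intros i Hi. unfold y. rewrite expo_app, expo_winv.
      replace (- expo i g + expo i h)%Z with (expo i h - expo i g)%Z by lia.
      rewrite Nat2Z.inj_mul. apply (same_slab_close (Z.of_nat rho) Pt j); [exact HPt | exact (I2 i Hi)]. }
    nia.
Qed.

End Column.

(** * Gluing over the base tree *)

Section Heights.
Variables (L w r : nat).
Hypothesis Hr : r < w.
Hypothesis HwL : w <= L.

Definition blk0 (h : nat) : nat := (h + L) / (2 * L).
Definition blk1 (h : nat) : nat := h / (2 * L).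
(* The distance of [h] from the nearest multiple of [2 * L]. *)
Definition dist0 (h : nat) : nat := let t := (h + L) mod (2 * L) in (t - L) + (L - t).

Definition close (h h' : nat) : Prop := h <= h' + r /\ h' <= h + r.

Lemma dist0_step h h' : close h h' -> dist0 h' <= dist0 h + r.
Proof.
  intros [H1 H2]. unfold dist0.
  assert (HL : 2 * L <> 0) by lia.
  assert (E := Nat.div_mod (h + L) (2 * L) HL). assert (E' := Nat.div_mod (h' + L) (2 * L) HL).
  assert (B := Nat.mod_upper_bound (h + L) (2 * L) HL). assert (B' := Nat.mod_upper_bound (h' + L) (2 * L) HL).
  set (t := (h + L) mod (2 * L)) in *. set (t' := (h' + L) mod (2 * L)) in *.
  set (k := (h + L) / (2 * L)) in *. set (k' := (h' + L) / (2 * L)) in *.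
  destruct (lt_eq_lt_dec k k') as [[Hk|Hk]|Hk].
  - assert (2 * L * k' >= 2 * L * k + 2 * L) by nia. lia.
  - rewrite Hk in E. lia.
  - assert (2 * L * k >= 2 * L * k' + 2 * L) by nia. lia.
Qed.

(** The truncated subtraction places the bottom of the lowest column at the root. There is nothing
    below it to fall into, so the margin [w] is demanded of the other columns only. *)
Lemma blk0_step h h' : close h h' -> dist0 h + w <= L ->
  blk0 h' = blk0 h /\ (2 * L * blk0 h - L = 0 \/ 2 * L * blk0 h - L + w <= h) /\ h <= 2 * L * blk0 h - L + 2 * L.
Proof.
  intros [H1 H2] HD. unfold dist0, blk0 in *.
  assert (HL : 2 * L <> 0) by lia.
  assert (E := Nat.div_mod (h + L) (2 * L) HL).
  assert (B := Nat.mod_upper_bound (h + L) (2 * L) HL).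
  set (t := (h + L) mod (2 * L)) in *. set (k := (h + L) / (2 * L)) in *.
  split; [|nia]. symmetry.
  apply (Nat.div_unique _ _ k (h' + L - 2 * L * k)); lia.
Qed.

Lemma blk1_step h h' : close h h' -> w <= dist0 h ->
  blk1 h' = blk1 h /\ 2 * L * blk1 h + w <= h /\ h <= 2 * L * blk1 h + 2 * L.
Proof.
  intros [H1 H2] HD. unfold dist0, blk1 in *.
  assert (HL : 2 * L <> 0) by lia.
  assert (E := Nat.div_mod (h + L) (2 * L) HL). assert (E' := Nat.div_mod h (2 * L) HL).
  assert (B := Nat.mod_upper_bound (h + L) (2 * L) HL). assert (B' := Nat.mod_upper_bound h (2 * L) HL).
  set (t := (h + L) mod (2 * L)) in *. set (k := (h + L) / (2 * L)) in *.
  set (t' := h mod (2 * L)) in *. set (k' := h / (2 * L)) in *.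
  assert (Hkk : k = k' \/ k = S k').
  { destruct (lt_eq_lt_dec k k') as [[Hk|Hk]|Hk]; [|auto|].
    - assert (2 * L * k' >= 2 * L * k + 2 * L) by nia. lia.
    - destruct (Nat.eq_dec k (S k')); [auto|]. assert (2 * L * k >= 2 * L * k' + 4 * L) by nia. lia. }
  assert (Hb : w <= t' /\ t' + w <= 2 * L).
  { destruct Hkk as [Hk|Hk].
    - rewrite Hk in E. lia.
    - assert (2 * L * k = 2 * L * k' + 2 * L) by nia. lia. }
  split; [|lia]. symmetry.
  apply (Nat.div_unique _ _ k' (h' - 2 * L * k')); lia.
Qed.

End Heights.

Section Gluing.
Variables (c p : nat) (N B : nat -> nat -> Z).
Let E := weq c N B.
Let HE := weq_congruence c N B.
Variables (M r V0 V1 rho0 rho1 : nat).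
Let w := S r.
(** [M + 1] zones host the missing colours, the next one is the overlap of the two stages, and the
    last one keeps distinct columns of stage 0 apart. *)
Let L := (M + 3) * w.
Variables fam0 fam1 : word -> nat -> word -> Prop.
Hypothesis cover0 : forall r0 g, column c p r0 (2 * L) g -> exists j, j < M /\ fam0 r0 j g.
Hypothesis cover1 : forall r0 g, column c p r0 (2 * L) g -> exists j, j < M /\ fam1 r0 j g.
Hypothesis small0 : forall r0 j, j < M -> small E p rho0 V0 (fun g => column c p r0 (2 * L) g /\ fam0 r0 j g).
Hypothesis small1 : forall r0 j, j < M -> small E p rho1 V1 (fun g => column c p r0 (2 * L) g /\ fam1 r0 j g).
Hypothesis Hrho0 : r <= rho0.
Hypothesis Hrho1 : V0 + 2 * r <= rho1.

Let ht (g : word) : nat := length (Ured c g).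
Let d (g : word) : nat := dist0 L (ht g).
Let lev0 (g : word) : nat := 2 * L * blk0 L (ht g) - L.
Let lev1 (g : word) : nat := 2 * L * blk1 L (ht g).
Definition bottom (l : nat) (st : word) : word := skipn (length st - l) st.
Let C0 (j : nat) (g : word) : Prop := fam0 (bottom (lev0 g) (Ured c g)) j g.
Let C1 (j : nat) (g : word) : Prop := fam1 (bottom (lev1 g) (Ured c g)) j g.

(* Zones are counted in multiples of [w] from the nearest centre of a stage 0 column.
   Colour k is not used in zone [M - k]; nearer to the centre it carries the family number k
   of stage 0, farther away the family number k - 1 of stage 0 and then number k of stage 1. *)
Let glued (k : nat) (g : word) : Prop := vp p g /\
  ((d g < (M - k) * w /\ C0 k g) \/
   ((M - k) * w + w <= d g /\
     ((d g < (M + 2) * w /\ 1 <= k /\ C0 (k - 1) g) \/ ((M + 1) * w <= d g /\ k < M /\ C1 k g)))).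

Lemma near_close g h : near E p r g h -> close r (ht g) (ht h) /\
  exists v, length v <= r /\ Ured c h = run (inU c) v (Ured c g).
Proof.
  intros [v [H1 [H2 H3]]]. assert (Hu : Ured c h = run (inU c) v (Ured c g)).
  { rewrite <- (weq_U _ _ _ _ _ H3). unfold Ured. now rewrite run_app. }
  split; [|exists v; auto]. assert (Hd := run_length_diff (inU c) v (Ured c g)).
  unfold close, ht. rewrite Hu. lia.
Qed.

Lemma bottom_app x st l : length st = l -> bottom l (x ++ st) = st.
Proof.
  intros H. unfold bottom. rewrite length_app. replace (length x + length st - l) with (length x) by lia.
  rewrite skipn_app, skipn_all, Nat.sub_diag. reflexivity.
Qed.

Lemma bottom_split l st : l <= length st -> exists x, st = x ++ bottom l st /\ length x = length st - l /\ length (bottom l st) = l.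
Proof.
  intros H. exists (firstn (length st - l) st). unfold bottom. rewrite firstn_skipn.
  rewrite length_firstn, length_skipn. split; [reflexivity | lia].
Qed.

Lemma suffix_kept g h l r0 : near E p r g h -> length r0 = l -> l = 0 \/ l + w <= ht g ->
  (exists x, Ured c g = x ++ r0) -> exists x, Ured c h = x ++ r0.
Proof.
  intros Hn Hl Hh [x Hx]. destruct (near_close g h Hn) as [_ [v [Hv Hu]]].
  destruct (Nat.eq_dec l 0) as [->|Hl0].
  - exists (Ured c h). rewrite (length_zero_iff_nil r0) in *. subst. now rewrite app_nil_r.
  - assert (ht g = length x + l) by (unfold ht; rewrite Hx, length_app; lia).
    destruct (run_suffix (inU c) v x r0) as [x' [E' _]]; [unfold w in *; lia|].
    exists x'. rewrite Hu. transitivity (run (inU c) v (x ++ r0)); [now f_equal | exact E'].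
Qed.

Lemma lev0_le g : d g + w <= L -> lev0 g <= ht g /\ ht g <= lev0 g + 2 * L.
Proof.
  intros Hd. assert (H := blk0_step L w r ltac:(unfold w; lia) ltac:(unfold L; nia) (ht g) (ht g) ltac:(unfold close; lia) Hd).
  unfold lev0. lia.
Qed.

Lemma lev1_le g : w <= d g -> lev1 g <= ht g /\ ht g <= lev1 g + 2 * L.
Proof.
  intros Hd. assert (H := blk1_step L w r ltac:(unfold w; lia) ltac:(unfold L; nia) (ht g) (ht g) ltac:(unfold close; lia) Hd).
  unfold lev1. lia.
Qed.

Lemma in_column g r0 l : vp p g -> length r0 = l -> ht g <= l + 2 * L -> (exists x, Ured c g = x ++ r0) ->
  column c p r0 (2 * L) g.
Proof.
  intros Hv Hl Hh [x Hx]. split; [exact Hv|]. exists x. split; [exact Hx|].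
  unfold ht in Hh. rewrite Hx, length_app in Hh. lia.
Qed.

Lemma stage0_small j : j < M ->
  small E p r V0 (fun g => vp p g /\ d g < (M + 2) * w /\ C0 j g).
Proof.
  intros Hj x y Hch.
  destruct (chain_dom _ _ _ _ _ _ Hch) as [[Hx1 [Hx2 Hx3]] _].
  assert (HdL : forall g, d g < (M + 2) * w -> d g + w <= L) by (intros g; unfold L; nia).
  set (r0 := bottom (lev0 x) (Ured c x)).
  destruct (bottom_split (lev0 x) (Ured c x)) as [x0 [Ex0 [_ Lr0]]]; [apply lev0_le; auto|].
  fold r0 in Ex0, Lr0.
  set (P := fun g => lev0 g = lev0 x /\ exists z, Ured c g = z ++ r0).
  apply (small0 r0 j Hj).
  apply (chain_sub E p (fun g => (vp p g /\ d g < (M + 2) * w /\ C0 j g) /\ P g) _ r); [exact Hrho0| |].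
  - intros z [[Z1 [Z2 Z3]] [Z4 Z5]]. split.
    + apply (in_column z r0 (lev0 x)); auto. rewrite <- Z4. apply lev0_le; auto.
    + destruct Z5 as [z' Hz']. unfold C0 in Z3. rewrite Z4 in Z3.
      replace (bottom (lev0 x) (Ured c z)) with r0 in Z3; [exact Z3|].
      symmetry. transitivity (bottom (lev0 x) (z' ++ r0)); [now f_equal | now apply bottom_app].
  - apply chain_restrict; [split; [reflexivity | now exists x0]| |exact Hch].
    intros g h [G1 G2] [_ [D1 _]] _ Hn.
    destruct (near_close g h Hn) as [Hcl _].
    destruct (blk0_step L w r ltac:(unfold w; lia) ltac:(unfold L; nia) (ht g) (ht h) Hcl (HdL g D1)) as [Eb [Hl _]].
    split.
    + unfold lev0 in *. rewrite Eb. exact G1.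
    + apply (suffix_kept g h (lev0 x)); auto. rewrite <- G1. exact Hl.
Qed.

Lemma glued_small k : k <= M -> small E p r (2 * (V0 + r) + V1) (glued k).
Proof.
  intros Hk x y Hch.
  destruct (chain_dom _ _ _ _ _ _ Hch) as [[Hxv Hx] _].
  assert (Hstep : forall g h, near E p r g h -> d h <= d g + r /\ d g <= d h + r).
  { intros g h Hn. destruct (near_close g h Hn) as [Hcl _].
    assert (HL : w <= L) by (unfold L; nia).
    split; apply (dist0_step L w r); auto; try (unfold w; lia). unfold close in *; lia. }
  destruct Hx as [[Hx _]|[Hx _]].
  - assert (Hk' : k < M) by (destruct (Nat.eq_dec k M); [subst; rewrite Nat.sub_diag in Hx; lia | lia]).
    apply (near_mono E p V0); [lia|]. apply (stage0_small k Hk').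
    apply (chain_sub E p (fun g => glued k g /\ d g < (M - k) * w) _ r); [lia| |].
    + intros z [[Z1 Z2] Z3]. split; [exact Z1|]. split; [nia|].
      destruct Z2 as [[_ Z2]|[Z2 _]]; [exact Z2 | lia].
    + apply chain_restrict; [exact Hx| |exact Hch].
      intros g h G1 _ [_ [[H1 _]|[H1 _]]] Hn; [exact H1|].
      apply Hstep in Hn. unfold w in *. lia.
  - assert (HP : (M - k) * w + w <= d x -> w <= d x) by lia.
    set (r1 := bottom (lev1 x) (Ured c x)).
    destruct (bottom_split (lev1 x) (Ured c x)) as [x0 [Ex0 [_ Lr1]]]; [apply lev1_le; lia|].
    fold r1 in Ex0, Lr1.
    set (P := fun g => ((M - k) * w + w <= d g) /\ lev1 g = lev1 x /\ exists z, Ured c g = z ++ r1).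
    set (Z := fun g => vp p g /\ d g < (M + 2) * w /\ 1 <= k /\ C0 (k - 1) g).
    set (W := fun g => k < M /\ column c p r1 (2 * L) g /\ fam1 r1 k g).
    assert (HZ : small E p r V0 Z).
    { destruct (Nat.eq_dec k 0) as [H0|H0].
      - intros u v Huv. apply chain_dom in Huv as [[_ [_ [H1 _]]] _]. lia.
      - eapply small_sub; [apply Nat.le_refl|apply Nat.le_refl| |apply (stage0_small (k - 1)); lia].
        intros g [G1 [G2 [_ G3]]]; auto. }
    assert (HW : small E p (V0 + 2 * r) V1 W).
    { intros u v Huv. assert (Hk' : k < M) by (apply chain_dom in Huv as [[H1 _] _]; exact H1).
      apply (small1 r1 k Hk'). eapply chain_sub; [exact Hrho1| |exact Huv]. intros g [_ G]; exact G. }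
    apply (small_union E HE p r V0 V1 Z W HZ HW).
    apply (chain_sub E p (fun g => glued k g /\ P g) _ r); [lia| |].
    + intros z [[Z1 Z2] [Z3 [Z4 Z5]]]. destruct Z2 as [[Z2 _]|[_ [[Z6 [Z7 Z8]]|[Z6 [Z7 Z8]]]]]; [lia| |].
      * left; repeat split; auto.
      * right. split; [exact Z7|]. split.
        -- apply (in_column z r1 (lev1 x)); auto. rewrite <- Z4. apply lev1_le; lia.
        -- destruct Z5 as [z' Hz']. unfold C1 in Z8. rewrite Z4 in Z8.
           replace (bottom (lev1 x) (Ured c z)) with r1 in Z8; [exact Z8|].
           symmetry. transitivity (bottom (lev1 x) (z' ++ r1)); [now f_equal | now apply bottom_app].
    + apply chain_restrict; [split; [exact Hx|]; split; [reflexivity | now exists x0]| |exact Hch].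
      intros g h [G1 [G2 G3]] _ Hh Hn.
      destruct (near_close g h Hn) as [Hcl _].
      destruct (blk1_step L w r ltac:(unfold w; lia) ltac:(unfold L; nia) (ht g) (ht h) Hcl ltac:(unfold d in *; lia)) as [Eb [Hl _]].
      split; [|split].
      * destruct Hh as [_ [[H1 _]|[H1 _]]]; [|exact H1]. apply Hstep in Hn. unfold w in *. lia.
      * unfold lev1 in *. rewrite Eb. exact G2.
      * apply (suffix_kept g h (lev1 x)); auto. rewrite <- G2. right; exact Hl.
Qed.

(** Family [j] of stage 0 has colour [j] up to zone [M - j]. From that zone on it takes colour
    [S j], whose own gap, zone [M - S j], ends exactly there. Thus a base tree costs a single
    additional colour. *)
Lemma glued_cover g : vp p g -> exists k, k <= M /\ glued k g.
Proof.
  intros Hv. destruct (Nat.lt_ge_cases (d g) ((M + 1) * w)) as [Hd|Hd].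
  - assert (HdL : d g + w <= L) by (unfold L; nia).
    destruct (cover0 (bottom (lev0 g) (Ured c g)) g) as [j [Hj Cj]].
    { destruct (bottom_split (lev0 g) (Ured c g)) as [x0 [Ex0 [_ Lr0]]]; [now apply lev0_le|].
      apply (in_column g _ (lev0 g)); auto; [now apply lev0_le | now exists x0]. }
    destruct (Nat.lt_ge_cases (d g) ((M - j) * w)) as [Hz|Hz].
    + exists j. split; [lia|]. split; [exact Hv|]. left. split; [exact Hz | exact Cj].
    + exists (S j). split; [lia|]. split; [exact Hv|]. right.
      split; [replace ((M - S j) * w + w) with ((M - j) * w) by (replace (M - j) with (S (M - S j)) by lia; simpl; lia); exact Hz|].
      left. split; [nia|]. split; [lia|]. replace (S j - 1) with j by lia. exact Cj.
  - assert (Hdw : w <= d g) by nia.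
    destruct (cover1 (bottom (lev1 g) (Ured c g)) g) as [j [Hj Cj]].
    { destruct (bottom_split (lev1 g) (Ured c g)) as [x0 [Ex0 [_ Lr0]]]; [now apply lev1_le|].
      apply (in_column g _ (lev1 g)); auto; [now apply lev1_le | now exists x0]. }
    exists j. split; [lia|]. split; [exact Hv|]. right. split; [nia|]. right; auto.
Qed.

Lemma gluing : exists Dom : nat -> word -> Prop,
  (forall g, vp p g -> exists k, k < S M /\ Dom k g) /\
  (forall k, k < S M -> small E p r (2 * (V0 + r) + V1) (Dom k)).
Proof.
  exists glued. split.
  - intros g Hg. destruct (glued_cover g Hg) as [k [Hk G]]. exists k; split; [lia | exact G].
  - intros k Hk. apply glued_small; lia.
Qed.

End Gluing.

(** * A mod 2 cup product on the cubical grid *)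

Definition xsum {T} (l : list T) (F : T -> bool) : bool := fold_right (fun a acc => xorb (F a) acc) false l.

Lemma xsum_cons {T} (a : T) l F : xsum (a :: l) F = xorb (F a) (xsum l F).
Proof. reflexivity. Qed.

Lemma xsum_ext {T} (l : list T) F G : (forall a, In a l -> F a = G a) -> xsum l F = xsum l G.
Proof.
  induction l as [|a l IH]; intros H; [reflexivity|]. simpl.
  rewrite (H a) by now left. f_equal. apply IH; intros; apply H; now right.
Qed.

Lemma xsum_zero {T} (l : list T) F : (forall a, In a l -> F a = false) -> xsum l F = false.
Proof.
  induction l as [|a l IH]; intros H; [reflexivity|]. simpl.
  rewrite (H a), IH; auto; [intros; apply H; now right | now left].
Qed.

Lemma xsum_xor {T} (l : list T) F G : xsum l (fun a => xorb (F a) (G a)) = xorb (xsum l F) (xsum l G).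
Proof.
  induction l as [|a l IH]; [reflexivity|]. simpl. rewrite IH.
  destruct (F a), (G a), (xsum l F), (xsum l G); reflexivity.
Qed.

Lemma xsum_and {T} (l : list T) F b : xsum l (fun a => b && F a) = b && xsum l F.
Proof.
  induction l as [|a l IH]; simpl; [now rewrite andb_false_r|]. rewrite IH.
  destruct b, (F a), (xsum l F); reflexivity.
Qed.

Lemma xsum_exchange {T T'} (l : list T) (l' : list T') F :
  xsum l (fun a => xsum l' (fun b => F a b)) = xsum l' (fun b => xsum l (fun a => F a b)).
Proof.
  induction l as [|a l IH]; simpl; [symmetry; apply xsum_zero; reflexivity|].
  rewrite IH. symmetry. apply (xsum_xor l' (F a)).
Qed.

Lemma xsum_true {T} (l : list T) F : xsum l F = true -> exists a, In a l /\ F a = true.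
Proof.
  intros H. apply NNPP; intros Hn. rewrite xsum_zero in H; [discriminate|].
  intros a Ha. destruct (F a) eqn:E; [|reflexivity]. exfalso; apply Hn; now exists a.
Qed.

Definition rem (m : nat) (l : list nat) : list nat := remove Nat.eq_dec m l.

Lemma rem_notin m l : ~ In m l -> rem m l = l.
Proof. apply notin_remove. Qed.

Lemma in_rem a m l : In a (rem m l) <-> In a l /\ a <> m.
Proof. split; [apply in_remove | intros [H1 H2]; now apply in_in_remove]. Qed.

Lemma rem_comm a b l : rem a (rem b l) = rem b (rem a l).
Proof. apply remove_remove_comm. Qed.

Lemma rem_cons a b l : rem a (b :: l) = if Nat.eq_dec a b then rem a l else b :: rem a l.
Proof. reflexivity. Qed.

Lemma rem_NoDup m l : NoDup l -> NoDup (rem m l).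
Proof.
  induction 1 as [|a l H1 H2 IH]; [constructor|]. rewrite rem_cons.
  destruct (Nat.eq_dec m a); [exact IH|]. constructor; [|exact IH]. rewrite in_rem. tauto.
Qed.

Lemma rem_length m l : NoDup l -> In m l -> S (length (rem m l)) = length l.
Proof.
  induction 1 as [|a l H1 H2 IH]; intros Hin; [destruct Hin|]. rewrite rem_cons.
  destruct (Nat.eq_dec m a) as [->|Hn]; [now rewrite rem_notin|].
  simpl. rewrite IH; [reflexivity|]. destruct Hin; [congruence | assumption].
Qed.

Definition dsum (l : list nat) (F : nat -> nat -> bool) : bool :=
  xsum l (fun m => xsum (rem m l) (fun m' => F m m')).

Lemma dsum_cons a l F : ~ In a l ->
  dsum (a :: l) F = xorb (xorb (xsum l (F a)) (xsum l (fun m => F m a))) (dsum l F).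
Proof.
  intros Ha. unfold dsum at 1. rewrite xsum_cons, rem_cons.
  destruct (Nat.eq_dec a a) as [_|]; [|contradiction].
  rewrite (xsum_ext l (fun m => xsum (rem m (a :: l)) (fun m' => F m m'))
    (fun m => xorb (F m a) (xsum (rem m l) (fun m' => F m m')))).
  - rewrite xsum_xor, rem_notin by exact Ha.
    unfold dsum. now rewrite xorb_assoc.
  - intros m Hm. rewrite rem_cons. destruct (Nat.eq_dec m a) as [->|]; [contradiction|reflexivity].
Qed.

Lemma dsum_swap l F : NoDup l -> dsum l F = dsum l (fun a b => F b a).
Proof.
  induction 1 as [|a l H1 H2 IH]; [reflexivity|]. rewrite !dsum_cons by exact H1. rewrite IH.
  f_equal. apply xorb_comm.
Qed.

Lemma dsum_sym l F : NoDup l -> (forall a b, F a b = F b a) -> dsum l F = false.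
Proof.
  intros HN HF. induction HN as [|a l H1 H2 IH]; [reflexivity|].
  rewrite dsum_cons by exact H1. rewrite IH.
  rewrite (xsum_ext l (fun m => F m a) (F a)) by (intros; apply HF).
  now rewrite xorb_nilpotent.
Qed.

Lemma dsum_xor l F G : dsum l (fun a b => xorb (F a b) (G a b)) = xorb (dsum l F) (dsum l G).
Proof.
  unfold dsum. rewrite <- xsum_xor. apply xsum_ext; intros; apply xsum_xor.
Qed.

Definition point := nat -> nat.
Definition shiftp (x : point) (m t : nat) : point := fun i => if i =? m then x i + t else x i.
Definition bump (x : point) (m : nat) : point := shiftp x m 1.

Lemma shiftp_comm x m t m' t' : shiftp (shiftp x m t) m' t' = shiftp (shiftp x m' t') m t.
Proof. extensionality i. unfold shiftp. destruct (i =? m), (i =? m'); lia. Qed.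

Lemma shiftp_add x m t t' : shiftp (shiftp x m t) m t' = shiftp x m (t + t').
Proof. extensionality i. unfold shiftp. destruct (i =? m); lia. Qed.

Lemma shiftp_0 x m : shiftp x m 0 = x.
Proof. extensionality i. unfold shiftp. destruct (i =? m); lia. Qed.

Lemma shiftp_same x m t : shiftp x m t m = x m + t.
Proof. unfold shiftp. now rewrite Nat.eqb_refl. Qed.

Lemma shiftp_other x m t i : i <> m -> shiftp x m t i = x i.
Proof. unfold shiftp. intros H. destruct (Nat.eqb_spec i m); [contradiction | reflexivity]. Qed.

(* The cup product of the coboundaries of [fs], evaluated on the Kuhn triangulation of the
   unit cube at [x] in the directions [ds]. *)
Fixpoint cup (fs : list (point -> bool)) (ds : list nat) (x : point) : bool :=
  match fs with
  | [] => true
  | f :: fs' => xsum ds (fun m => xorb (f (bump x m)) (f x) && cup fs' (rem m ds) (bump x m))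
  end.

(** A product of coboundaries is a cocycle: the sum runs over the pairs of opposite faces of a cube
    whose dimension is one more than the number of factors. *)
Lemma cup_closed fs : forall ds x, NoDup ds -> length ds = S (length fs) ->
  xsum ds (fun m => xorb (cup fs (rem m ds) (bump x m)) (cup fs (rem m ds) x)) = false.
Proof.
  induction fs as [|f fs IH]; intros ds x HN HL.
  - apply xsum_zero. reflexivity.
  - set (G := fun m m' => cup fs (rem m' (rem m ds)) (bump (bump x m) m')).
    set (H := fun m m' => cup fs (rem m' (rem m ds)) (bump x m)).
    assert (GS : forall a b, G a b = G b a).
    { intros a b. unfold G. rewrite rem_comm. unfold bump. now rewrite shiftp_comm. }
    assert (HI : forall m, In m ds -> xsum (rem m ds) (fun m' => xorb (G m m') (H m m')) = false).
    { intros m Hm. apply (IH (rem m ds) (bump x m)); [now apply rem_NoDup|].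
      assert (Hr := rem_length m ds HN Hm). simpl in HL. lia. }
    (* In the expansion over ordered pairs of directions the first term is symmetric, so it cancels
       modulo 2. The others pair up, after a swap, into instances of the induction hypothesis. *)
    transitivity (dsum ds (fun m m' =>
      xorb (xorb (f (bump (bump x m) m') && G m m') (f (bump x m) && G m m'))
           (xorb (f (bump x m') && H m' m) (f x && H m' m)))).
    { unfold dsum. apply xsum_ext. intros m Hm. cbn [cup]. rewrite <- xsum_xor.
      apply xsum_ext. intros m' Hm'. unfold G, H. rewrite (rem_comm m m').
      destruct (f (bump (bump x m) m')), (f (bump x m)), (f (bump x m')), (f x),
        (cup fs (rem m' (rem m ds)) (bump (bump x m) m')), (cup fs (rem m' (rem m ds)) (bump x m')); reflexivity. }
    rewrite !dsum_xor.
    rewrite (dsum_sym ds (fun m m' => f (bump (bump x m) m') && G m m') HN).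
    2:{ intros a b. rewrite GS. unfold bump. now rewrite shiftp_comm. }
    rewrite (dsum_swap ds (fun m m' => f (bump x m') && H m' m) HN).
    rewrite (dsum_swap ds (fun m m' => f x && H m' m) HN). cbn beta.
    assert (E1 : xorb (dsum ds (fun m m' => f (bump x m) && G m m')) (dsum ds (fun m m' => f (bump x m) && H m m')) = false).
    { rewrite <- dsum_xor. unfold dsum. apply xsum_zero. intros m Hm.
      rewrite (xsum_ext _ _ (fun m' => f (bump x m) && xorb (G m m') (H m m'))).
      - rewrite xsum_and, HI by exact Hm. apply andb_false_r.
      - intros m' _. destruct (f (bump x m)), (G m m'), (H m m'); reflexivity. }
    assert (E2 : dsum ds (fun m m' => f x && H m m') = false).
    { assert (E3 : dsum ds H = false).
      { rewrite <- (dsum_sym ds G HN GS). unfold dsum. apply xsum_ext. intros m Hm.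
        specialize (HI m Hm). rewrite xsum_xor in HI. now apply xorb_eq in HI. }
      unfold dsum. rewrite (xsum_ext _ _ (fun m => f x && xsum (rem m ds) (H m))) by (intros; apply xsum_and).
      rewrite xsum_and. change (f x && dsum ds H = false). rewrite E3. apply andb_false_r. }
    rewrite E2, xorb_false_r, xorb_false_l. exact E1.
Qed.

(** The Leibniz rule: the coboundary of [f] times a cocycle is the coboundary of the product. *)
Lemma cup_telescope f fs ds x : NoDup ds -> length ds = S (length fs) ->
  cup (f :: fs) ds x = xsum ds (fun m =>
    xorb (f (bump x m) && cup fs (rem m ds) (bump x m)) (f x && cup fs (rem m ds) x)).
Proof.
  intros HN HL. assert (Hc := cup_closed fs ds x HN HL).
  assert (Hx : xsum ds (fun m => f x && xorb (cup fs (rem m ds) (bump x m)) (cup fs (rem m ds) x)) = false).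
  { rewrite xsum_and, Hc. apply andb_false_r. }
  cbn [cup]. rewrite <- (xorb_false_r (xsum _ _)), <- Hx, <- xsum_xor.
  apply xsum_ext. intros m _.
  destruct (f (bump x m)), (f x), (cup fs (rem m ds) (bump x m)), (cup fs (rem m ds) x); reflexivity.
Qed.

Fixpoint box (ds : list nat) (N : nat) (G : point -> bool) (x : point) : bool :=
  match ds with
  | [] => G x
  | m :: ds' => xsum (seq 0 N) (fun t => box ds' N G (shiftp x m t))
  end.

Lemma box_ext ds N G G' x : (forall y, (forall i, ~ In i ds -> y i = x i) -> G y = G' y) ->
  box ds N G x = box ds N G' x.
Proof.
  revert x; induction ds as [|m ds IH]; intros x H; cbn [box]; [apply H; reflexivity|].
  apply xsum_ext. intros t _. apply IH. intros y Hy. apply H. intros i Hi.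
  rewrite Hy; [|intros Hi'; apply Hi; now right]. apply shiftp_other. intros ->; apply Hi; now left.
Qed.

Lemma box_shift ds N G x k t : box ds N G (shiftp x k t) = box ds N (fun y => G (shiftp y k t)) x.
Proof.
  revert x; induction ds as [|m ds IH]; intros x; cbn [box]; [reflexivity|].
  apply xsum_ext. intros u _. now rewrite shiftp_comm, IH.
Qed.

Lemma box_xsum {T} (l : list T) ds N G x :
  box ds N (fun y => xsum l (fun k => G k y)) x = xsum l (fun k => box ds N (G k) x).
Proof.
  revert x; induction ds as [|m ds IH]; intros x; cbn [box]; [reflexivity|].
  rewrite xsum_exchange. apply xsum_ext. intros t _. apply IH.
Qed.

Lemma box_zero ds N G x : (forall y, (forall i, ~ In i ds -> y i = x i) -> G y = false) -> box ds N G x = false.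
Proof.
  revert x; induction ds as [|m ds IH]; intros x H; cbn [box]; [apply H; reflexivity|].
  apply xsum_zero. intros t _. apply IH. intros y Hy. apply H. intros i Hi.
  rewrite Hy; [|intros Hi'; apply Hi; now right]. apply shiftp_other. intros ->; apply Hi; now left.
Qed.

(** Discrete Stokes theorem in one direction: interior faces cancel and the two outer faces
    remain. *)
Lemma box_telescope g k ds N x : NoDup ds -> In k ds ->
  box ds N (fun y => xorb (g (bump y k)) (g y)) x =
  box (rem k ds) N (fun y => xorb (g (shiftp y k N)) (g y)) x.
Proof.
  intros HN; revert x; induction HN as [|m ds H1 H2 IH]; intros x Hin; [destruct Hin|].
  rewrite rem_cons. destruct (Nat.eq_dec k m) as [->|Hn].
  - cbn [box]. rewrite rem_notin by exact H1.
    rewrite (xsum_ext _ _ (fun t => box ds N (fun y => xorb (g (bump (shiftp y m t) m)) (g (shiftp y m t))) x))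
      by (intros; apply box_shift).
    rewrite <- box_xsum. apply box_ext. intros y _. clear.
    induction N as [|N IH]; [simpl; rewrite shiftp_0; symmetry; apply xorb_nilpotent|].
    rewrite seq_S. unfold xsum in *. rewrite fold_right_app. simpl fold_right at 2.
    assert (Hf : forall (l : list nat) F b, fold_right (fun a acc => xorb (F a) acc) b l =
       xorb (fold_right (fun a acc => xorb (F a) acc) false l) b).
    { induction l as [|a l IHl]; intros G b; simpl; [now destruct b|]. now rewrite IHl, xorb_assoc. }
    rewrite Hf, IH. unfold bump. rewrite shiftp_add, Nat.add_1_r.
    destruct (g (shiftp y m N)), (g (shiftp y m (S N))), (g y); reflexivity.
  - cbn [box]. apply xsum_ext. intros t _. apply IH. destruct Hin; [congruence | assumption].
Qed.

Section Grid.
Variables (N : nat) (F : nat -> point -> bool).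
Hypothesis F0 : forall i y, y i = 0 -> F i y = false.
Hypothesis FN : forall i y, y i = N -> F i y = true.

Lemma cup_face k ks ds y : In k ks -> ~ In k ds -> (y k = 0 \/ y k = N) -> cup (map F ks) ds y = false.
Proof.
  revert ds y; induction ks as [|a ks IH]; intros ds y Hin Hnin Hy; [destruct Hin|].
  cbn [map cup]. apply xsum_zero. intros m Hm.
  assert (Hkm : k <> m) by (intros ->; contradiction).
  assert (Hb : bump y m k = y k) by now apply shiftp_other.
  destruct (Nat.eq_dec a k) as [->|Hak].
  - replace (F k (bump y m)) with (F k y); [now rewrite xorb_nilpotent|].
    destruct Hy as [Hy|Hy]; [rewrite !F0 | rewrite !FN]; auto; congruence.
  - rewrite IH; [apply andb_false_r| | |rewrite Hb; exact Hy].
    + destruct Hin; [congruence | assumption].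
    + rewrite in_rem; tauto.
Qed.

(** By Stokes the total is a sum over outer faces. On a face orthogonal to [k <> m] the function
    [F k] is constant and its coboundary vanishes; of the two faces orthogonal to [m] only the one
    with [F m = true] counts, and it carries the same statement in one dimension less. *)
Lemma box_cup ds : NoDup ds -> forall x, (forall m, In m ds -> x m = 0) -> box ds N (cup (map F ds) ds) x = true.
Proof.
  induction 1 as [|m ds H1 H2 IH]; intros x Hx; [reflexivity|].
  assert (HN : NoDup (m :: ds)) by now constructor.
  rewrite (box_ext _ _ _ (fun y => xsum (m :: ds) (fun k =>
    xorb (F m (bump y k) && cup (map F ds) (rem k (m :: ds)) (bump y k)) (F m y && cup (map F ds) (rem k (m :: ds)) y)))).
  2:{ intros y _. apply (cup_telescope (F m) (map F ds)); [exact HN | simpl; now rewrite length_map]. }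
  rewrite box_xsum.
  rewrite (xsum_ext _ _ (fun k => box (rem k (m :: ds)) N (fun y =>
     xorb (F m (shiftp y k N) && cup (map F ds) (rem k (m :: ds)) (shiftp y k N)) (F m y && cup (map F ds) (rem k (m :: ds)) y)) x)).
  2:{ intros k Hk. apply (box_telescope (fun y => F m y && cup (map F ds) (rem k (m :: ds)) y)); auto. }
  rewrite xsum_cons, xsum_zero.
  - rewrite xorb_false_r, rem_cons. destruct (Nat.eq_dec m m) as [_|]; [|contradiction].
    rewrite rem_notin by exact H1.
    rewrite (box_ext _ _ _ (fun y => cup (map F ds) ds (shiftp y m N))).
    + rewrite <- box_shift. apply IH. intros k Hk. rewrite shiftp_other by (intros ->; contradiction).
      apply Hx; now right.
    + intros y Hy. assert (Ey : y m = 0) by (rewrite Hy by exact H1; apply Hx; now left).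
      rewrite (F0 m y Ey), (FN m (shiftp y m N)) by (rewrite shiftp_same; lia).
      now rewrite andb_true_l, andb_false_l, xorb_false_r.
  - intros k Hk. apply box_zero. intros y Hy.
    assert (Ey : y k = 0) by (rewrite Hy; [apply Hx; now right | rewrite in_rem; tauto]).
    rewrite !(cup_face k); try exact Hk; try (rewrite in_rem; tauto).
    + now rewrite !andb_false_r.
    + left; exact Ey.
    + right. rewrite shiftp_same. lia.
Qed.

Definition in_cube (ds : list nat) (x u : point) : Prop :=
  forall i, x i <= u i <= S (x i) /\ (~ In i ds -> u i = x i).

Lemma cup_edge fs : forall ds x, cup fs ds x = true -> forall f, In f fs ->
  exists u v, in_cube ds x u /\ in_cube ds x v /\ f u <> f v.
Proof.
  induction fs as [|g fs IH]; intros ds x H f Hf; [destruct Hf|].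
  cbn [cup] in H. apply xsum_true in H as [m [Hm H]]. apply andb_prop in H as [H1 H2].
  assert (Hc : forall u, in_cube (rem m ds) (bump x m) u -> in_cube ds x u).
  { intros u Hu i. destruct (Hu i) as [Hu1 Hu2]. unfold bump in *.
    destruct (Nat.eq_dec i m) as [->|Hn].
    - rewrite shiftp_same in *. rewrite Hu2; [split; [lia | contradiction]|]. rewrite in_rem; tauto.
    - rewrite shiftp_other in * by exact Hn. split; [lia|]. intros Hi. apply Hu2. rewrite in_rem; tauto. }
  destruct Hf as [<-|Hf].
  - exists (bump x m), x. split; [|split].
    + apply Hc. intros i. split; [lia | reflexivity].
    + intros i. split; [lia | reflexivity].
    + intros E. rewrite E, xorb_nilpotent in H1. discriminate.
  - destruct (IH _ _ H2 f Hf) as [u [v [Hu [Hv Huv]]]]. exists u, v. auto.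
Qed.

Lemma box_true ds G x : box ds N G x = true ->
  exists y, G y = true /\ forall i, (y i = x i \/ (In i ds)) /\ (y i < x i + N \/ y i = x i \/ ~ NoDup ds).
Proof.
  revert x; induction ds as [|m ds IH]; intros x H; cbn [box] in H.
  - exists x; split; [exact H|]. intros i; auto.
  - apply xsum_true in H as [t [Ht H]]. apply in_seq in Ht. apply IH in H as [y [Gy Hy]].
    exists y. split; [exact Gy|]. intros i. destruct (Hy i) as [[H1|H1] H2].
    + destruct (Nat.eq_dec i m) as [->|Hn].
      * rewrite shiftp_same in *. split; [right; now left|]. left; lia.
      * rewrite shiftp_other in * by exact Hn. auto.
    + split; [right; now right|].
      destruct (Nat.eq_dec i m) as [->|Hn].
      * right; right. intros HN; apply NoDup_cons_iff in HN; tauto.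
      * rewrite shiftp_other in * by exact Hn. destruct H2 as [H2|[H2|H2]]; auto.
        right; right. intros HN; apply NoDup_cons_iff in HN; tauto.
Qed.

(** The total of the products over all cubes is odd, so the product is nonzero on some cube, and
    each of its factors must change there. This is a discrete Poincare-Miranda theorem. *)
Lemma grid_cube n : 0 < N -> exists x, (forall i, i < n -> x i < N) /\ (forall i, n <= i -> x i = 0) /\
  forall i, i < n -> exists u v, in_cube (seq 0 n) x u /\ in_cube (seq 0 n) x v /\ F i u <> F i v.
Proof.
  intros HN0. assert (HN := seq_NoDup n 0).
  assert (Hb := box_cup (seq 0 n) HN (fun _ => 0) (fun _ _ => eq_refl)).
  apply box_true in Hb as [x [Hx Hr]]. exists x. split; [|split].
  - intros i Hi. destruct (Hr i) as [_ [H|[H|H]]]; [lia | lia | contradiction].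
  - intros i Hi. destruct (Hr i) as [[H|H] _]; [exact H | apply in_seq in H; lia].
  - intros i Hi. apply (cup_edge _ _ _ Hx). apply in_map. apply in_seq; lia.
Qed.

End Grid.

(** * Lower bounds from grids *)

Lemma bounded_enum {T} (P : T -> Prop) n :
  (forall l, NoDup l -> (forall a, In a l -> P a) -> length l <= n) ->
  exists l, NoDup l /\ forall a, In a l <-> P a.
Proof.
  intros H. apply NNPP; intros Hn.
  assert (Hl : forall m, exists l, NoDup l /\ (forall a, In a l -> P a) /\ length l = m).
  { induction m as [|m [l [H1 [H2 H3]]]]; [exists []; repeat split; auto; [constructor | intros a []]|].
    assert (Ha : exists a, P a /\ ~ In a l).
    { apply NNPP; intros Hna. apply Hn. exists l. split; [exact H1|]. intros a; split; [apply H2|].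
      intros Pa; apply NNPP; intros Hin; apply Hna; now exists a. }
    destruct Ha as [a [Pa Hin]]. exists (a :: l). split; [now constructor|]. split; [|simpl; lia].
    intros b [<-|Hb]; auto. }
  destruct (Hl (S n)) as [l [H1 [H2 H3]]]. specialize (H l H1 H2). lia.
Qed.

Section LowerBound.
Variables (X : Type) (dle : X -> X -> R -> Prop).
Hypothesis dle_sym : forall x y t, dle x y t -> dle y x t.
Hypothesis dle_refl : forall x t, (0 <= t)%R -> dle x x t.
Hypothesis dle_trans : forall x y z s t, dle x y s -> dle y z t -> dle x z (s + t)%R.
Hypothesis dle_mono : forall x y s t, (s <= t)%R -> dle x y s -> dle x y t.

Variables (n L : nat) (delta D : R) (phi : point -> X) (F : (X -> Prop) -> Prop).
Hypothesis Hdelta : (0 < delta)%R.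
Hypothesis HL : 0 < L.
Hypothesis Hstep : forall x u, (forall i, x i <= u i <= S (x i)) -> (forall i, n <= i -> u i = x i) ->
  dle (phi x) (phi u) delta.
Hypothesis Hopp : forall i x y, i < n -> x i = 0 -> y i = L -> (forall j, x j <= L /\ y j <= L) ->
  (forall j, n <= j -> x j = 0 /\ y j = 0) -> ~ dle (phi x) (phi y) (D + 4 * INR n * delta).
Hypothesis Hcover : is_cover X F.
Hypothesis Hdiam : diam_le X dle F D.
Hypothesis Hmult : forall x Us, NoDup Us -> (forall U, In U Us -> F U /\ ball_meets X dle x (2 * INR n * delta) U) ->
  length Us <= n.

Let clip (y : point) : point := fun i => if i <? n then min (y i) L else 0.
Let Q (t : nat) (y : point) (U : X -> Prop) : Prop :=
  F U /\ ball_meets X dle (phi (clip y)) (INR t * delta) U.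

Lemma Q_mono t t' y U : t <= t' -> Q t y U -> Q t' y U.
Proof.
  intros Ht [H1 [u [H2 H3]]]. split; [exact H1|]. exists u; split; [|exact H3].
  apply (dle_mono _ _ (INR t * delta)); [|exact H2]. apply Rmult_le_compat_r; [lra | now apply le_INR].
Qed.

Lemma Q_enum t y : t <= 2 * n -> exists l, NoDup l /\ (forall U, In U l <-> Q t y U) /\ 1 <= length l <= n.
Proof.
  intros Ht.
  assert (Hb : forall l, NoDup l -> (forall U, In U l -> Q t y U) -> length l <= n).
  { intros l H1 H2. apply (Hmult (phi (clip y))); [exact H1|]. intros U HU.
    destruct (Q_mono t (2 * n) y U Ht (H2 U HU)) as [H3 H4]. split; [exact H3|].
    rewrite mult_INR in H4. exact H4. }
  destruct (bounded_enum (Q t y) n Hb) as [l [H1 H2]]. exists l. split; [exact H1|]. split; [exact H2|].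
  split; [|apply Hb; [exact H1 | intros U; apply H2]].
  destruct (Hcover (phi (clip y))) as [U [HU1 HU2]].
  assert (HU : In U l).
  { apply H2. split; [exact HU1|]. exists (phi (clip y)). split; [|exact HU2].
    apply dle_refl. apply Rmult_le_pos; [apply pos_INR | lra]. }
  destruct l; [destruct HU | simpl; lia].
Qed.

(** The number of members met by the ball of radius [2 * t * delta] lies between 1 and [n] and is
    monotone in [t], so it cannot increase at each of [n] steps. *)
Lemma Q_stable x : exists t l, t < n /\ NoDup l /\ 1 <= length l <= n /\
  (forall U, In U l <-> Q (2 * t) x U) /\ (forall U, In U l <-> Q (2 * t + 2) x U).
Proof.
  assert (H : forall m, m <= n -> (exists t l, t < n /\ NoDup l /\ 1 <= length l <= n /\
     (forall U, In U l <-> Q (2 * t) x U) /\ (forall U, In U l <-> Q (2 * t + 2) x U)) \/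
     exists l, NoDup l /\ (forall U, In U l <-> Q (2 * m) x U) /\ m + 1 <= length l <= n).
  { induction m as [|m IH]; intros Hm.
    - right. destruct (Q_enum (2 * 0) x) as [l H]; [lia|]. now exists l.
    - destruct IH as [IH|[l [H1 [H2 H3]]]]; [lia | now left|].
      destruct (Q_enum (2 * S m) x) as [l' [H1' [H2' H3']]]; [lia|].
      assert (Hi : incl l l').
      { intros U HU. apply H2'. apply (Q_mono (2 * m)); [lia|]. now apply H2. }
      destruct (Nat.lt_ge_cases (length l) (length l')) as [Hlt|Hge].
      + right. exists l'. split; [exact H1'|]. split; [exact H2' | lia].
      + left. exists m, l. split; [lia|]. split; [exact H1|]. split; [lia|]. split; [exact H2|].
        intros U. replace (2 * m + 2) with (2 * S m) by lia. rewrite <- H2'. split; [apply Hi|].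
        apply (NoDup_length_incl H1 Hge Hi). }
  destruct (H n (Nat.le_refl n)) as [H1|[l [_ [_ H1]]]]; [exact H1 | lia].
Qed.

(* Points whose nearby members of the cover agree at suitable levels, and number [c]. *)
Let rel (c : nat) (y z : point) : Prop := exists t t' l, t < n /\ t' < n /\ NoDup l /\ length l = c /\
  (forall U, In U l <-> Q (2 * t + 1) y U) /\ (forall U, In U l <-> Q (2 * t' + 1) z U).

(** Direction [i] is served by the points that see exactly [S i] members, like the vertices of one
    type in the barycentric subdivision of a nerve. The branch for [n <= i] makes the boundary
    conditions hold for all indices. *)
Let G (i : nat) (y : point) : bool :=
  if i <? n then
    if excluded_middle_informative (clip y i = L \/ exists z, clip z i = L /\ rel (S i) y z) then true else false
  else negb (y i =? 0).

Lemma clip_bound y : (forall j, clip y j <= L) /\ (forall j, n <= j -> clip y j = 0).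
Proof.
  split; intros j; unfold clip; destruct (Nat.ltb_spec j n); lia.
Qed.

(** Related points have a common nearby member of the cover, so their distance is at most [D] plus
    two radii, each at most [2 * n * delta]. *)
Lemma rel_far i y z : i < n -> clip y i = 0 -> clip z i = L -> ~ rel (S i) y z.
Proof.
  intros Hi Hy Hz [t [t' [l [Ht [Ht' [H1 [H2 [H3 H4]]]]]]]].
  destruct l as [|U l]; [discriminate|].
  destruct (proj1 (H3 U) (or_introl eq_refl)) as [HF [u [Hu1 Hu2]]].
  destruct (proj1 (H4 U) (or_introl eq_refl)) as [_ [v [Hv1 Hv2]]].
  destruct (clip_bound y) as [B1 B2], (clip_bound z) as [B3 B4].
  apply (Hopp i (clip y) (clip z)); auto.
  apply (dle_mono _ _ ((INR (2 * t + 1) * delta + D) + INR (2 * t' + 1) * delta)%R).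
  - assert (INR (2 * t + 1) <= 2 * INR n)%R.
    { replace 2%R with (INR 2) by reflexivity. rewrite <- mult_INR. apply le_INR. lia. }
    assert (INR (2 * t' + 1) <= 2 * INR n)%R.
    { replace 2%R with (INR 2) by reflexivity. rewrite <- mult_INR. apply le_INR. lia. }
    nra.
  - eapply dle_trans; [eapply dle_trans; [exact Hu1|]|apply dle_sym; exact Hv1].
    now apply (Hdiam U HF).
Qed.

(** On the cube where every [G i] changes, a stable radius exists at the corner. All its vertices
    see the same set of members at the odd level in between, so the function indexed by the size of
    that set is constant on the cube. *)
Lemma no_cover_of_grid : False.
Proof.
  assert (G0 : forall i y, y i = 0 -> G i y = false).
  { intros i y Hy. unfold G. destruct (Nat.ltb_spec i n) as [Hi|Hi]; [|now rewrite Hy].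
    assert (Hc : clip y i = 0) by (unfold clip; destruct (Nat.ltb_spec i n); lia).
    destruct excluded_middle_informative as [[H|[z [Hz Hr]]]|]; [lia| |reflexivity].
    exfalso. exact (rel_far i y z Hi Hc Hz Hr). }
  assert (GN : forall i y, y i = L -> G i y = true).
  { intros i y Hy. unfold G. destruct (Nat.ltb_spec i n) as [Hi|Hi].
    - destruct excluded_middle_informative as [_|H]; [reflexivity|]. exfalso; apply H; left.
      unfold clip. destruct (Nat.ltb_spec i n); lia.
    - destruct (Nat.eqb_spec (y i) 0); [lia | reflexivity]. }
  destruct (grid_cube L G G0 GN n HL) as [x [Hx1 [Hx2 Hx3]]].
  destruct (Q_stable x) as [t [l [Ht [HN [Hl [Q1 Q2]]]]]].
  set (i := length l - 1). assert (Hi : i < n) by (unfold i; lia).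
  assert (Hin : forall u, in_cube (seq 0 n) x u ->
     clip u = u /\ clip x = x /\ forall U, In U l <-> Q (2 * t + 1) u U).
  { intros u Hu.
    assert (Eu : clip u = u).
    { extensionality j. unfold clip. destruct (Hu j) as [Hu1 Hu2].
      destruct (Nat.ltb_spec j n) as [Hj|Hj]; [specialize (Hx1 j Hj); lia|].
      rewrite Hu2; [now rewrite Hx2 | rewrite in_seq; lia]. }
    assert (Ex : clip x = x).
    { extensionality j. unfold clip. destruct (Nat.ltb_spec j n) as [Hj|Hj]; [specialize (Hx1 j Hj); lia|].
      now rewrite Hx2. }
    split; [exact Eu|]. split; [exact Ex|].
    assert (Hd : dle (phi x) (phi u) delta).
    { apply Hstep; [intros j; apply Hu|]. intros j Hj. apply Hu. rewrite in_seq. lia. }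
    intros U; split; intros HU.
    - apply Q1 in HU as [HF [v [Hv1 Hv2]]]. split; [exact HF|]. exists v. split; [|exact Hv2].
      rewrite Ex in Hv1. rewrite Eu.
      replace (INR (2 * t + 1) * delta)%R with (delta + INR (2 * t) * delta)%R by (rewrite plus_INR; simpl; lra).
      eapply dle_trans; [apply dle_sym; exact Hd | exact Hv1].
    - apply Q2. destruct HU as [HF [v [Hv1 Hv2]]]. split; [exact HF|]. exists v. split; [|exact Hv2].
      rewrite Ex. rewrite Eu in Hv1.
      replace (INR (2 * t + 2) * delta)%R with (delta + INR (2 * t + 1) * delta)%R
        by (rewrite !plus_INR; simpl; lra).
      eapply dle_trans; [exact Hd | exact Hv1]. }
  assert (Hsym : forall u v, in_cube (seq 0 n) x u -> in_cube (seq 0 n) x v -> G i u = true -> G i v = true).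
  { intros u v Hu Hv. unfold G. destruct (Nat.ltb_spec i n); [|lia].
    destruct (Hin u Hu) as [_ [_ Qu]]. destruct (Hin v Hv) as [_ [_ Qv]].
    destruct (excluded_middle_informative (clip u i = L \/ _)) as [Hc|]; [intros _|discriminate].
    destruct excluded_middle_informative as [|Hno]; [reflexivity|]. exfalso; apply Hno; right.
    destruct Hc as [Hc|[z [Hz [t1 [t' [l1 [T1 [T2 [T3 [T4 [T5 T6]]]]]]]]]]].
    - exists u. split; [exact Hc|]. exists t, t, l.
      split; [exact Ht|]. split; [exact Ht|]. split; [exact HN|]. split; [unfold i; lia|]. split; [exact Qv | exact Qu].
    - exists z. split; [exact Hz|]. exists t, t', l. split; [exact Ht|]. split; [exact T2|]. split; [exact HN|].
      split; [unfold i; lia|]. split; [exact Qv|]. intros U. rewrite <- T6.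
      assert (Hll : length l1 = length l) by (unfold i in T4; lia).
      (* Both sets belong to the vertex [u] and differ only in the radius, so they are nested;
         having the same size they coincide. *)
      destruct (Nat.le_ge_cases t t1) as [Hc|Hc].
      + assert (Hi1 : incl l l1).
        { intros U' HU'. apply T5. apply (Q_mono (2 * t + 1)); [lia|]. now apply Qu. }
        split; [apply Hi1 | apply (NoDup_length_incl HN); [lia | exact Hi1]].
      + assert (Hi1 : incl l1 l).
        { intros U' HU'. apply Qu. apply (Q_mono (2 * t1 + 1)); [lia|]. now apply T5. }
        split; [apply (NoDup_length_incl T3); [lia | exact Hi1] | apply Hi1]. }
  destruct (Hx3 i Hi) as [u [v [Hu [Hv Huv]]]]. apply Huv.
  destruct (G i u) eqn:Gu, (G i v) eqn:Gv; auto.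
  - now rewrite (Hsym u v Hu Hv Gu) in Gv.
  - now rewrite (Hsym v u Hv Hu Gv) in Gu.
Qed.

End LowerBound.

(** * Word metrics given by a model *)

Section Model.
Variables (Eq : word -> word -> Prop) (X : Type) (dle : X -> X -> R -> Prop) (p : nat) (rp : X -> word).
Hypothesis HE : word_congruence Eq.
Hypothesis HM : word_model Eq X dle p rp.

Lemma model_refl x t : (0 <= t)%R -> dle x x t.
Proof.
  intros Ht. apply HM. exists []. rewrite app_nil_r. split; [apply vp_nil|]. split; [exact Ht | apply (wc_refl _ HE)].
Qed.

Lemma model_sym x y t : dle x y t -> dle y x t.
Proof.
  intros H. apply HM in H as [w [H1 [H2 H3]]]. apply HM. exists (winv w). split; [now apply vp_winv|].
  rewrite winv_length. split; [exact H2|]. apply (E_move _ HE) in H3.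
  apply (E_move _ HE).
  apply (wc_trans _ HE) with (winv (winv (rp x) ++ rp y)); [now apply (E_winv _ HE)|].
  rewrite winv_app, winvK. apply (wc_refl _ HE).
Qed.

Lemma model_trans x y z s t : dle x y s -> dle y z t -> dle x z (s + t)%R.
Proof.
  intros H H'. apply HM in H as [w [H1 [H2 H3]]]. apply HM in H' as [w' [H1' [H2' H3']]].
  apply HM. exists (w ++ w'). split; [now apply vp_app|]. split; [rewrite length_app, plus_INR; lra|].
  rewrite app_assoc. apply (wc_trans _ HE) with (rp y ++ w'); [|exact H3'].
  apply (wc_app _ HE); [exact H3 | apply (wc_refl _ HE)].
Qed.

Lemma model_mono x y s t : (s <= t)%R -> dle x y s -> dle x y t.
Proof.
  intros Hst H. apply HM in H as [w [H1 [H2 H3]]]. apply HM. exists w. split; [exact H1|]. split; [lra | exact H3].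
Qed.

Lemma mult_le_mono F r r' n : (r <= r')%R -> mult_le X dle F r' n -> mult_le X dle F r n.
Proof.
  intros Hr H x Us HU HF. apply (H x); [exact HU|]. intros U HIn. destruct (HF U HIn) as [H1 [y [H2 H3]]].
  split; [exact H1|]. exists y. split; [now apply (model_mono _ _ r) | exact H3].
Qed.

Lemma asdimAN_asdim n : asdimAN_le dle n -> asdim_le dle n.
Proof.
  intros [C [r0 [HC [Hr0 H]]]] r Hr. destruct (H (Rmax r r0) (Rmax_r r r0)) as [F [H1 [H2 H3]]].
  exists F. split; [exact H1|]. split; [now exists (C * Rmax r r0)%R|].
  apply (mult_le_mono F r (Rmax r r0)); [apply Rmax_l | exact H3].
Qed.

End Model.

Section FreePowers.
Variable Eq : word -> word -> Prop.
Hypothesis HE : word_congruence Eq.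

Lemma lp_succ i k : Eq (lp i (k + 1)) (lp i k ++ lp i 1).
Proof.
  destruct (Z_le_gt_dec 0 k) as [Hk|Hk].
  - replace (lp i k ++ lp i 1) with (lp i (k + 1)); [apply (wc_refl _ HE)|].
    unfold lp. destruct (Z.ltb_spec (k + 1) 0), (Z.ltb_spec k 0); try lia.
    replace (Z.abs_nat (k + 1)) with (Z.abs_nat k + 1) by lia. apply repeat_app.
  - apply (wc_sym _ HE).
    replace (lp i k) with (lp i (k + 1) ++ lp i (- (1))).
    + rewrite <- app_assoc. rewrite <- (app_nil_r (lp i (k + 1))) at 2.
      apply (wc_app _ HE); [apply (wc_refl _ HE)|]. rewrite <- winv_lp. apply (E_winv_l _ HE).
    + unfold lp. destruct (Z.ltb_spec (k + 1) 0) as [H1|H1], (Z.ltb_spec k 0) as [H2|H2]; try lia.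
      * replace (Z.abs_nat k) with (Z.abs_nat (k + 1) + 1) by lia. symmetry; apply repeat_app.
      * replace k with (-1)%Z by lia. reflexivity.
Qed.

(** For exponents of opposite signs the two sides differ as words and agree only after
    cancellation. *)
Lemma lp_add i k k' : Eq (lp i (k + k')) (lp i k ++ lp i k').
Proof.
  revert k. induction k' as [|k' IH|k' IH] using Z.peano_ind; intros k.
  - rewrite Z.add_0_r. change (lp i 0) with (@nil letter). rewrite app_nil_r. apply (wc_refl _ HE).
  - replace (k + Z.succ k')%Z with (k + k' + 1)%Z by lia.
    apply (wc_trans _ HE) with (lp i (k + k') ++ lp i 1); [apply lp_succ|].
    apply (wc_trans _ HE) with ((lp i k ++ lp i k') ++ lp i 1).
    + apply (wc_app _ HE); [apply IH | apply (wc_refl _ HE)].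
    + rewrite <- app_assoc. apply (wc_app _ HE); [apply (wc_refl _ HE)|].
      unfold Z.succ. apply (wc_sym _ HE), lp_succ.
  - assert (H : Eq (lp i k') (lp i (Z.pred k') ++ lp i 1)).
    { replace k' with (Z.pred k' + 1)%Z at 1 by lia. apply lp_succ. }
    assert (H2 : Eq (lp i (k + k')) (lp i (k + Z.pred k') ++ lp i 1)).
    { replace (k + k')%Z with (k + Z.pred k' + 1)%Z by lia. apply lp_succ. }
    assert (Hc : forall u v x, Eq (u ++ x) (v ++ x) -> Eq u v).
    { intros u v x Hx. assert (Hu : forall y, Eq ((y ++ x) ++ winv x) y).
      { intros y. rewrite <- app_assoc. rewrite <- (app_nil_r y) at 2.
        apply (wc_app _ HE); [apply (wc_refl _ HE) | apply (E_winv_r _ HE)]. }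
      apply (wc_trans _ HE) with ((u ++ x) ++ winv x); [apply (wc_sym _ HE), Hu|].
      apply (wc_trans _ HE) with ((v ++ x) ++ winv x); [|apply Hu].
      apply (wc_app _ HE); [exact Hx | apply (wc_refl _ HE)]. }
    apply (Hc _ _ (lp i 1)). apply (wc_trans _ HE) with (lp i (k + k')); [apply (wc_sym _ HE), H2|].
    apply (wc_trans _ HE) with (lp i k ++ lp i k'); [apply IH|]. rewrite <- app_assoc.
    apply (wc_app _ HE); [apply (wc_refl _ HE) | exact H].
Qed.

End FreePowers.

(** * Flats and the grids inside them *)

Section Flat.
Variables (c p : nat) (N B : nat -> nat -> Z).
Hypothesis HN : forall s i, s <= i -> N s i = 1%Z.
Hypothesis Hp : 3 + c <= p.
Let E := weq c N B.
Let HE := weq_congruence c N B.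

(* Words that represent a product of powers of a, b, the letters of the free abelian factor
   and central elements. *)
Record flat (ka kb : Z) (e : nat -> Z) (kap : nat -> nat -> Z) (w : word) : Prop := {
  flat_U : Ured c w = Ured c (lp 0 ka);
  flat_V : Vred c w = Vred c (lp 1 kb);
  flat_e : forall i, 3 <= i < 3 + c -> expo i w = e i;
  flat_Z : forall s i, i < s -> (N s i | cent c (fsi B s i) w - kap s i)%Z
}.

Lemma asum_lp phi k : asum c phi (lp 0 k) = (k * phi 0)%Z.
Proof. unfold asum, lp. rewrite lsum_repeat by reflexivity. unfold mlet; cbn [fst snd Nat.eqb]. now rewrite sg_lp. Qed.

Lemma bsum_lp f q k : bsum c f q (lp 1 k) = (k * f q)%Z.
Proof.
  unfold bsum, lp. rewrite lsum_repeat by reflexivity. unfold mlet; cbn [fst snd Nat.eqb]. rewrite sg_lp.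
  now rewrite Z.sub_0_r.
Qed.

(** All letters a and b count at position 0, where [fsi] vanishes because slots are positive. The
    cocycle is therefore zero and coordinates add. *)
Lemma flat_app ka kb e kap ka' kb' e' kap' w w' : flat ka kb e kap w -> flat ka' kb' e' kap' w' ->
  flat (ka + ka') (kb + kb') (fun i => e i + e' i)%Z (fun s i => kap s i + kap' s i)%Z (w ++ w').
Proof.
  intros [H1 H2 H3 H4] [H1' H2' H3' H4']. split.
  - pose proof (run_congruence (inU c) (inU_inv c)) as HC. unfold Ured in *.
    rewrite (lp_add _ HC 0 ka ka'). now apply run_cong.
  - pose proof (run_congruence (inV c) (inV_inv c)) as HC. unfold Vred in *.
    rewrite (lp_add _ HC 1 kb kb'). now apply run_cong.
  - intros i Hi. rewrite expo_app, H3, H3' by exact Hi. reflexivity.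
  - intros s i Hi. rewrite cent_app.
    replace (asum c (fun q => bsum c (fsi B s i) (q + pos c w') w')%Z w) with 0%Z.
    + destruct (H4 s i Hi) as [y Hy], (H4' s i Hi) as [y' Hy']. exists (y + y')%Z. lia.
    + rewrite asum_U, H1, <- asum_U, asum_lp, bsum_V, H2', <- bsum_V, bsum_lp, pos_V, H2', <- pos_V, pos_lp.
      cbn [Nat.eqb Nat.add]. rewrite (fsi_vanish B s i); [lia|]. assert (H := slot_gt s i). lia.
Qed.

Lemma flat_E ka kb e kap w w' : flat ka kb e kap w -> E w w' -> flat ka kb e kap w'.
Proof.
  intros [H1 H2 H3 H4] [W1 W2 W3 W4]. split.
  - congruence.
  - congruence.
  - intros i Hi. rewrite <- W3; auto.
  - intros s i Hi. destruct (H4 s i Hi) as [y Hy], (W4 s i) as [y' Hy']. exists (y - y')%Z. lia.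
Qed.

Lemma flat_unique ka kb e kap w w' : flat ka kb e kap w -> flat ka kb e kap w' -> E w w'.
Proof.
  intros [H1 H2 H3 H4] [H1' H2' H3' H4']. split; try congruence.
  - intros i Hi. rewrite H3, H3'; auto.
  - intros s i. destruct (le_lt_dec s i) as [Hi|Hi]; [rewrite HN by exact Hi; apply Z.divide_1_l|].
    destruct (H4 s i Hi) as [y Hy], (H4' s i Hi) as [y' Hy']. exists (y - y')%Z. lia.
Qed.

Lemma single_any s i k : i < s -> single c p N B s i k (2 + 2 * Z.abs_nat k + 4 * (slot s i)).
Proof.
  intros Hi. destruct (zcomm c p (slot s i) 1 k ltac:(lia)) as [w [H1 [H2 H3]]].
  exists w. split; [exact H1|]. split; [|lia].
  intros s' i' Hi'. rewrite H2. rewrite <- (Z.add_0_r (4 * Z.of_nat (slot s i))).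
  rewrite fsi_eval by lia. unfold delta. exists 0%Z.
  destruct ((s' =? s) && (i' =? i)); [rewrite Z.pow_0_r|]; lia.
Qed.

Lemma flat_exists (Lc : list (nat * nat)) ka kb e kap Kz K : NoDup Lc ->
  (forall i, 3 <= i < 3 + c -> (Z.abs (e i) <= Z.of_nat K)%Z) ->
  (forall s i, In (s, i) Lc -> i < s /\ 2 + 2 * Z.abs_nat (kap s i) + 4 * (slot s i) <= Kz) ->
  exists w, vp p w /\ flat ka kb e (restr Lc kap) w /\
    length w <= Z.abs_nat ka + Z.abs_nat kb + c * K + length Lc * Kz.
Proof.
  intros HL He HK.
  destruct (cword_list c p N B kap (fun _ => Kz) Lc HL) as [w [C1 [C2 C3]]].
  { intros s i Hin. destruct (HK s i Hin) as [Hi Hle].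
    destruct (single_any s i (kap s i) Hi) as [w [W1 [W2 W3]]]. exists w. repeat split; try apply W1; auto. lia. }
  exists ((lp 0 ka ++ lp 1 kb) ++ extraword c e ++ w). split; [|split].
  - rewrite !vp_app. repeat split; try apply vp_lp; try lia; [|apply C1].
    intros l Hl; apply extraword_in in Hl; lia.
  - destruct (extraword_UV c e) as [EU EV].
    assert (F1 : flat ka 0 (fun _ => 0%Z) (fun _ _ => 0%Z) (lp 0 ka)).
    { split; [reflexivity| | |].
      - apply run_id. intros l Hl; apply lp_in in Hl. unfold inV; rewrite Hl. reflexivity.
      - intros i Hi. rewrite expo_lp. destruct (Nat.eqb_spec 0 i); lia.
      - intros s i _. rewrite cent_bfree by (intros l Hl; apply lp_in in Hl; lia). apply Z.divide_0_r. }
    assert (F2 : flat 0 kb (fun _ => 0%Z) (fun _ _ => 0%Z) (lp 1 kb)).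
    { split; [|reflexivity| |].
      - apply run_id. intros l Hl; apply lp_in in Hl. unfold inU; rewrite Hl. reflexivity.
      - intros i Hi. rewrite expo_lp. destruct (Nat.eqb_spec 1 i); lia.
      - intros s i _. rewrite cent_afree by (intros l Hl; apply lp_in in Hl; lia). apply Z.divide_0_r. }
    assert (F3 : flat 0 0 e (fun _ _ => 0%Z) (extraword c e)).
    { split; auto.
      - intros i Hi. now apply extraword_expo.
      - intros s i _. rewrite cent_bfree by (intros l Hl; apply extraword_in in Hl; lia). apply Z.divide_0_r. }
    assert (F4 : flat 0 0 (fun _ => 0%Z) (restr Lc kap) w).
    { split; [apply (cw_U _ _ _ C1) | apply (cw_V _ _ _ C1) | intros; apply (cw_e _ _ _ C1) | exact C2]. }
    assert (FF := flat_app _ _ _ _ _ _ _ _ _ _ (flat_app _ _ _ _ _ _ _ _ _ _ F1 F2) (flat_app _ _ _ _ _ _ _ _ _ _ F3 F4)).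
    destruct FF as [G1 G2 G3 G4]. split.
    + now replace ka with (ka + 0 + (0 + 0))%Z at 2 by lia.
    + now replace kb with (0 + kb + (0 + 0))%Z at 2 by lia.
    + intros i Hi. rewrite G3 by exact Hi. lia.
    + intros s i Hi. destruct (G4 s i Hi) as [y Hy]. exists y. rewrite <- Hy. lia.
  - rewrite !length_app, !lp_length.
    assert (H1 := extraword_length c e K He).
    assert (H2 : list_sum (map (fun _ : nat * nat => Kz) Lc) <= length Lc * Kz) by (apply list_sum_bound; auto). lia.
Qed.

(** With constant weight 1, [asum] and [bsum] are exponent sums, so these coordinates are linear in
    the length; the central ones are quadratic. *)
Lemma flat_bounds ka kb e kap w : vp p w -> flat ka kb e kap w ->
  (Z.abs ka <= Z.of_nat (length w))%Z /\ (Z.abs kb <= Z.of_nat (length w))%Z /\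
  (forall i, 3 <= i < 3 + c -> (Z.abs (e i) <= Z.of_nat (length w))%Z) /\
  (forall s i, i < s -> fbounded c p (fsi B s i) -> exists y,
     (Z.abs (kap s i - N s i * y) <= Z.of_nat (length w) * Z.of_nat (length w))%Z).
Proof.
  intros Hw [H1 H2 H3 H4].
  assert (Hl : forall m i, (Z.abs (lsum m (mlet i) (fun _ => 1%Z) w) <= Z.of_nat (length w))%Z).
  { intros m i. rewrite <- (Z.mul_1_l (Z.of_nat (length w))).
    apply (lsum_bound m) with (P := fun _ => True); auto; try lia. apply mlet_abs. }
  split; [|split; [|split]].
  - assert (H := Hl (shift c) 0). change (lsum (shift c) (mlet 0) (fun _ => 1%Z) w) with (asum c (fun _ => 1%Z) w) in H.
    rewrite asum_U, H1, <- asum_U, asum_lp in H. lia.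
  - assert (H := Hl (shift c) 1). change (lsum (shift c) (mlet 1) (fun _ => 1%Z) w) with (bsum c (fun _ => 1%Z) 0 w) in H.
    rewrite bsum_V, H2, <- bsum_V, bsum_lp in H. lia.
  - intros i Hi. rewrite <- H3 by exact Hi. apply Hl.
  - intros s i Hi Hf. destruct (H4 s i Hi) as [y Hy]. exists (- y)%Z.
    replace (kap s i - N s i * - y)%Z with (cent c (fsi B s i) w) by lia. now apply (cent_bound c p).
Qed.

Variables (X : Type) (dle : X -> X -> R -> Prop) (rp : X -> word).
Hypothesis HM : word_model E X dle p rp.
Variables (Lc : list (nat * nat)) (idx : nat -> nat -> nat) (D0 Kz : nat).
Hypothesis HL : NoDup Lc.
Hypothesis HLc : forall s i, In (s, i) Lc -> i < s /\ 4 + 4 * (slot s i) <= Kz.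
Hypothesis HLf : forall s i, In (s, i) Lc -> fbounded c p (fsi B s i).
Hypothesis Hidx : forall j, 2 + c <= j < 2 + c + length Lc -> exists s i, In (s, i) Lc /\ idx s i = j.
Hypothesis Hidx' : forall s i, In (s, i) Lc -> idx s i < 2 + c + length Lc.

(** The scale [delta] bounds the cost of a diagonal unit step. Opposite faces are [Lg] apart in
    coordinates, while a word of length at most [Tn] changes the first [2 + c] of them by at most
    [Tn] and a central one, modulo its order, by at most [Tn ^ 2]. *)
Lemma grid_lower (n Lg Tn : nat) (Dm : R) (F : (X -> Prop) -> Prop) :
  n = 2 + c + length Lc -> 1 <= D0 ->
  let delta := INR ((2 + c) * D0 + length Lc * Kz) in
  (Dm + 4 * INR n * delta <= INR Tn)%R ->
  Tn < Lg -> (forall s i y, In (s, i) Lc -> (Z.of_nat Tn * Z.of_nat Tn < Z.abs (Z.of_nat Lg - N s i * y))%Z) ->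
  is_cover X F -> diam_le X dle F Dm ->
  ~ mult_le X dle F (2 * INR n * delta) (n - 1).
Proof.
  intros Hn HD delta HT HLg HNL Hcov Hdiam Hmult.
  set (Fl := fun (x : nat -> Z) => flat (Z.of_nat D0 * x 0) (Z.of_nat D0 * x 1)
     (fun i => Z.of_nat D0 * x (i - 1)%nat)%Z (restr Lc (fun s i => x (idx s i)))).
  assert (Fl_ex : forall x : nat -> Z, exists w, vp p w /\ Fl x w /\
     ((forall j, j < n -> (Z.abs (x j) <= 1)%Z) -> length w <= (2 + c) * D0 + length Lc * Kz)).
  { intros x. destruct (classic (forall j, j < n -> (Z.abs (x j) <= 1)%Z)) as [Hs|Hs].
    - destruct (flat_exists Lc (Z.of_nat D0 * x 0) (Z.of_nat D0 * x 1)
        (fun i => Z.of_nat D0 * x (i - 1)%nat)%Z (fun s i => x (idx s i)) Kz D0 HL) as [w [W1 [W2 W3]]].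
      + intros i Hi. assert (H := Hs (i - 1) ltac:(lia)). nia.
      + intros s i Hin. destruct (HLc s i Hin) as [Hi HK]. split; [exact Hi|].
        assert (H := Hs (idx s i) ltac:(rewrite Hn; now apply Hidx')). lia.
      + exists w. split; [exact W1|]. split; [exact W2|]. intros _.
        assert (H0 := Hs 0 ltac:(lia)). assert (H1 := Hs 1 ltac:(lia)).
        assert (Z.abs_nat (Z.of_nat D0 * x 0) <= D0) by nia. assert (Z.abs_nat (Z.of_nat D0 * x 1) <= D0) by nia. lia.
    - set (K := fold_right (fun (i a : nat) => Z.abs_nat (Z.of_nat D0 * x (i - 1)%nat) + a) 0 (seq 3 c)).
      set (K' := fold_right (fun (q : nat * nat) a => 2 + 2 * Z.abs_nat (x (idx (fst q) (snd q))) + 4 * slot (fst q) (snd q) + a) 0 Lc).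
      destruct (flat_exists Lc (Z.of_nat D0 * x 0) (Z.of_nat D0 * x 1)
        (fun i => Z.of_nat D0 * x (i - 1)%nat)%Z (fun s i => x (idx s i)) K' K HL) as [w [W1 [W2 W3]]].
      + assert (Hf : forall l i, In i l -> Z.abs_nat (Z.of_nat D0 * x (i - 1)%nat) <=
          fold_right (fun (i a : nat) => Z.abs_nat (Z.of_nat D0 * x (i - 1)%nat) + a) 0 l).
        { induction l as [|b l IH]; [intros i []|]. intros i [->|Hin]; simpl; [lia|]. specialize (IH i Hin). lia. }
        intros i Hi. assert (H := Hf (seq 3 c) i ltac:(apply in_seq; lia)). fold K in H. lia.
      + assert (Hf : forall l q, In q l -> 2 + 2 * Z.abs_nat (x (idx (fst q) (snd q))) + 4 * slot (fst q) (snd q) <=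
          fold_right (fun (q : nat * nat) a => 2 + 2 * Z.abs_nat (x (idx (fst q) (snd q))) + 4 * slot (fst q) (snd q) + a) 0 l).
        { induction l as [|b l IH]; [intros q []|]. intros q [->|Hin]; cbn [fold_right]; [lia|]. specialize (IH q Hin). lia. }
        intros s i Hin. destruct (HLc s i Hin) as [Hi HK]. split; [exact Hi|]. exact (Hf Lc (s, i) Hin).
      + exists w. split; [exact W1|]. split; [exact W2|]. intros Hs'. contradiction. }
  assert (Fl_app : forall x y w w', Fl x w -> Fl y w' -> Fl (fun j => x j + y j)%Z (w ++ w')).
  { intros x y w w' H H'. destruct (flat_app _ _ _ _ _ _ _ _ _ _ H H') as [G1 G2 G3 G4]. split.
    - rewrite G1. do 2 f_equal. lia.
    - rewrite G2. do 2 f_equal. lia.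
    - intros i Hi. rewrite G3 by exact Hi. lia.
    - intros s i Hi. destruct (G4 s i Hi) as [z Hz]. exists z. rewrite <- Hz. unfold restr.
      destruct (in_dec slot_dec (s, i) Lc); lia. }
  destruct HM as [M1 [M2 M3]].
  set (cast := fun x : point => fun j => Z.of_nat (x j)).
  assert (Hphi : forall x : point, exists z, Fl (cast x) (rp z)).
  { intros x. destruct (Fl_ex (cast x)) as [w [W1 [W2 _]]]. destruct (M2 w W1) as [z Hz]. exists z.
    apply (flat_E _ _ _ _ w); [exact W2 | now apply (wc_sym _ HE)]. }
  destruct (Hphi (fun _ => 0)) as [z0 _].
  set (phi := fun x : point => epsilon (inhabits z0) (fun z => Fl (cast x) (rp z))).
  assert (Hphi' : forall x, Fl (cast x) (rp (phi x))) by (intros x; apply epsilon_spec, Hphi).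
  clearbody phi.
  assert (Hconn : forall x y w, Fl (fun j => Z.of_nat (y j) - Z.of_nat (x j))%Z w -> E (rp (phi x) ++ w) (rp (phi y))).
  { intros x y w Hw. assert (H := Fl_app _ _ _ _ (Hphi' x) Hw).
    apply (flat_unique (Z.of_nat D0 * cast y 0) (Z.of_nat D0 * cast y 1)
     (fun i => Z.of_nat D0 * cast y (i - 1)%nat)%Z (restr Lc (fun s i => cast y (idx s i)))); [|apply Hphi'].
    replace (cast y) with (fun j => cast x j + (Z.of_nat (y j) - Z.of_nat (x j)))%Z; [exact H|].
    extensionality j. unfold cast. lia. }
  apply (no_cover_of_grid X dle (model_sym E X dle p rp HE HM) (model_refl E X dle p rp HE HM)
    (model_trans E X dle p rp HE HM) (model_mono E X dle p rp HM) n Lg delta Dm phi F).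
  - unfold delta. apply lt_0_INR. nia.
  - lia.
  - intros x u H1 H2. destruct (Fl_ex (fun j => Z.of_nat (u j) - Z.of_nat (x j))%Z) as [w [W1 [W2 W3]]].
    apply M3. exists w. split; [exact W1|]. split; [|now apply Hconn].
    apply le_INR, W3. intros j _. specialize (H1 j). lia.
  - intros i x y Hi Hx Hy Hxy Hxy' Hd. apply M3 in Hd as [w [W1 [W2 W3]]].
    assert (Hlw : length w <= Tn) by (apply INR_le; eapply Rle_trans; [exact W2 | exact HT]).
    destruct (Fl_ex (fun j => Z.of_nat (y j) - Z.of_nat (x j))%Z) as [v [V1 [V2 _]]].
    assert (Hwv : E v w).
    { apply (E_cancel_l E HE (rp (phi x))). apply (wc_trans _ HE) with (rp (phi y)); [now apply Hconn|].
      now apply (wc_sym _ HE). }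
    assert (Hfw := flat_E _ _ _ _ _ _ V2 Hwv).
    destruct (flat_bounds _ _ _ _ _ W1 Hfw) as [B1 [B2 [B3 B4]]].
    destruct (Nat.eq_dec i 0) as [->|Hi0]; [rewrite Hx, Hy in B1; nia|].
    destruct (Nat.eq_dec i 1) as [->|Hi1]; [rewrite Hx, Hy in B2; nia|].
    destruct (Nat.lt_ge_cases i (2 + c)) as [Hi2|Hi2].
    + assert (H := B3 (i + 1) ltac:(lia)). replace (i + 1 - 1) with i in H by lia. rewrite Hx, Hy in H. nia.
    + destruct (Hidx i ltac:(lia)) as [s [i' [Hin Ei]]]. destruct (HLc s i' Hin) as [Hi' _].
      destruct (B4 s i' Hi' (HLf s i' Hin)) as [z Hz]. unfold restr in Hz.
      destruct (in_dec slot_dec (s, i') Lc); [|contradiction]. rewrite Ei, Hx, Hy in Hz.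
      assert (H := HNL s i' z Hin). replace (Z.of_nat Lg - Z.of_nat 0 - N s i' * z)%Z with (Z.of_nat Lg - N s i' * z)%Z in Hz by lia.
      assert (Z.of_nat (length w) * Z.of_nat (length w) <= Z.of_nat Tn * Z.of_nat Tn)%Z by (apply Z.mul_le_mono_nonneg; lia). lia.
  - exact Hcov.
  - exact Hdiam.
  - intros x Us HU HF. assert (H := Hmult x Us HU HF). lia.
Qed.

End Flat.

(** * Primitive recursive functions *)

Definition isPR (k : nat) (f : list nat -> nat) : Prop :=
  exists p, forall xs, length xs = k -> pr_eval p xs = f xs.

Lemma isPR_ext k f g : (forall xs, length xs = k -> f xs = g xs) -> isPR k f -> isPR k g.
Proof. intros H [p Hp]; exists p; intros xs Hxs. now rewrite Hp, H. Qed.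

Lemma isPR_var k i : isPR k (fun xs => nth i xs 0).
Proof. now exists (PRproj i). Qed.

Lemma isPR_const k n : isPR k (fun _ => n).
Proof.
  induction n as [|n [p Hp]]; [now exists PRzero|].
  exists (PRcomp PRsucc [p]). intros xs Hxs. simpl. now rewrite Hp.
Qed.

Lemma isPR_comp k m h (gs : list (list nat -> nat)) : length gs = m -> isPR m h ->
  (forall g, In g gs -> isPR k g) -> isPR k (fun xs => h (map (fun g => g xs) gs)).
Proof.
  intros Hm [ph Hh] Hg.
  assert (H : exists ps, forall xs, length xs = k -> map (fun q => pr_eval q xs) ps = map (fun g => g xs) gs).
  { clear Hm. induction gs as [|g gs IH]; [now exists []|].
    destruct IH as [ps Hps]; [intros; apply Hg; now right|].
    destruct (Hg g (or_introl eq_refl)) as [q Hq]. exists (q :: ps). intros xs Hxs. simpl.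
    now rewrite Hq, Hps. }
  destruct H as [ps Hps]. exists (PRcomp ph ps). intros xs Hxs. simpl. rewrite Hps by exact Hxs.
  apply Hh. now rewrite length_map.
Qed.

Definition PR1 (f : nat -> nat) : Prop := isPR 1 (fun xs => f (nth 0 xs 0)).
Definition PR2 (f : nat -> nat -> nat) : Prop := isPR 2 (fun xs => f (nth 0 xs 0) (nth 1 xs 0)).

Lemma isPR_app1 f k g : PR1 f -> isPR k g -> isPR k (fun xs => f (g xs)).
Proof.
  intros Hf Hg. apply (isPR_comp k 1 _ [g]) in Hf; [exact Hf | reflexivity|]. intros g' [<-|[]]; exact Hg.
Qed.

Lemma isPR_app2 f k g h : PR2 f -> isPR k g -> isPR k h -> isPR k (fun xs => f (g xs) (h xs)).
Proof.
  intros Hf Hg Hh. apply (isPR_comp k 2 _ [g; h]) in Hf; [exact Hf | reflexivity|].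
  intros g' [<-|[<-|[]]]; assumption.
Qed.

Lemma map_nth_seq (xs pre : list nat) :
  map (fun i => nth i (pre ++ xs) 0) (seq (length pre) (length xs)) = xs.
Proof.
  revert pre; induction xs as [|x xs IH]; intros pre; [reflexivity|]. simpl.
  rewrite app_nth2, Nat.sub_diag by lia. f_equal.
  specialize (IH (pre ++ [x])). rewrite <- app_assoc, length_app in IH. simpl in IH.
  rewrite Nat.add_1_r in IH. exact IH.
Qed.

Lemma isPR_weaken j k f : isPR k f -> isPR (j + k) (fun xs => f (skipn j xs)).
Proof.
  intros Hf. apply (isPR_comp (j + k) k f (map (fun i => fun xs => nth i xs 0) (seq j k))) in Hf.
  - refine (isPR_ext _ _ _ _ Hf). intros xs Hxs. f_equal. rewrite map_map.
    assert (H := map_nth_seq (skipn j xs) (firstn j xs)). rewrite firstn_skipn in H.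
    rewrite length_firstn, length_skipn in H. rewrite Hxs in H.
    replace (min j (j + k)) with j in H by lia. replace (j + k - j) with k in H by lia. exact H.
  - now rewrite length_map, length_seq.
  - intros g Hg. apply in_map_iff in Hg as [i [<- _]]. apply isPR_var.
Qed.

Lemma isPR_under k f : isPR k f -> isPR (S k) (fun xs => f (tl xs)).
Proof.
  intros H. apply (isPR_weaken 1) in H. refine (isPR_ext _ _ _ _ H). intros xs _. now destruct xs.
Qed.

Lemma isPR_rec k b s n : isPR k b -> isPR (2 + k) s -> isPR k n ->
  isPR k (fun xs => nat_rect (fun _ => nat) (b xs) (fun i acc => s (i :: acc :: xs)) (n xs)).
Proof.
  intros [pb Hb] [ps Hs] [pn Hn].
  exists (PRcomp (PRrec pb ps) (pn :: map PRproj (seq 0 k))). intros xs Hxs. simpl.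
  rewrite map_map. simpl. assert (H := map_nth_seq xs []). simpl in H. rewrite Hxs in H. rewrite H.
  rewrite Hn by exact Hxs. rewrite Hb by exact Hxs.
  induction (n xs) as [|m IH]; [reflexivity|]. simpl. rewrite IH, Hs by (simpl; lia). reflexivity.
Qed.

Lemma PR2_rec b s : PR1 b -> isPR 3 s ->
  PR2 (fun (n x : nat) => nat_rect (fun _ => nat) (b x) (fun i acc => s [i; acc; x]) n).
Proof.
  intros Hb Hs. unfold PR2.
  apply (isPR_ext 2 (fun xs => nat_rect (fun _ => nat) (b (nth 1 xs 0))
     (fun i acc => s [nth 0 (i :: acc :: xs) 0; nth 1 (i :: acc :: xs) 0; nth 3 (i :: acc :: xs) 0]) (nth 0 xs 0))).
  - reflexivity.
  - apply (isPR_rec 2 (fun xs => b (nth 1 xs 0))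
      (fun xs => s [nth 0 xs 0; nth 1 xs 0; nth 3 xs 0]) (fun xs => nth 0 xs 0)).
    + apply (isPR_app1 b); [exact Hb | apply isPR_var].
    + apply (isPR_comp 4 3 s [fun xs => nth 0 xs 0; fun xs => nth 1 xs 0; fun xs => nth 3 xs 0]) in Hs.
      * exact Hs.
      * reflexivity.
      * intros g [<-|[<-|[<-|[]]]]; apply isPR_var.
    + apply isPR_var.
Qed.

Lemma PR2_swap f : PR2 f -> PR2 (fun x y => f y x).
Proof. intros H. apply (isPR_app2 f); auto using isPR_var. Qed.

Lemma PR1_S : PR1 S.
Proof. exists PRsucc. intros xs Hxs. simpl. destruct xs; reflexivity. Qed.

Definition idn (x : nat) : nat := x.

Lemma PR2_add : PR2 Nat.add.
Proof.
  apply (isPR_ext 2 (fun xs => (fun (n x : nat) => nat_rect (fun _ => nat) (idn x) (fun i acc => (fun l => S (nth 1 l 0)) [i; acc; x]) n) (nth 0 xs 0) (nth 1 xs 0))).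
  - intros xs _. cbv beta. induction (nth 0 xs 0) as [|m IH]; [reflexivity|]. simpl in *. now rewrite IH.
  - apply (PR2_rec idn (fun l => S (nth 1 l 0))); [apply isPR_var | apply (isPR_app1 S); [apply PR1_S | apply isPR_var]].
Qed.

Lemma PR2_mul : PR2 Nat.mul.
Proof.
  apply (isPR_ext 2 (fun xs => (fun (n x : nat) => nat_rect (fun _ => nat) 0 (fun i acc => (fun l => nth 2 l 0 + nth 1 l 0) [i; acc; x]) n) (nth 0 xs 0) (nth 1 xs 0))).
  - intros xs _. cbv beta. induction (nth 0 xs 0) as [|m IH]; [reflexivity|]. simpl in *. now rewrite IH.
  - apply (PR2_rec (fun _ => 0) (fun l => nth 2 l 0 + nth 1 l 0)); [exact (isPR_const 1 _) | apply (isPR_app2 Nat.add); [apply PR2_add| |]; apply isPR_var].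
Qed.

Lemma PR2_pow : PR2 Nat.pow.
Proof.
  apply (PR2_swap (fun n x : nat => x ^ n)).
  apply (isPR_ext 2 (fun xs => (fun (n x : nat) => nat_rect (fun _ => nat) 1 (fun i acc => (fun l => nth 2 l 0 * nth 1 l 0) [i; acc; x]) n) (nth 0 xs 0) (nth 1 xs 0))).
  - intros xs _. cbv beta. induction (nth 0 xs 0) as [|m IH]; [reflexivity|]. simpl in *. now rewrite IH.
  - apply (PR2_rec (fun _ => 1) (fun l => nth 2 l 0 * nth 1 l 0)); [exact (isPR_const 1 _) | apply (isPR_app2 Nat.mul); [apply PR2_mul| |]; apply isPR_var].
Qed.

Lemma PR1_pred : PR1 Nat.pred.
Proof.
  apply (isPR_ext 1 (fun xs => nat_rect (fun _ => nat) 0 (fun i acc => nth 0 (i :: acc :: xs) 0) (nth 0 xs 0))).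
  - intros xs _. destruct (nth 0 xs 0); reflexivity.
  - apply (isPR_rec 1 (fun _ => 0) (fun l => nth 0 l 0) (fun xs => nth 0 xs 0)); auto using isPR_const, isPR_var.
Qed.

Lemma PR2_sub : PR2 Nat.sub.
Proof.
  apply (PR2_swap (fun n x : nat => x - n)).
  apply (isPR_ext 2 (fun xs => (fun (n x : nat) => nat_rect (fun _ => nat) (idn x) (fun i acc => (fun l => Nat.pred (nth 1 l 0)) [i; acc; x]) n) (nth 0 xs 0) (nth 1 xs 0))).
  - intros xs _. cbv beta. unfold idn. induction (nth 0 xs 0) as [|m IH]; [simpl; lia|]. simpl in *. rewrite IH. lia.
  - apply (PR2_rec idn (fun l => Nat.pred (nth 1 l 0))); [apply isPR_var | apply (isPR_app1 Nat.pred); [apply PR1_pred | apply isPR_var]].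
Qed.

Definition isz (x : nat) : nat := 1 - x.
Definition eqn (x y : nat) : nat := isz ((x - y) + (y - x)).
Definition ite (b x y : nat) : nat := isz (isz b) * x + isz b * y.

Lemma eqn_spec x y : eqn x y = if x =? y then 1 else 0.
Proof. unfold eqn, isz. destruct (Nat.eqb_spec x y); lia. Qed.

Lemma ite_spec b x y : ite b x y = if b =? 0 then y else x.
Proof. unfold ite, isz. destruct (Nat.eqb_spec b 0) as [->|H]; [lia|]. replace (1 - b) with 0 by lia. lia. Qed.

Lemma isz_spec x : isz x <> 0 <-> x = 0.
Proof. unfold isz; lia. Qed.

Definition nsum (n : nat) (F : nat -> nat) : nat := nat_rect (fun _ => nat) 0 (fun i acc => acc + F i) n.

Lemma nsum_ext n F G : (forall i, i < n -> F i = G i) -> nsum n F = nsum n G.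
Proof.
  induction n as [|n IH]; intros H; [reflexivity|]. simpl. rewrite IH by (intros; apply H; lia).
  rewrite H by lia. reflexivity.
Qed.

Lemma nsum_S n F : nsum (S n) F = F 0 + nsum n (fun i => F (S i)).
Proof. induction n as [|n IH]; [simpl; lia|]. change (nsum (S (S n)) F) with (nsum (S n) F + F (S n)). rewrite IH. simpl. lia. Qed.

Lemma nsum_zero n F : nsum n F = 0 <-> forall i, i < n -> F i = 0.
Proof.
  induction n as [|n IH]; [split; [lia | reflexivity]|]. simpl. split.
  - intros H i Hi. destruct (Nat.eq_dec i n) as [->|]; [lia|]. apply IH; lia.
  - intros H. rewrite H by lia. rewrite (proj2 IH); [reflexivity|]. intros; apply H; lia.
Qed.

Lemma nsum_single n F j : j < n -> (forall i, i < n -> i <> j -> F i = 0) -> nsum n F = F j.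
Proof.
  induction n as [|n IH]; intros Hj H; [lia|]. simpl.
  destruct (Nat.eq_dec j n) as [->|Hn].
  - rewrite (proj2 (nsum_zero n F)); [lia|]. intros i Hi. apply H; lia.
  - rewrite IH by (lia || (intros; apply H; lia)). rewrite (H n) by lia. lia.
Qed.

Lemma isPR_nsum k n F : isPR k n -> isPR (S k) F -> isPR k (fun xs => nsum (n xs) (fun i => F (i :: xs))).
Proof.
  intros Hn HF. unfold nsum.
  apply (isPR_ext k (fun xs => nat_rect (fun _ => nat) 0
    (fun i acc => (fun l => nth 1 l 0 + F (nth 0 l 0 :: skipn 2 l)) (i :: acc :: xs)) (n xs))); [reflexivity|].
  apply (isPR_rec k (fun _ => 0) (fun l => nth 1 l 0 + F (nth 0 l 0 :: skipn 2 l)) n); auto using isPR_const.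
  apply (isPR_app2 Nat.add); [apply PR2_add | apply isPR_var|].
  apply (isPR_comp (2 + k) (S k) F ((fun xs => nth 0 xs 0) :: map (fun i => fun xs => nth i xs 0) (seq 2 k))) in HF.
  - refine (isPR_ext _ _ _ _ HF). intros xs Hxs. f_equal. simpl. f_equal. rewrite map_map.
    assert (H := map_nth_seq (skipn 2 xs) (firstn 2 xs)). rewrite firstn_skipn in H.
    rewrite length_firstn, length_skipn in H. rewrite Hxs in H.
    replace (min 2 (2 + k)) with 2 in H by lia. replace (2 + k - 2) with k in H by lia. exact H.
  - simpl. now rewrite length_map, length_seq.
  - intros g [<-|Hg]; [apply isPR_var|]. apply in_map_iff in Hg as [i [<- _]]. apply isPR_var.
Qed.

Lemma PR1_isz : PR1 isz.
Proof. apply (isPR_app2 Nat.sub); [apply PR2_sub | apply isPR_const | apply isPR_var]. Qed.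

Ltac pr := repeat first
  [ eassumption
  | apply isPR_var | apply isPR_const
  | apply PR2_add | apply PR2_mul | apply PR2_sub | apply PR2_pow | apply PR1_S | apply PR1_pred | apply PR1_isz ].

Lemma PR2_eqn : PR2 eqn.
Proof.
  unfold PR2, eqn. apply (isPR_app1 isz); [pr|]. apply (isPR_app2 Nat.add); [pr| |]; apply (isPR_app2 Nat.sub); pr.
Qed.

Lemma isPR_ite k b f g : isPR k b -> isPR k f -> isPR k g -> isPR k (fun xs => ite (b xs) (f xs) (g xs)).
Proof.
  intros Hb Hf Hg. unfold ite. apply (isPR_app2 Nat.add); [pr| |]; apply (isPR_app2 Nat.mul); pr.
  - apply (isPR_app1 isz); [pr|]. apply (isPR_app1 isz); pr.
  - apply (isPR_app1 isz); pr.
Qed.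

Lemma PR2_modulo : PR2 Nat.modulo.
Proof.
  apply (isPR_ext 2 (fun xs => (fun (n x : nat) => nat_rect (fun _ => nat) 0
     (fun i acc => (fun l => ite (eqn (S (nth 1 l 0)) (nth 2 l 0)) 0 (S (nth 1 l 0))) [i; acc; x]) n) (nth 0 xs 0) (nth 1 xs 0))).
  - intros xs _. cbv beta. set (x := nth 1 xs 0). clearbody x.
    match goal with |- nat_rect _ _ ?F _ = _ => set (G := F) end.
    induction (nth 0 xs 0) as [|m IH]; [symmetry; apply Nat.Div0.mod_0_l|].
    change (G m (nat_rect (fun _ => nat) 0 G m) = S m mod x). rewrite IH. unfold G. cbn [nth].
    rewrite ite_spec, eqn_spec.
    (* With modulus 0 the counter is never reset, in agreement with [m mod 0 = m]. *)
    destruct (Nat.eq_dec x 0) as [->|Hx].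
    { simpl. reflexivity. }
    assert (Hb := Nat.mod_upper_bound m x Hx). assert (Hd := Nat.div_mod m x Hx).
    destruct (Nat.eqb_spec (S (m mod x)) x) as [He|He]; simpl.
    + symmetry. change (S m mod x = 0). symmetry. apply (Nat.mod_unique _ _ (S (m / x))); lia.
    + change (S (m mod x) = S m mod x). apply (Nat.mod_unique _ _ (m / x)); lia.
  - apply (PR2_rec (fun _ => 0) (fun l => ite (eqn (S (nth 1 l 0)) (nth 2 l 0)) 0 (S (nth 1 l 0)))); [exact (isPR_const 1 _)|].
    apply isPR_ite; pr.
    + apply (isPR_app2 eqn); [apply PR2_eqn| |pr]. apply (isPR_app1 S); pr.
    + apply (isPR_app1 S); pr.
Qed.

Lemma cpair_tri x y : cpair x y = nsum (S (x + y)) idn + y.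
Proof.
  unfold cpair. f_equal. symmetry. generalize (x + y) as n. intros n.
  apply Nat.div_unique with 0; [lia|]. rewrite Nat.add_0_r.
  induction n as [|n IH]; [reflexivity|]. change (nsum (S (S n)) idn) with (nsum (S n) idn + S n). nia.
Qed.

Lemma tri_mono n m : n < m -> nsum (S n) idn + n < nsum (S m) idn.
Proof.
  induction 1 as [|m Hm IH].
  - change (nsum (S (S n)) idn) with (nsum (S n) idn + S n). lia.
  - change (nsum (S (S m)) idn) with (nsum (S m) idn + S m). lia.
Qed.

Lemma cpair_inj x y x' y' : cpair x y = cpair x' y' -> x = x' /\ y = y'.
Proof.
  rewrite !cpair_tri. intros H.
  destruct (lt_eq_lt_dec (x + y) (x' + y')) as [[Hl|He]|Hl].
  - apply tri_mono in Hl. lia.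
  - rewrite He in H. lia.
  - apply tri_mono in Hl. lia.
Qed.

Lemma cpair_le x y : x <= cpair x y /\ y <= cpair x y.
Proof.
  rewrite cpair_tri. assert (H : forall n, n <= nsum (S n) idn).
  { intros n. destruct n as [|n]; [simpl; lia|]. change (nsum (S (S n)) idn) with (nsum (S n) idn + S n). lia. }
  specialize (H (x + y)). lia.
Qed.

Lemma PR2_cpair : PR2 cpair.
Proof.
  apply (isPR_ext 2 (fun xs => nsum (S (nth 0 xs 0 + nth 1 xs 0)) (fun i => (fun l => nth 0 l 0) (i :: xs)) + nth 1 xs 0)).
  - intros xs _. rewrite cpair_tri. reflexivity.
  - apply (isPR_app2 Nat.add); pr. apply (isPR_nsum 2 (fun xs => S (nth 0 xs 0 + nth 1 xs 0)) (fun l => nth 0 l 0)); pr.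
    apply (isPR_app1 S); pr.
Qed.

(** Bounded search written as a sum in which exactly one term survives, the pair with code [n]. *)
Definition cleft (n : nat) : nat := nsum (S n) (fun x => nsum (S n) (fun y => eqn (cpair x y) n * x)).
Definition cright (n : nat) : nat := nsum (S n) (fun x => nsum (S n) (fun y => eqn (cpair x y) n * y)).

Lemma cunpair_sum (g : nat -> nat -> nat) x y :
  nsum (S (cpair x y)) (fun x' => nsum (S (cpair x y)) (fun y' => eqn (cpair x' y') (cpair x y) * g x' y')) = g x y.
Proof.
  destruct (cpair_le x y) as [Hx Hy].
  rewrite (nsum_single _ _ x); [rewrite (nsum_single _ _ y)| |].
  - rewrite eqn_spec, Nat.eqb_refl. lia.
  - lia.
  - intros i _ Hi. rewrite eqn_spec. destruct (Nat.eqb_spec (cpair x i) (cpair x y)) as [H|]; [|reflexivity].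
    apply cpair_inj in H. lia.
  - lia.
  - intros i _ Hi. apply nsum_zero. intros j _. rewrite eqn_spec.
    destruct (Nat.eqb_spec (cpair i j) (cpair x y)) as [H|]; [|reflexivity]. apply cpair_inj in H. lia.
Qed.

Lemma cleft_cpair x y : cleft (cpair x y) = x.
Proof. apply (cunpair_sum (fun x _ => x)). Qed.
Lemma cright_cpair x y : cright (cpair x y) = y.
Proof. apply (cunpair_sum (fun _ y => y)). Qed.

Lemma PR1_cleft : PR1 cleft.
Proof.
  apply (isPR_nsum 1 (fun xs => S (nth 0 xs 0))
    (fun l => nsum (S (nth 1 l 0)) (fun y => (fun l' => eqn (cpair (nth 1 l' 0) (nth 0 l' 0)) (nth 2 l' 0) * nth 1 l' 0) (y :: l)))).
  - apply (isPR_app1 S); pr.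
  - apply (isPR_nsum 2 (fun l => S (nth 1 l 0)) (fun l' => eqn (cpair (nth 1 l' 0) (nth 0 l' 0)) (nth 2 l' 0) * nth 1 l' 0));
      [apply (isPR_app1 S); pr|].
    apply (isPR_app2 Nat.mul); pr. apply (isPR_app2 eqn); [apply PR2_eqn| |pr].
    apply (isPR_app2 cpair); [apply PR2_cpair| |]; pr.
Qed.

Lemma PR1_cright : PR1 cright.
Proof.
  apply (isPR_nsum 1 (fun xs => S (nth 0 xs 0))
    (fun l => nsum (S (nth 1 l 0)) (fun y => (fun l' => eqn (cpair (nth 1 l' 0) (nth 0 l' 0)) (nth 2 l' 0) * nth 0 l' 0) (y :: l)))).
  - apply (isPR_app1 S); pr.
  - apply (isPR_nsum 2 (fun l => S (nth 1 l 0)) (fun l' => eqn (cpair (nth 1 l' 0) (nth 0 l' 0)) (nth 2 l' 0) * nth 0 l' 0));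
      [apply (isPR_app1 S); pr|].
    apply (isPR_app2 Nat.mul); pr. apply (isPR_app2 eqn); [apply PR2_eqn| |pr].
    apply (isPR_app2 cpair); [apply PR2_cpair| |]; pr.
Qed.

(** * Computing with codes of words *)

Definition lcode (l : letter) : nat := 2 * fst l + (if snd l then 1 else 0).
Definition hdc (u : nat) : nat := cleft (Nat.pred u).
Definition tlc (u : nat) : nat := cright (Nat.pred u).

Lemma code_cons l w : code (l :: w) = S (cpair (lcode l) (code w)).
Proof. destruct l; reflexivity. Qed.
Lemma hdc_code l w : hdc (code (l :: w)) = lcode l.
Proof. rewrite code_cons. apply cleft_cpair. Qed.
Lemma tlc_code l w : tlc (code (l :: w)) = code w.
Proof. rewrite code_cons. apply cright_cpair. Qed.
Lemma tlc_0 : tlc 0 = 0.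
Proof. reflexivity. Qed.

Lemma lcode_inj l l' : lcode l = lcode l' -> l = l'.
Proof. destruct l as [i []], l' as [i' []]; unfold lcode; cbn [fst snd]; intros; f_equal; lia. Qed.

Lemma code_length w : length w <= code w.
Proof.
  induction w as [|l w IH]; [simpl; lia|]. rewrite code_cons.
  destruct (cpair_le (lcode l) (code w)). simpl. lia.
Qed.

Lemma code_zero w : code w = 0 <-> w = [].
Proof. destruct w as [|l w]; [split; reflexivity|]. rewrite code_cons. split; discriminate. Qed.

Lemma PR1_hdc : PR1 hdc.
Proof. apply (isPR_app1 cleft); [apply PR1_cleft|]. apply (isPR_app1 Nat.pred); pr. Qed.
Lemma PR1_tlc : PR1 tlc.
Proof. apply (isPR_app1 cright); [apply PR1_cright|]. apply (isPR_app1 Nat.pred); pr. Qed.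

Definition suf (x u : nat) : nat := nat_rect (fun _ => nat) u (fun _ acc => tlc acc) x.

Lemma PR2_suf : PR2 suf.
Proof.
  apply (PR2_rec idn (fun l => tlc (nth 1 l 0))); [apply isPR_var|].
  apply (isPR_app1 tlc); [apply PR1_tlc | pr].
Qed.

Lemma suf_code x w : suf x (code w) = code (skipn x w).
Proof.
  revert w; induction x as [|x IH]; intros w; [reflexivity|].
  change (suf (S x) (code w)) with (tlc (suf x (code w))). rewrite IH. clear IH.
  revert w; induction x as [|x IH]; intros w.
  - destruct w as [|l w]; [apply tlc_0 | apply tlc_code].
  - destruct w as [|l w]; [apply tlc_0 | apply IH].
Qed.

(** A code is at least as large as the length of its word, so [u] terms reach every nonempty suffix;
    beyond the end [suf] is 0 and the term is dropped. *)
Definition ssum (g : nat -> nat) (u : nat) : nat :=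
  nsum u (fun x => ite (suf x u) (g (suf x u)) 0).
Fixpoint wsum (g : nat -> nat) (w : word) : nat :=
  match w with [] => 0 | l :: w' => g (code w) + wsum g w' end.

Lemma ssum_code g w : ssum g (code w) = wsum g w.
Proof.
  assert (H : forall n w, length w <= n -> nsum n (fun x => ite (code (skipn x w)) (g (code (skipn x w))) 0) = wsum g w).
  { intros n; induction n as [|n IH]; intros v Hv.
    - destruct v; [reflexivity | simpl in Hv; lia].
    - rewrite nsum_S. destruct v as [|l v].
      + simpl skipn. rewrite (proj2 (nsum_zero _ _)); [reflexivity|]. intros i _. simpl. reflexivity.
      + simpl skipn. rewrite IH by (simpl in Hv; lia). rewrite ite_spec.
        destruct (Nat.eqb_spec (code (l :: v)) 0) as [H0|H0]; [apply code_zero in H0; discriminate | reflexivity]. }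
  rewrite <- (H (code w) w) by apply code_length. unfold ssum. apply nsum_ext. intros i _. now rewrite suf_code.
Qed.

Lemma isPR_ssum k G u : isPR (S k) G -> isPR k u -> isPR k (fun xs => ssum (fun v => G (v :: xs)) (u xs)).
Proof.
  intros HG Hu. unfold ssum.
  apply (isPR_nsum k u (fun l => ite (suf (nth 0 l 0) (u (tl l))) (G (suf (nth 0 l 0) (u (tl l)) :: tl l)) 0)); [exact Hu|].
  assert (Hs : isPR (S k) (fun l => suf (nth 0 l 0) (u (tl l)))).
  { apply (isPR_app2 suf); [apply PR2_suf | pr | now apply isPR_under]. }
  apply isPR_ite; [exact Hs| |pr].
  apply (isPR_comp (S k) (S k) G ((fun l => suf (nth 0 l 0) (u (tl l))) :: map (fun i => fun xs => nth i xs 0) (seq 1 k))) in HG.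
  - refine (isPR_ext _ _ _ _ HG). intros xs Hxs. f_equal. simpl. f_equal. rewrite map_map.
    destruct xs as [|x xs]; [discriminate|]. simpl.
    assert (H := map_nth_seq xs [x]). simpl in Hxs, H. replace (length xs) with k in H by lia. exact H.
  - simpl. now rewrite length_map, length_seq.
  - intros g [<-|Hg]; [exact Hs|]. apply in_map_iff in Hg as [i [<- _]]. apply isPR_var.
Qed.

Lemma lcode_mlet l i : (Z.of_nat (eqn (lcode l) (2 * i)) - Z.of_nat (eqn (lcode l) (2 * i + 1)))%Z = mlet i l.
Proof.
  rewrite !eqn_spec. unfold lcode, mlet. destruct l as [j b]; cbn [fst snd].
  destruct b; repeat match goal with |- context [?x =? ?y] => destruct (Nat.eqb_spec x y) end; cbn [sg]; lia.
Qed.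

Lemma lcode_idx l i : eqn (lcode l) (2 * i) + eqn (lcode l) (2 * i + 1) = if fst l =? i then 1 else 0.
Proof.
  rewrite !eqn_spec. unfold lcode. destruct l as [j b]; cbn [fst snd].
  destruct b; repeat match goal with |- context [?x =? ?y] => destruct (Nat.eqb_spec x y) end; cbn [sg]; lia.
Qed.

(** * A primitive recursive test for trivial words *)

Section Check.
Variables (c p : nat) (Nn Bn : nat -> nat -> nat).

Definition posP (u : nat) : nat := ssum (fun v => 4 * eqn (hdc v) (2 * 2) + eqn (hdc v) (2 * (3 + c))) u.
Definition posN (u : nat) : nat := ssum (fun v => 4 * eqn (hdc v) (2 * 2 + 1) + eqn (hdc v) (2 * (3 + c) + 1)) u.

Lemma pos_code w : pos c w = (Z.of_nat (posP (code w)) - Z.of_nat (posN (code w)))%Z.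
Proof.
  unfold posP, posN. rewrite !ssum_code. induction w as [|l w IH]; [reflexivity|].
  cbn [wsum]. unfold pos in *. cbn [possum]. rewrite IH, hdc_code.
  assert (H1 := lcode_mlet l 2). assert (H2 := lcode_mlet l (3 + c)).
  assert (H3 : shift c l = (4 * mlet 2 l + mlet (3 + c) l)%Z).
  { unfold shift, mlet. destruct (Nat.eqb_spec (fst l) 2), (Nat.eqb_spec (fst l) (3 + c)); lia. }
  lia.
Qed.

(** The equation between the difference of positions and [4 * slot s i + r], with [P] and [M] the
    positive and negative parts of the first position, rearranged so that no truncated subtraction
    occurs. *)
Definition hit (sgm P M s i r v : nat) : nat :=
  eqn (hdc v) (2 + sgm) * eqn (P + posN v) (M + posP v + 4 * (slot s i) + r).
Definition bcount (sgm s i u : nat) : nat :=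
  nsum 4 (fun r => Bn s i ^ r * ssum (hit sgm (posP u) (posN u) s i r) (tlc u)).

Let B (s i : nat) : Z := Z.of_nat (Bn s i).

Lemma fsi_sum s i P M v :
  fsi B s i (Z.of_nat P - Z.of_nat M - (Z.of_nat (posP v) - Z.of_nat (posN v)))%Z =
  Z.of_nat (nsum 4 (fun r => Bn s i ^ r * eqn (P + posN v) (M + posP v + 4 * (slot s i) + r))).
Proof.
  cbn [nsum nat_rect]. rewrite !eqn_spec. unfold fsi, B.
  set (q := (Z.of_nat P - Z.of_nat M - (Z.of_nat (posP v) - Z.of_nat (posN v)) - 4 * Z.of_nat (slot s i))%Z).
  assert (Hq : forall r, (P + posN v =? M + posP v + 4 * (slot s i) + r) = (q =? Z.of_nat r)%Z).
  { intros r. unfold q. destruct (Nat.eqb_spec (P + posN v) (M + posP v + 4 * (slot s i) + r)) as [H|H];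
      symmetry; [apply Z.eqb_eq | apply Z.eqb_neq]; lia. }
  rewrite !Hq. clearbody q. clear Hq.
  destruct (Z.leb_spec 0 q), (Z.ltb_spec q 4); cbn [andb];
    destruct (Z.eqb_spec q (Z.of_nat 0)), (Z.eqb_spec q (Z.of_nat 1)), (Z.eqb_spec q (Z.of_nat 2)), (Z.eqb_spec q (Z.of_nat 3));
    subst; try lia.
  - rewrite Z.pow_0_r. simpl. lia.
  - change (Z.of_nat 1) with 1%Z. rewrite Z.pow_1_r. simpl. lia.
  - rewrite <- Nat2Z.inj_pow. f_equal. simpl. lia.
  - rewrite <- Nat2Z.inj_pow. f_equal. simpl. lia.
Qed.

Lemma bsum_code P M s i w :
  bsum c (fsi B s i) (Z.of_nat P - Z.of_nat M) w =
  (Z.of_nat (nsum 4 (fun r => Bn s i ^ r * wsum (hit 0 P M s i r) w)%nat) -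
   Z.of_nat (nsum 4 (fun r => Bn s i ^ r * wsum (hit 1 P M s i r) w)%nat))%Z.
Proof.
  induction w as [|l w IH]; [cbn [nsum nat_rect wsum]; rewrite !Nat.mul_0_r; reflexivity|].
  unfold bsum in *. cbn [lsum]. rewrite IH.
  change (possum (shift c) (l :: w)) with (pos c (l :: w)). rewrite pos_code, fsi_sum.
  rewrite <- (lcode_mlet l 1). rewrite <- (hdc_code l w).
  set (v := code (l :: w)). cbn [nsum nat_rect wsum]. unfold hit. fold v. cbn [Nat.mul Nat.add].
  set (a0 := eqn (hdc v) 2). set (a1 := eqn (hdc v) 3). rewrite !Nat2Z.inj_add, !Nat2Z.inj_mul, !Nat2Z.inj_add, !Nat2Z.inj_mul. ring.
Qed.

Definition centP (s i u : nat) : nat := ssum (fun v => eqn (hdc v) 0 * bcount 0 s i v + eqn (hdc v) 1 * bcount 1 s i v) u.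
Definition centN (s i u : nat) : nat := ssum (fun v => eqn (hdc v) 0 * bcount 1 s i v + eqn (hdc v) 1 * bcount 0 s i v) u.

Lemma cent_code s i w : cent c (fsi B s i) w = (Z.of_nat (centP s i (code w)) - Z.of_nat (centN s i (code w)))%Z.
Proof.
  unfold centP, centN. rewrite !ssum_code. induction w as [|l w IH]; [reflexivity|].
  cbn [wsum cent]. rewrite IH, pos_code, bsum_code, hdc_code, <- (lcode_mlet l 0).
  unfold bcount. rewrite tlc_code.
  assert (Es : forall sgm P M, nsum 4 (fun r => Bn s i ^ r * ssum (hit sgm P M s i r) (code w)) =
     nsum 4 (fun r => Bn s i ^ r * wsum (hit sgm P M s i r) w)).
  { intros. apply nsum_ext. intros r _. now rewrite ssum_code. }
  rewrite !Es. cbn [Nat.mul Nat.add].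
  rewrite !Nat2Z.inj_add, !Nat2Z.inj_mul. ring.
Qed.

(** Exchanges the codes [2 * i] and [2 * i + 1] of a letter and its inverse. *)
Definition invl (l : nat) : nat := l + 1 - 2 * (l mod 2).
Definition pushc (al : nat -> nat) (l st : nat) : nat :=
  ite (al l) (ite st (ite (eqn (hdc st) (invl l)) (tlc st) (S (cpair l st))) (S (cpair l st))) st.
Definition stk (al : nat -> nat) (x u : nat) : nat :=
  nat_rect (fun _ => nat) 0 (fun i acc => ite (suf i u) (pushc al (hdc (suf i u)) acc) acc) x.

Lemma lcode_inv l : lcode (inv_letter l) = invl (lcode l).
Proof.
  unfold lcode, invl, inv_letter. destruct l as [i []]; cbn [fst snd negb].
  - replace ((2 * i + 1) mod 2) with 1; [lia|]. apply (Nat.mod_unique _ _ i); lia.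
  - replace ((2 * i + 0) mod 2) with 0; [lia|]. apply (Nat.mod_unique _ _ i); lia.
Qed.

Lemma pushc_code (A : letter -> bool) al l st : al (lcode l) <> 0 <-> A l = true ->
  pushc al (lcode l) (code st) = code (step A st l).
Proof.
  intros H. unfold pushc, step. rewrite !ite_spec.
  destruct (Nat.eqb_spec (al (lcode l)) 0) as [H0|H0].
  - destruct (A l); [exfalso; apply H; auto | reflexivity].
  - rewrite (proj1 H H0). destruct st as [|h st].
    + change (code []) with 0. cbn [Nat.eqb push]. now rewrite code_cons.
    + destruct (Nat.eqb_spec (code (h :: st)) 0) as [Hc|_]; [apply code_zero in Hc; discriminate|].
      rewrite hdc_code, tlc_code, eqn_spec, <- lcode_inv. unfold push.
      destruct (letter_eq_dec h (inv_letter l)) as [->|Hn].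
      * rewrite Nat.eqb_refl. reflexivity.
      * destruct (Nat.eqb_spec (lcode h) (lcode (inv_letter l))) as [He|He]; [apply lcode_inj in He; contradiction|].
        cbn [Nat.eqb]. now rewrite (code_cons l).
Qed.

Lemma stk_code (A : letter -> bool) al w : (forall l, al (lcode l) <> 0 <-> A l = true) ->
  stk al (code w) (code w) = code (run A w []).
Proof.
  intros H.
  assert (Hx : forall x, stk al x (code w) = code (run A (firstn x w) [])).
  { induction x as [|x IH]; [reflexivity|].
    change (stk al (S x) (code w)) with
      (ite (suf x (code w)) (pushc al (hdc (suf x (code w))) (stk al x (code w))) (stk al x (code w))).
    rewrite IH, suf_code, ite_spec. clear IH.
    assert (Hs : firstn (S x) w = firstn x w ++ match skipn x w with [] => [] | l :: _ => [l] end).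
    { clear. revert w; induction x as [|x IH]; intros [|l w]; try reflexivity. cbn [skipn].
      change (firstn (S (S x)) (l :: w)) with (l :: firstn (S x) w). rewrite IH. reflexivity. }
    rewrite Hs. destruct (skipn x w) as [|l v].
    - rewrite app_nil_r. reflexivity.
    - destruct (Nat.eqb_spec (code (l :: v)) 0) as [Hc|_]; [apply code_zero in Hc; discriminate|].
      rewrite hdc_code, run_app. simpl run at 2. now apply pushc_code. }
  rewrite Hx, firstn_all2 by apply code_length. reflexivity.
Qed.

Definition alph (i j k l : nat) : nat :=
  (eqn l (2 * i) + eqn l (2 * i + 1)) + (eqn l (2 * j) + eqn l (2 * j + 1)) + (eqn l (2 * k) + eqn l (2 * k + 1)).

Lemma alph_spec i j k l : alph i j k (lcode l) <> 0 <-> (fst l =? i) || (fst l =? j) || (fst l =? k) = true.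
Proof.
  unfold alph. rewrite !lcode_idx. destruct (fst l =? i), (fst l =? j), (fst l =? k); simpl; split; auto; discriminate.
Qed.

Definition expP (i u : nat) : nat := ssum (fun v => eqn (hdc v) (2 * i)) u.
Definition expN (i u : nat) : nat := ssum (fun v => eqn (hdc v) (2 * i + 1)) u.

Lemma expo_code i w : expo i w = (Z.of_nat (expP i (code w)) - Z.of_nat (expN i (code w)))%Z.
Proof.
  unfold expP, expN. rewrite !ssum_code. induction w as [|l w IH]; [reflexivity|].
  rewrite expo_cons, IH. cbn [wsum]. rewrite hdc_code. assert (H := lcode_mlet l i). lia.
Qed.

Definition bad_letters (u : nat) : nat := ssum (fun v => S (hdc v) - 2 * p) u.

Lemma bad_letters_code w : bad_letters (code w) = 0 <-> vp p w.
Proof.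
  unfold bad_letters. rewrite ssum_code. induction w as [|l w IH].
  - split; [intros _; apply vp_nil | reflexivity].
  - cbn [wsum]. rewrite hdc_code, vp_cons, <- IH. unfold lcode. destruct (snd l); lia.
Qed.

Definition check (u : nat) : nat :=
  isz (bad_letters u + stk (alph 0 2 (3 + c)) u u + stk (alph 1 2 (3 + c)) u u +
    nsum c (fun i => isz (eqn (expP (3 + i) u) (expN (3 + i) u))) +
    nsum (2 * u + 1) (fun s => nsum s (fun i => isz (eqn (centP s i u mod Nn s i) (centN s i u mod Nn s i))))).

Let N (s i : nat) : Z := Z.of_nat (Nn s i).
Hypothesis HN : forall s i, s <= i -> Nn s i = 1.

Lemma eqn_isz x y : isz (eqn x y) = 0 <-> x = y.
Proof. rewrite eqn_spec. destruct (Nat.eqb_spec x y); cbn [isz]; unfold isz; split; auto; (discriminate || contradiction). Qed.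

Lemma divide_mod x y n : (Z.of_nat n | Z.of_nat x - Z.of_nat y)%Z <-> x mod n = y mod n.
Proof.
  destruct (Nat.eq_dec n 0) as [->|Hn].
  (* Modulus 0 is the infinite cyclic case: [x mod 0 = x], and only 0 is divisible by 0. *)
  - rewrite !Nat.mod_0_r. split; [intros [k Hk]; lia|].
    intros H. exists 0%Z. lia.
  - split.
    + intros [k Hk]. apply Nat2Z.inj. rewrite !Nat2Z.inj_mod.
      replace (Z.of_nat x) with (Z.of_nat y + k * Z.of_nat n)%Z by lia. apply Z.mod_add. lia.
    + intros H. assert (Ex := Nat.div_mod x n Hn). assert (Ey := Nat.div_mod y n Hn).
      exists (Z.of_nat (x / n) - Z.of_nat (y / n))%Z. rewrite Ex, Ey at 1. rewrite H. lia.
Qed.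

Lemma check_code w : check (code w) <> 0 <-> vp p w /\ weq c N B w [].
Proof.
  unfold check. rewrite isz_spec.
  rewrite (stk_code (inU c) (alph 0 2 (3 + c)) w) by (intros; apply alph_spec).
  rewrite (stk_code (inV c) (alph 1 2 (3 + c)) w) by (intros; apply alph_spec).
  set (e1 := nsum c _). set (e2 := nsum (2 * code w + 1) _).
  assert (H1 : e1 = 0 <-> forall i, 3 <= i < 3 + c -> expo i w = 0%Z).
  { unfold e1. rewrite nsum_zero. split; intros H i Hi.
    - specialize (H (i - 3) ltac:(lia)). apply (proj1 (eqn_isz _ _)) in H. replace (3 + (i - 3)) with i in H by lia.
      rewrite expo_code. lia.
    - apply (proj2 (eqn_isz _ _)). specialize (H (3 + i) ltac:(lia)). rewrite expo_code in H. lia. }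
  assert (H2 : e2 = 0 <-> forall s i, (N s i | cent c (fsi B s i) w - 0)%Z).
  { unfold e2. rewrite nsum_zero. split.
    - intros H s i. destruct (le_lt_dec s i) as [Hsi|Hsi]; [unfold N; rewrite HN by exact Hsi; apply Z.divide_1_l|].
      destruct (Nat.lt_ge_cases s (2 * code w + 1)) as [Hs|Hs].
      + specialize (H s Hs). rewrite nsum_zero in H. specialize (H i Hsi). apply (proj1 (eqn_isz _ _)) in H.
        rewrite cent_code, Z.sub_0_r. now apply divide_mod.
      (* The origin of the bound [2 * u + 1] in [check]: [slot s i] exceeds [s], hence twice the
         length of the word, and the coordinate is invisible. *)
      + rewrite (cent_vanish c _ _ w (fsi_vanish B s i)); [apply Z.divide_0_r|].
        assert (Hl := code_length w). assert (Hd := slot_gt s i). lia.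
    - intros H s _. apply nsum_zero. intros i _. apply (proj2 (eqn_isz _ _)). apply divide_mod.
      specialize (H s i). rewrite cent_code, Z.sub_0_r in H. exact H. }
  assert (HU := code_zero (run (inU c) w [])). assert (HV := code_zero (run (inV c) w [])).
  assert (HB := bad_letters_code w). split.
  - intros H. split; [apply HB; lia|]. split.
    + apply HU. lia.
    + apply HV. lia.
    + intros i Hi. change (expo i []) with 0%Z. apply H1; auto. lia.
    + intros s i. apply H2. lia.
  - intros [Hv [W1 W2 W3 W4]]. rewrite (proj2 HB Hv), (proj2 HU W1), (proj2 HV W2).
    rewrite (proj2 H1), (proj2 H2); [reflexivity| |]; auto.
Qed.

Hypothesis PR_N : PR2 Nn.
Hypothesis PR_B : PR2 Bn.

Ltac prs := repeat first
  [ match goal with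
    | |- isPR _ (fun xs => nth _ xs 0) => apply isPR_var
    | |- isPR _ (fun _ => ?n) => apply isPR_const
    | |- PR1 hdc => apply PR1_hdc | |- PR1 tlc => apply PR1_tlc | |- PR1 S => apply PR1_S
    | |- PR1 isz => apply PR1_isz | |- PR2 Nat.add => apply PR2_add | |- PR2 Nat.mul => apply PR2_mul
    | |- PR2 Nat.sub => apply PR2_sub | |- PR2 Nat.pow => apply PR2_pow | |- PR2 eqn => apply PR2_eqn
    | |- PR2 Nat.modulo => apply PR2_modulo | |- PR2 cpair => apply PR2_cpair | |- PR2 suf => apply PR2_suf
    | |- PR2 Nn => exact PR_N | |- PR2 Bn => exact PR_B
    | |- isPR _ (fun _ => hdc _) => apply (isPR_app1 hdc)
    | |- isPR _ (fun _ => tlc _) => apply (isPR_app1 tlc)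
    | |- isPR _ (fun _ => S _) => apply (isPR_app1 S)
    | |- isPR _ (fun _ => isz _) => apply (isPR_app1 isz)
    | |- isPR _ (fun _ => _ + _) => apply (isPR_app2 Nat.add)
    | |- isPR _ (fun _ => _ * _) => apply (isPR_app2 Nat.mul)
    | |- isPR _ (fun _ => _ - _) => apply (isPR_app2 Nat.sub)
    | |- isPR _ (fun _ => _ ^ _) => apply (isPR_app2 Nat.pow)
    | |- isPR _ (fun _ => _ mod _) => apply (isPR_app2 Nat.modulo)
    | |- isPR _ (fun _ => eqn _ _) => apply (isPR_app2 eqn)
    | |- isPR _ (fun _ => cpair _ _) => apply (isPR_app2 cpair)
    | |- isPR _ (fun _ => suf _ _) => apply (isPR_app2 suf)
    | |- isPR _ (fun _ => Nn _ _) => apply (isPR_app2 Nn)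
    | |- isPR _ (fun _ => Bn _ _) => apply (isPR_app2 Bn)
    | |- isPR _ (fun _ => ite _ _ _) => apply isPR_ite
    end ].

Lemma PR1_Dn : PR1 Dn.
Proof.
  apply (isPR_ext 1 (fun xs => nat_rect (fun _ => nat) 4 (fun i acc => (fun l => nth 1 l 0 ^ 8) (i :: acc :: xs)) (nth 0 xs 0))).
  - intros xs _. induction (nth 0 xs 0) as [|m IH]; [reflexivity|]. cbn [nat_rect nth] in *. now rewrite IH.
  - apply (isPR_rec 1 (fun _ => 4) (fun l => nth 1 l 0 ^ 8) (fun xs => nth 0 xs 0)); prs.
Qed.

Lemma PR2_slot : PR2 slot.
Proof.
  unfold PR2, slot. apply (isPR_app2 Nat.mul); [prs| |prs].
  apply (isPR_app1 Dn); [apply PR1_Dn | prs].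
Qed.

Lemma PR1_posP : PR1 posP.
Proof.
  refine (isPR_ssum 1 (fun l => 4 * eqn (hdc (nth 0 l 0)) (2 * 2) + eqn (hdc (nth 0 l 0)) (2 * (3 + c))) (fun xs => nth 0 xs 0) _ _); prs.
Qed.
Lemma PR1_posN : PR1 posN.
Proof.
  refine (isPR_ssum 1 (fun l => 4 * eqn (hdc (nth 0 l 0)) (2 * 2 + 1) + eqn (hdc (nth 0 l 0)) (2 * (3 + c) + 1)) (fun xs => nth 0 xs 0) _ _); prs.
Qed.

Lemma isPR_bcount sgm k s i u : isPR k s -> isPR k i -> isPR k u -> isPR k (fun xs => bcount sgm (s xs) (i xs) (u xs)).
Proof.
  intros Hs Hi Hu.
  apply (isPR_comp k 3 (fun xs => bcount sgm (nth 0 xs 0) (nth 1 xs 0) (nth 2 xs 0)) [s; i; u]); [reflexivity| |].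
  2:{ intros g [<-|[<-|[<-|[]]]]; assumption. }
  refine (isPR_nsum 3 (fun _ => 4) (fun l => Bn (nth 1 l 0) (nth 2 l 0) ^ (nth 0 l 0) *
    ssum (fun v => (fun l' => eqn (hdc (nth 0 l' 0)) (2 + sgm) *
       eqn (posP (nth 4 l' 0) + posN (nth 0 l' 0)) (posN (nth 4 l' 0) + posP (nth 0 l' 0) + 4 * slot (nth 2 l' 0) (nth 3 l' 0) + nth 1 l' 0)) (v :: l)) (tlc (nth 3 l 0))) _ _); [prs|].
  apply (isPR_app2 Nat.mul); [prs|prs|].
  apply (isPR_ssum 4 (fun l' => eqn (hdc (nth 0 l' 0)) (2 + sgm) *
       eqn (posP (nth 4 l' 0) + posN (nth 0 l' 0)) (posN (nth 4 l' 0) + posP (nth 0 l' 0) + 4 * slot (nth 2 l' 0) (nth 3 l' 0) + nth 1 l' 0)) (fun l => tlc (nth 3 l 0))); [|prs].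
  prs; match goal with
    | |- isPR _ (fun _ => posP _) => apply (isPR_app1 posP); [apply PR1_posP|]
    | |- isPR _ (fun _ => posN _) => apply (isPR_app1 posN); [apply PR1_posN|]
    | |- isPR _ (fun _ => slot _ _) => apply (isPR_app2 slot); [apply PR2_slot| |]
    end; prs.
Qed.

Lemma isPR_centP k s i u : isPR k s -> isPR k i -> isPR k u -> isPR k (fun xs => centP (s xs) (i xs) (u xs)).
Proof.
  intros Hs Hi Hu.
  apply (isPR_comp k 3 (fun xs => centP (nth 0 xs 0) (nth 1 xs 0) (nth 2 xs 0)) [s; i; u]); [reflexivity| |].
  2:{ intros g [<-|[<-|[<-|[]]]]; assumption. }
  refine (isPR_ssum 3 (fun l => eqn (hdc (nth 0 l 0)) 0 * bcount 0 (nth 1 l 0) (nth 2 l 0) (nth 0 l 0)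
     + eqn (hdc (nth 0 l 0)) 1 * bcount 1 (nth 1 l 0) (nth 2 l 0) (nth 0 l 0)) (fun xs => nth 2 xs 0) _ _); prs; apply isPR_bcount; prs.
Qed.

Lemma isPR_centN k s i u : isPR k s -> isPR k i -> isPR k u -> isPR k (fun xs => centN (s xs) (i xs) (u xs)).
Proof.
  intros Hs Hi Hu.
  apply (isPR_comp k 3 (fun xs => centN (nth 0 xs 0) (nth 1 xs 0) (nth 2 xs 0)) [s; i; u]); [reflexivity| |].
  2:{ intros g [<-|[<-|[<-|[]]]]; assumption. }
  refine (isPR_ssum 3 (fun l => eqn (hdc (nth 0 l 0)) 0 * bcount 1 (nth 1 l 0) (nth 2 l 0) (nth 0 l 0)
     + eqn (hdc (nth 0 l 0)) 1 * bcount 0 (nth 1 l 0) (nth 2 l 0) (nth 0 l 0)) (fun xs => nth 2 xs 0) _ _); prs; apply isPR_bcount; prs.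
Qed.

Lemma isPR_stk k i j q u : isPR k u -> isPR k (fun xs => stk (alph i j q) (u xs) (u xs)).
Proof.
  intros Hu. unfold stk.
  apply (isPR_app1 (fun x => nat_rect (fun _ => nat) 0 (fun i0 acc => ite (suf i0 x) (pushc (alph i j q) (hdc (suf i0 x)) acc) acc) x)); [|exact Hu].
  refine (isPR_rec 1 (fun _ => 0) (fun l => ite (suf (nth 0 l 0) (nth 2 l 0)) (pushc (alph i j q) (hdc (suf (nth 0 l 0) (nth 2 l 0))) (nth 1 l 0)) (nth 1 l 0)) (fun xs => nth 0 xs 0) _ _ _); [prs| |prs].
  unfold pushc, alph, invl. prs.
Qed.

Lemma PR1_check : PR1 check.
Proof.
  unfold PR1, check. prs.
  - refine (isPR_ssum 1 (fun l => S (hdc (nth 0 l 0)) - 2 * p) (fun xs => nth 0 xs 0) _ _); prs.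
  - apply isPR_stk; prs.
  - apply isPR_stk; prs.
  - refine (isPR_nsum 1 (fun _ => c) (fun l => isz (eqn (expP (3 + nth 0 l 0) (nth 1 l 0)) (expN (3 + nth 0 l 0) (nth 1 l 0)))) _ _); prs.
    + refine (isPR_ssum 2 (fun l => eqn (hdc (nth 0 l 0)) (2 * (3 + nth 1 l 0))) (fun l => nth 1 l 0) _ _); prs.
    + refine (isPR_ssum 2 (fun l => eqn (hdc (nth 0 l 0)) (2 * (3 + nth 1 l 0) + 1)) (fun l => nth 1 l 0) _ _); prs.
  - refine (isPR_nsum 1 (fun xs => 2 * nth 0 xs 0 + 1) (fun l => nsum (nth 0 l 0) (fun i =>
      (fun l' => isz (eqn (centP (nth 1 l' 0) (nth 0 l' 0) (nth 2 l' 0) mod Nn (nth 1 l' 0) (nth 0 l' 0))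
        (centN (nth 1 l' 0) (nth 0 l' 0) (nth 2 l' 0) mod Nn (nth 1 l' 0) (nth 0 l' 0)))) (i :: l))) _ _); [prs|].
    apply (isPR_nsum 2 (fun l => nth 0 l 0) (fun l' => isz (eqn (centP (nth 1 l' 0) (nth 0 l' 0) (nth 2 l' 0) mod Nn (nth 1 l' 0) (nth 0 l' 0))
        (centN (nth 1 l' 0) (nth 0 l' 0) (nth 2 l' 0) mod Nn (nth 1 l' 0) (nth 0 l' 0))))); prs; match goal with
    | |- isPR _ (fun _ => centP _ _ _) => apply isPR_centP
    | |- isPR _ (fun _ => centN _ _ _) => apply isPR_centN
    end; prs.
Qed.

Lemma weq_re_words : re_words (fun w => vp p w /\ weq c N B w []).
Proof.
  exists (fun a => check a <> 0). split.
  - assert (H : isPR 2 (fun xs => check (nth 0 xs 0))) by (apply (isPR_app1 check); [apply PR1_check | prs]).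
    destruct H as [q Hq]. exists q. intros a. split.
    + intros Ha. exists 0. rewrite Hq by reflexivity. exact Ha.
    + intros [t Ht]. rewrite Hq in Ht by reflexivity. exact Ht.
  - intros w. symmetry. apply check_code.
Qed.

End Check.

(** * Upper bounds *)

(** The constant that bounds central errors in [column_small]. *)
Definition Qconst (Kf : nat) : nat := 6 * Kf + (4 + 2 * Kf) * (4 + 2 * Kf).

(* At scale [rho], all but [mu] central coordinates are either invisible or bounded by [Vc]. *)
Definition central_scale (c p : nat) (N B : nat -> nat -> Z) (mu rho Vc : nat) : Prop :=
  exists cuts : list (nat * nat), length cuts = mu /\
  (forall s i, In (s, i) cuts -> fbounded c p (fsi B s i)) /\
  (forall s i e, In (s, i) cuts -> (0 <= e)%Z -> (2 ^ e | N s i)%Z \/ (0 < N s i < 2 ^ e)%Z) /\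
  (forall kap : nat -> nat -> Z,
    (forall s i, (16 + 8 * (2 + c + mu)) * rho < slot s i -> i < s -> (N s i | kap s i)%Z) ->
    (forall s i, In (s, i) cuts -> exists y,
      (Z.abs (kap s i - N s i * y) <= Z.of_nat (Qconst (2 + c + mu) * (rho * rho)))%Z) ->
    exists w, cword c p w /\ (forall s i, (N s i | cent c (fsi B s i) w - kap s i)%Z) /\ length w <= Vc).

Section Upper.
Variables (c p : nat) (N B : nat -> nat -> Z).
Hypothesis Hp : 3 + c <= p.
Let E := weq c N B.
Let HE := weq_congruence c N B.
Variables (X : Type) (dle : X -> X -> R -> Prop) (rp : X -> word).
Hypothesis HM : word_model E X dle p rp.
Variables (mu : nat) (Vf : nat -> nat).
Hypothesis Hscale : forall rho, 1 <= rho -> central_scale c p N B mu rho (Vf rho).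

Let Kf : nat := 2 + c + mu.
Let A0 : nat := 4 + (2 + c) * Kf.
(** The height of the columns used by [gluing] for chains of step [2 * r], the step that
    [colours_cover] asks for balls of radius [r]. *)
Definition rho_0 (r : nat) : nat := 2 * ((Kf + 3) * S (2 * r)).
Definition size_0 (r : nat) : nat := A0 * rho_0 r + Vf (rho_0 r).
(** Stage 1 must tolerate jumps over whole pieces of stage 0, and be at least the height of a
    column. *)
Definition rho_1 (r : nat) : nat := size_0 r + 2 * (2 * r) + rho_0 r.
Definition size_1 (r : nat) : nat := A0 * rho_1 r + Vf (rho_1 r).

Lemma central_scale_family rho R : 1 <= rho -> R <= rho -> exists fam : word -> nat -> word -> Prop,
  (forall r0 g, column c p r0 R g -> exists j, j < Kf /\ fam r0 j g) /\
  (forall r0 j, j < Kf -> small E p rho (A0 * rho + Vf rho) (fun g => column c p r0 R g /\ fam r0 j g)).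
Proof.
  intros H1 HR. destruct (Hscale rho H1) as [cuts [Hl [Hf [HN Hc]]]].
  unfold Kf, A0. unfold Kf. rewrite <- Hl in *.
  exists (fun r0 => colour c N B r0 rho cuts). split.
  - intros r0 g Hg. now apply (column_colours c p N B Hp r0 R rho cuts).
  - intros r0 j Hj. apply (column_small c p N B Hp r0 R rho (Vf rho) cuts); auto.
Qed.

(** Columns need [Kf] colours and the gluing one more, so a ball meets at most [3 + c + mu]
    members. *)
Lemma upper_cover r : exists F,
  is_cover X F /\ diam_le X dle F (INR (2 * (size_0 r + 2 * r) + size_1 r)) /\
  (forall n, 2 + c + mu <= n -> mult_le X dle F (INR r) n).
Proof.
  assert (H0 : 1 <= rho_0 r) by (unfold rho_0; lia).
  assert (H1 : 1 <= rho_1 r /\ rho_0 r <= rho_1 r) by (unfold rho_1; lia).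
  destruct (central_scale_family (rho_0 r) (rho_0 r) H0 (Nat.le_refl _)) as [fam0 [C0 S0]].
  destruct (central_scale_family (rho_1 r) (rho_0 r) (proj1 H1) (proj2 H1)) as [fam1 [C1 S1]].
  destruct (gluing c p N B Kf (2 * r) (size_0 r) (size_1 r) (rho_0 r) (rho_1 r) fam0 fam1 C0 C1 S0 S1)
    as [Dom [D1 D2]].
  - unfold rho_0; nia.
  - unfold rho_1; lia.
  - destruct (colours_cover E HE p X dle rp HM (S Kf) r _ Dom D1 D2) as [F [F1 [F2 F3]]].
    exists F. split; [exact F1|]. split; [exact F2|]. intros n Hn. apply F3. unfold Kf. lia.
Qed.

Lemma nat_above (r : R) : (0 <= r)%R -> exists n : nat, (r <= INR n <= r + 1)%R.
Proof.
  intros Hr. destruct (archimed r) as [H1 H2]. exists (Z.to_nat (up r)).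
  assert (Hz : (0 <= up r)%Z) by (apply le_IZR; lra).
  rewrite INR_IZR_INZ, Z2Nat.id by exact Hz. lra.
Qed.

Lemma upper_asdim : asdim_le dle (2 + c + mu).
Proof.
  intros r Hr. destruct (nat_above r (Rlt_le _ _ Hr)) as [n [Hn _]].
  destruct (upper_cover n) as [F [F1 [F2 F3]]]. exists F. split; [exact F1|]. split; [eexists; exact F2|].
  apply (mult_le_mono E X dle p rp HM F r (INR n)); [exact Hn|]. apply F3. lia.
Qed.

Lemma upper_asdimAN C : (forall rho, 1 <= rho -> Vf rho <= C * rho) -> asdimAN_le dle (2 + c + mu).
Proof.
  intros HC.
  assert (Hlin : exists K, forall n, 1 <= n -> 2 * (size_0 n + 2 * n) + size_1 n <= K * n).
  { set (a := 6 * (Kf + 3)).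
    assert (Hr0 : forall n, 1 <= n -> rho_0 n <= a * n) by (intros n Hn; unfold rho_0, a; nia).
    assert (Hs0 : forall n, 1 <= n -> size_0 n <= (A0 + C) * a * n).
    { intros n Hn. specialize (Hr0 n Hn). assert (H := HC (rho_0 n) ltac:(unfold rho_0; lia)).
      unfold size_0. nia. }
    set (b := (A0 + C) * a + 4 + a).
    assert (Hr1 : forall n, 1 <= n -> rho_1 n <= b * n).
    { intros n Hn. specialize (Hr0 n Hn). specialize (Hs0 n Hn). unfold rho_1, b. nia. }
    exists (2 * ((A0 + C) * a + 2) + (A0 + C) * b). intros n Hn.
    specialize (Hs0 n Hn). specialize (Hr1 n Hn).
    assert (H := HC (rho_1 n) ltac:(unfold rho_1, rho_0; lia)).
    assert (H2 := Nat.mul_le_mono_l _ _ (A0 + C) Hr1). unfold size_1. lia. }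
  destruct Hlin as [K HK].
  exists (2 * INR K + 1)%R, 1%R. assert (HKp := pos_INR K). split; [lra|]. split; [lra|].
  intros r Hr. destruct (nat_above r ltac:(lra)) as [n [Hn Hn']].
  assert (H1 : 1 <= n).
  { apply INR_le. simpl. lra. }
  destruct (upper_cover n) as [F [F1 [F2 F3]]]. exists F. split; [exact F1|]. split.
  - intros U HU x y Hx Hy. apply (model_mono E X dle p rp HM x y (INR (2 * (size_0 n + 2 * n) + size_1 n))).
    + assert (H2 := le_INR _ _ (HK n H1)). rewrite mult_INR in H2. nra.
    + now apply (F2 U).
  - apply (mult_le_mono E X dle p rp HM F r (INR n)); [exact Hn|]. apply F3. lia.
Qed.

End Upper.

(** * The central coordinates at a given scale *)

Lemma Dn_pow2 s : exists e, (0 <= e)%Z /\ Z.of_nat (Dn s) = (2 ^ e)%Z.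
Proof.
  induction s as [|s [e [H1 H2]]]; [exists 2%Z; split; [lia | reflexivity]|].
  exists (e * 8)%Z. split; [lia|]. change (Dn (S s)) with (Dn s ^ 8).
  rewrite Nat2Z.inj_pow, H2, <- Z.pow_mul_r by lia. reflexivity.
Qed.

Lemma pow2_dichotomy n e : (exists f, (0 <= f)%Z /\ n = (2 ^ f)%Z) -> (0 <= e)%Z ->
  (2 ^ e | n)%Z \/ (0 < n < 2 ^ e)%Z.
Proof.
  intros [f [Hf ->]] He. destruct (Z_le_gt_dec e f) as [H|H].
  - left. exists (2 ^ (f - e))%Z. rewrite <- Z.pow_add_r by lia. f_equal. lia.
  - right. split; [apply Z.pow_pos_nonneg; lia | apply Z.pow_lt_mono_r; lia].
Qed.

Lemma sqrt_le_of_square x y : (0 <= y)%Z -> (x <= y * y)%Z -> (Z.sqrt x <= y)%Z.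
Proof. intros Hy H. rewrite <- (Z.sqrt_square y) by exact Hy. now apply Z.sqrt_le_mono. Qed.

Section Scales.
Variables (c p : nat) (N B : nat -> nat -> Z).
Hypothesis Hp : 3 + c <= p.
Hypothesis HN : forall s i, s <= i -> N s i = 1%Z.
Hypothesis HNb : forall s i, N s i = 1%Z \/ N s i = (Z.of_nat (Dn s) ^ 4)%Z.

Lemma N_range s i : (0 < N s i <= Z.of_nat (Dn s) ^ 4)%Z.
Proof.
  assert (H := Dn_gt s). destruct (HNb s i) as [->| ->].
  - split; [lia|]. change 1%Z with (1 ^ 4)%Z. apply Z.pow_le_mono_l. lia.
  - split; [apply Z.pow_pos_nonneg; lia | lia].
Qed.

(** A residue modulo [Dn s ^ 4] has a square root of at most [Dn s ^ 2], and the slot is also below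
    [Dn s ^ 2]: two summands with factor 8, and one unit for the constant. *)
Lemma single_all s i k : i < s -> single c p N B s i k (17 * (Dn s * Dn s)).
Proof.
  intros Hi. assert (HR := N_range s i). assert (Hm := Z.mod_pos_bound k (N s i) ltac:(lia)).
  apply (single_mod c p N B s i (k mod N s i)).
  { exists (- (k / N s i))%Z. assert (H := Z.div_mod k (N s i) ltac:(lia)). lia. }
  apply single_plain; [lia | exact Hi|]. destruct (Dn_pow_le s) as [H4 _].
  assert (Hb := slot_bounds s i Hi).
  assert (Hs : (Z.sqrt (Z.abs (k mod N s i)) <= Z.of_nat (Dn s) * Z.of_nat (Dn s))%Z).
  { apply sqrt_le_of_square; [nia|].
    replace (Z.of_nat (Dn s) * Z.of_nat (Dn s) * (Z.of_nat (Dn s) * Z.of_nat (Dn s)))%Z with (Z.of_nat (Dn s) ^ 4)%Z by ring.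
    rewrite Z.abs_eq by lia. lia. }
  assert (16 <= Dn s * Dn s) by nia. lia.
Qed.

Definition windows (n : nat) : list (nat * nat) :=
  nodup slot_dec (filter (fun x => snd x <? fst x) (list_prod (seq 0 n) (seq 0 n))).

Lemma windows_in n s i : In (s, i) (windows n) <-> s < n /\ i < s.
Proof.
  unfold windows. rewrite nodup_In, filter_In, in_prod_iff, !in_seq. simpl. rewrite Nat.ltb_lt. lia.
Qed.

Lemma windows_length n : length (windows n) <= n * n.
Proof.
  unfold windows. eapply Nat.le_trans; [apply (NoDup_incl_length (NoDup_nodup _ _)
    (l' := filter (fun x => snd x <? fst x) (list_prod (seq 0 n) (seq 0 n)))); intros x Hx; apply nodup_In in Hx; exact Hx|].
  eapply Nat.le_trans; [apply filter_length_le'|]. now rewrite length_prod, !length_seq.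
Qed.

(** Finitely many finite coordinates are visible at a given scale, so without any cut there is some
    bound, with no control of its growth. This is all that [asdim] requires. *)
Lemma central_scale_finite rho : exists V, central_scale c p N B 0 rho V.
Proof.
  set (Th := (16 + 8 * (2 + c + 0)) * rho).
  set (c1 := 17 * (Dn Th * Dn Th)).
  exists (list_sum (map (fun _ => c1) (windows (S Th)))). exists [].
  split; [reflexivity|]. split; [intros s i []|]. split; [intros s i e []|].
  intros kap Hhi _. apply (cword_exists c p N B HN kap (fun _ => c1)).
  - apply NoDup_nodup.
  - intros s i Hi Hin. rewrite windows_in in Hin. apply Hhi; [|exact Hi]. fold Th.
    assert (H := slot_gt s i). lia.
  - intros s i Hin. apply windows_in in Hin as [Hs Hi].
    destruct (single_all s i (kap s i) Hi) as [w [W1 [W2 W3]]].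
    exists w. split; [exact W1|]. split; [exact W2|].
    assert (Hm := Dn_mono s Th ltac:(lia)).
    assert (Dn s * Dn s <= Dn Th * Dn Th) by (apply Nat.mul_le_mono; exact Hm). unfold c1. lia.
Qed.

(* The coordinates below [mu] of the current window are cut into slabs; the other ones are
   trivial or distorted by the letter q. *)
Variable mu : nat.
Hypothesis Hcut : forall s i, i < mu -> fbounded c p (fsi B s i).
Hypothesis Hshort : (forall s i, mu <= i -> N s i = 1%Z) \/ (p = 4 + c /\ forall s i, mu <= i -> B s i = Z.of_nat (Dn s)).

Let Kf : nat := 2 + c + mu.

Lemma current_window Th : 4 <= Th -> exists S0, Dn S0 <= Th /\ Th < Dn (S S0).
Proof.
  intros H4.
  assert (H : forall n, Th < Dn n -> exists S0, Dn S0 <= Th /\ Th < Dn (S S0)).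
  { induction n as [|n IH]; intros Hn; [simpl in Hn; lia|].
    destruct (Nat.lt_ge_cases Th (Dn n)) as [H|H]; [now apply IH|]. exists n. split; [lia | exact Hn]. }
  exact (H Th (Dn_gt Th)).
Qed.

(** The number of old coordinates is at most [S0 ^ 2], which [Dn (pred S0) ^ 2] dominates; the
    exponent 8 in [Dn] pays for the product. *)
Lemma old_windows S0 : length (windows S0) * (17 * (Dn (pred S0) * Dn (pred S0))) <= Dn S0.
Proof.
  assert (Hl := windows_length S0).
  destruct S0 as [|s]; [simpl in *; lia|]. simpl pred. assert (Hg := Dn_gt s).
  destruct (Dn_pow_le s) as [H4 _]. change (Dn (S s)) with (Dn s ^ 8). set (d := Dn s) in *.
  set (n := length (windows (S s))) in *. clearbody n d.
  assert (H1 : 16 <= d * d) by nia. set (e := d * d) in *.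
  assert (H2 : n <= e) by (unfold e; nia).
  replace (d ^ 8) with (e * e * (e * e)) by (unfold e; simpl; ring). clearbody e.
  assert (H3 : 17 * e <= e * e * 2) by nia.
  assert (H5 : e * (17 * e) <= e * (e * e * 2)) by (apply Nat.mul_le_mono_l; exact H3).
  assert (H6 : n * (17 * e) <= e * (17 * e)) by (apply Nat.mul_le_mono_r; exact H2).
  assert (H7 : e * (e * e * 2) <= e * e * (e * e)) by (replace (e * (e * e * 2)) with (e * e * (e * 2)) by ring; apply Nat.mul_le_mono_l; nia).
  lia.
Qed.

Lemma list_sum_cons n l : list_sum (n :: l) = n + list_sum l.
Proof. reflexivity. Qed.

(* The slots of a window grow geometrically. *)
Lemma visible_slots_sum s Th n :
  list_sum (map (slot s) (filter (fun i => slot s i <=? Th) (seq 0 n))) <= 2 * Th.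
Proof.
  assert (H : list_sum (map (slot s) (filter (fun i => slot s i <=? Th) (seq 0 n))) <= slot s n /\
    list_sum (map (slot s) (filter (fun i => slot s i <=? Th) (seq 0 n))) <= 2 * Th); [|apply H].
  assert (Hs : forall n, slot s (S n) = 2 * slot s n) by (intros m; unfold slot; simpl; lia).
  induction n as [|n [IH1 IH2]]; [simpl; lia|]. rewrite seq_S, filter_app, map_app, list_sum_app, Hs.
  simpl. destruct (Nat.leb_spec (slot s n) Th) as [H|H]; simpl; lia.
Qed.

(** Older windows cost at most [th * rho] in total and newer ones are invisible. In the current
    window the cut coordinates are at most quadratic in [rho], with linear root, and the others cost
    a multiple of their slot, with geometric sum. *)
Lemma central_scale_linear : exists C, forall rho, 1 <= rho -> central_scale c p N B mu rho (C * rho).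
Proof.
  set (Q := Qconst Kf). set (th := 16 + 8 * Kf).
  exists (th + (mu * (8 * Q + 8 * th + 2) + 38 * th)). intros rho Hrho.
  destruct (current_window (th * rho)) as [S0 [HS1 HS2]]; [unfold th; nia|].
  exists (map (pair S0) (seq 0 mu)).
  assert (Hin : forall s i, In (s, i) (map (pair S0) (seq 0 mu)) <-> s = S0 /\ i < mu).
  { intros s i. rewrite in_map_iff. split.
    - intros [x [Hx Hx']]. injection Hx as <- <-. apply in_seq in Hx'. lia.
    - intros [-> Hi]. exists i. split; [reflexivity | apply in_seq; lia]. }
  split; [now rewrite length_map, length_seq|]. split; [|split].
  - intros s i Hi. apply Hin in Hi as [_ Hi]. now apply Hcut.
  - intros s i e _ He. apply pow2_dichotomy; [|exact He]. destruct (HNb s i) as [->| ->].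
    + exists 0%Z. split; [lia | reflexivity].
    + destruct (Dn_pow2 s) as [f [Hf ->]]. exists (f * 4)%Z. split; [lia|]. now rewrite Z.pow_mul_r by lia.
  - intros kap Hhi Hcur. fold Kf in Hcur, Hhi. fold th in Hhi. fold Q in Hcur.
    set (c1 := 17 * (Dn (pred S0) * Dn (pred S0))).
    set (c2 := (8 * Q + 8 * th + 2) * rho).
    set (vis := filter (fun i => slot S0 i <=? th * rho) (seq 0 S0)).
    (* 19 bounds [8 * Dn s + 4 * slot s i + 26] in units of the slot: [Dn s] is at most the slot,
       and the slot is at least 4. *)
    set (cst := fun x : nat * nat => if fst x <? S0 then c1 else if snd x <? mu then c2 else 19 * slot S0 (snd x)).
    assert (Hvis : forall i, In i vis <-> i < S0 /\ slot S0 i <= th * rho).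
    { intros i. unfold vis. rewrite filter_In, in_seq, Nat.leb_le. lia. }
    assert (Hcv : forall s i, In (s, i) (map (pair S0) vis) <-> s = S0 /\ i < S0 /\ slot S0 i <= th * rho).
    { intros s i. rewrite in_map_iff. split.
      - intros [x [Hx Hx']]. injection Hx as <- <-. apply Hvis in Hx'. auto.
      - intros [-> Hi]. exists i. split; [reflexivity | now apply Hvis]. }
    destruct (cword_exists c p N B HN kap cst (windows S0 ++ map (pair S0) vis)) as [w [W1 [W2 W3]]].
    + apply NoDup_app; [apply NoDup_nodup| |].
      * apply FinFun.Injective_map_NoDup; [intros x y Hxy; now injection Hxy | apply NoDup_filter, seq_NoDup].
      * intros [s i] H1 H2. apply windows_in in H1. apply Hcv in H2. lia.
    + intros s i Hi Hni. rewrite in_app_iff, windows_in, Hcv in Hni. apply Hhi; [|exact Hi].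
      destruct (lt_eq_lt_dec s S0) as [[H|H]|H]; [exfalso; tauto| |].
      * subst s. apply Nat.nle_gt. intros Hle. apply Hni. right. auto.
      * assert (Hb := slot_bounds s i Hi). assert (Hm := Dn_mono (S S0) s H). lia.
    + intros s i Hsi. apply in_app_or in Hsi as [Hsi|Hsi].
      * apply windows_in in Hsi as [Hs Hi]. unfold cst. cbn [fst snd].
        destruct (Nat.ltb_spec s S0) as [_|]; [|lia].
        destruct (single_all s i (kap s i) Hi) as [w [W1 [W2 W3]]].
        exists w. split; [exact W1|]. split; [exact W2|]. assert (Hm := Dn_mono s (pred S0) ltac:(lia)).
        assert (Dn s * Dn s <= Dn (pred S0) * Dn (pred S0)) by (apply Nat.mul_le_mono; exact Hm). unfold c1. lia.
      * apply Hcv in Hsi as [-> [Hi Hv]]. unfold cst. cbn [fst snd].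
        destruct (Nat.ltb_spec S0 S0) as [|_]; [lia|]. destruct (Nat.ltb_spec i mu) as [Him|Him].
        -- destruct (Hcur S0 i) as [y Hy]; [now apply Hin|].
           apply (single_mod c p N B S0 i (kap S0 i - N S0 i * y)%Z); [exists (- y)%Z; lia|].
           apply single_plain; [lia | exact Hi|].
           assert (Hs : (Z.sqrt (Z.abs (kap S0 i - N S0 i * y)) <= Z.of_nat (Q * rho))%Z).
           { apply sqrt_le_of_square; [lia|]. eapply Z.le_trans; [exact Hy|].
             assert (H1 : Q * (rho * rho) <= Q * (Q * (rho * rho))).
             { apply Nat.mul_le_mono_l. assert (1 <= Q) by (unfold Q, Qconst; lia).
               rewrite <- (Nat.mul_1_l (rho * rho)) at 1. now apply Nat.mul_le_mono_r. }
             lia. }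
           unfold c2. lia.
        -- destruct Hshort as [Heq|[Hp4 HB]].
           { exists []. split; [apply cword_nil|]. split; [|simpl; lia].
             intros s' i' Hi'. unfold delta. destruct ((s' =? S0) && (i' =? i)) eqn:Ee; [|apply Z.divide_0_r].
             apply andb_prop in Ee as [E1 E2]. apply Nat.eqb_eq in E1, E2. subst. rewrite Heq by exact Him. apply Z.divide_1_l. }
           assert (HR := N_range S0 i). assert (Hm := Z.mod_pos_bound (kap S0 i) (N S0 i) ltac:(lia)).
           apply (single_mod c p N B S0 i (kap S0 i mod N S0 i)%Z).
           { exists (- (kap S0 i / N S0 i))%Z. assert (H := Z.div_mod (kap S0 i) (N S0 i) ltac:(lia)). lia. }
           apply single_short; auto; [lia|]. assert (Hb := slot_bounds S0 i Hi). destruct (Dn_pow_le S0) as [H4 _]. lia.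
    + exists w. split; [exact W1|]. split; [exact W2|]. eapply Nat.le_trans; [exact W3|].
      rewrite map_app, list_sum_app, map_map.
      assert (H1 : list_sum (map cst (windows S0)) <= th * rho).
      { eapply Nat.le_trans; [apply (list_sum_bound cst c1)|].
        - intros [s i] Hsi. apply windows_in in Hsi as [Hs _]. unfold cst. cbn [fst].
          destruct (Nat.ltb_spec s S0); lia.
        - assert (Ho := old_windows S0). fold c1 in Ho. lia. }
      assert (H2 : forall l, list_sum (map (fun i => cst (S0, i)) l) <= list_sum (map (fun i => if i <? mu then c2 else 0) l) + 19 * list_sum (map (slot S0) l)).
      { induction l as [|i l IH]; [simpl; lia|]. rewrite !map_cons, !list_sum_cons.
        unfold cst at 1. cbn [fst snd]. destruct (Nat.ltb_spec S0 S0) as [|_]; [lia|].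
        destruct (i <? mu); lia. }
      assert (H3 : forall n, list_sum (map (fun i => if i <? mu then c2 else 0) (filter (fun i => slot S0 i <=? th * rho) (seq 0 n))) <= min n mu * c2).
      { induction n as [|n IH]; [simpl; lia|]. rewrite seq_S, filter_app, map_app, list_sum_app.
        change (0 + n) with n. cbn [filter]. destruct (slot S0 n <=? th * rho).
        - rewrite map_cons, list_sum_cons. cbn [map list_sum fold_right]. destruct (Nat.ltb_spec n mu).
          + replace (min (S n) mu) with (S (min n mu)) by lia. lia.
          + replace (min (S n) mu) with (min n mu) by lia. lia.
        - cbn [map list_sum fold_right]. assert (min n mu * c2 <= min (S n) mu * c2) by (apply Nat.mul_le_mono_r; lia). lia. }
      specialize (H2 vis). specialize (H3 S0). fold vis in H3.
      assert (H4 := visible_slots_sum S0 (th * rho) S0). fold vis in H4.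
      assert (H5 : min S0 mu * c2 <= mu * c2) by (apply Nat.mul_le_mono_r; lia). unfold c2 in *. lia.
Qed.

End Scales.

(** * Lower bounds *)

(** [0 ^ 0 = 1] keeps the generator at the first position, while the three further positions
    contribute nothing. *)
Lemma fbounded_zero c p B s i : B s i = 0%Z -> fbounded c p (fsi B s i).
Proof.
  intros HB x _. unfold fsi. rewrite HB. set (q := (x - 4 * Z.of_nat (slot s i))%Z).
  destruct (Z.leb_spec 0 q), (Z.ltb_spec q 4); cbn [andb]; try (simpl; lia).
  destruct (Z.eq_dec q 0) as [->|Hq]; [simpl; lia|]. rewrite Z.pow_0_l by lia. simpl; lia.
Qed.

Lemma fbounded_without_q c p B s i : p <= 3 + c -> fbounded c p (fsi B s i).
Proof.
  intros Hp x Hx. unfold stepsize in Hx. destruct (Nat.leb_spec p (3 + c)); [|lia].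
  destruct Hx as [y ->]. unfold fsi. set (q := (y * 4 - 4 * Z.of_nat (slot s i))%Z).
  destruct (Z.leb_spec 0 q), (Z.ltb_spec q 4); cbn [andb]; try (simpl; lia).
  replace q with 0%Z by lia. rewrite Z.pow_0_r. simpl; lia.
Qed.

Section Lower.
Variables (c p : nat) (N B : nat -> nat -> Z).
Hypothesis Hp : 3 + c <= p.
Hypothesis HN : forall s i, s <= i -> N s i = 1%Z.
Variables (X : Type) (dle : X -> X -> R -> Prop) (rp : X -> word).
Hypothesis HM : word_model (weq c N B) X dle p rp.

Lemma mult_le_weaken F r j n : j <= n -> mult_le X dle F r j -> mult_le X dle F r n.
Proof. intros Hj H x Us H1 H2. specialize (H x Us H1 H2). lia. Qed.

Lemma asdim_lower (Lc : list (nat * nat)) (idx : nat -> nat -> nat) (Kz : nat) : NoDup Lc ->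
  (forall s i, In (s, i) Lc -> i < s /\ 4 + 4 * slot s i <= Kz) ->
  (forall s i, In (s, i) Lc -> fbounded c p (fsi B s i)) ->
  (forall s i, In (s, i) Lc -> N s i = 0%Z) ->
  (forall j, 2 + c <= j < 2 + c + length Lc -> exists s i, In (s, i) Lc /\ idx s i = j) ->
  (forall s i, In (s, i) Lc -> idx s i < 2 + c + length Lc) ->
  forall j, j < 2 + c + length Lc -> ~ asdim_le dle j.
Proof.
  intros HL HLc HLf HLN Hidx Hidx' j Hj Has. set (n := 2 + c + length Lc) in *.
  set (delta := INR ((2 + c) * 1 + length Lc * Kz)).
  assert (Hd : (0 < delta)%R) by (apply lt_0_INR; lia).
  assert (Hn : (0 < INR n)%R) by (apply lt_0_INR; unfold n; lia).
  destruct (Has (2 * INR n * delta)%R) as [F [F1 [[Dm F2] F3]]]; [nra|].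
  destruct (nat_above (Rmax 0 (Dm + 4 * INR n * delta))) as [Tn [HT _]]; [apply Rmax_l|].
  (* The side [Tn * Tn + 1] just exceeds the central values of words of length at most [Tn]; the
     coordinates are infinite cyclic, so no multiple of the order comes closer. *)
  apply (grid_lower c p N B HN Hp X dle rp HM Lc idx 1 Kz HL HLc HLf Hidx Hidx' n (Tn * Tn + 1) Tn Dm F);
    auto; fold delta.
  - eapply Rle_trans; [apply Rmax_r | exact HT].
  - nia.
  - intros s i y Hin. rewrite (HLN s i Hin). lia.
  - apply (mult_le_weaken _ _ j); [lia | exact F3].
Qed.

Lemma asdim_lower_base j : j < 2 + c -> ~ asdim_le dle j.
Proof.
  intros Hj. apply (asdim_lower [] (fun _ _ => 0) 0); simpl; try tauto; try lia. constructor.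
Qed.

(** The first coordinates of [S j] different windows give that many independent infinite central
    directions. *)
Lemma asdim_infinite : (forall s i, i < s -> N s i = 0%Z) -> (forall s i, fbounded c p (fsi B s i)) ->
  forall j, ~ asdim_le dle j.
Proof.
  intros H0 Hf j. set (Lc := map (fun k => (S k, 0)) (seq 0 (S j))).
  assert (Hin : forall s i, In (s, i) Lc -> i = 0 /\ 1 <= s <= S j).
  { intros s i Hin. apply in_map_iff in Hin as [k [E Hk]]. injection E as <- <-. apply in_seq in Hk. lia. }
  assert (Hlen : length Lc = S j) by (unfold Lc; now rewrite length_map, length_seq).
  apply (asdim_lower Lc (fun s _ => 1 + c + s) (4 + 4 * Dn (S j))); auto.
  - apply FinFun.Injective_map_NoDup; [intros x y Hxy; now injection Hxy | apply seq_NoDup].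
  - intros s i Hsi. apply Hin in Hsi as [-> Hs]. split; [lia|]. unfold slot. assert (H := Dn_mono s (S j)).
    simpl Nat.pow. lia.
  - intros s i Hsi. apply Hin in Hsi as [-> Hs]. apply H0. lia.
  - intros k Hk. rewrite Hlen in Hk. exists (k - 1 - c), 0. split; [|lia]. apply in_map_iff.
    exists (k - 2 - c). split; [f_equal; lia | apply in_seq; lia].
  - intros s i Hsi. apply Hin in Hsi. lia.
  - rewrite Hlen. lia.
Qed.

(** Both the step [delta] and the allowed diameter are proportional to [Dn s0], so faces need a
    separation of order [Dn s0 ^ 2], which fits into a circle of length [Dn s0 ^ 4] once [s0] is
    large. *)
Lemma asdimAN_lower m : (forall s i, m <= s -> i < m -> N s i = (Z.of_nat (Dn s) ^ 4)%Z) ->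
  (forall s i, i < m -> fbounded c p (fsi B s i)) ->
  forall j, j < 2 + c + m -> ~ asdimAN_le dle j.
Proof.
  intros Hbig Hf j Hj [C [r0 [HC [Hr0 H]]]]. set (n := 2 + c + m) in *.
  set (a := (2 + c) + m * (4 + 4 * 2 ^ m)).
  (* With [delta = a * D] and cover radius [2 * n * delta], the diameter [C * (2 * n * delta)] plus
     [4 * n * delta] is at most [A * D]. *)
  destruct (nat_above ((C + 2) * 2 * INR n * INR a)) as [A [HA _]].
  { assert (H1 := pos_INR n). assert (H2 := pos_INR a). apply Rmult_le_pos; nra. }
  destruct (nat_above r0 ltac:(lra)) as [r1 [Hr1 _]].
  (* The three summands ensure that the window has [m] coordinates, that [D ^ 4] exceeds
     [2 * (A * D) ^ 2 + 1], and that the scale is at least [r0]. *)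
  set (s0 := m + (2 * A + 3) + r1). set (D := Dn s0). assert (HD : s0 < D) by apply Dn_gt.
  set (Lc := map (pair s0) (seq 0 m)).
  assert (Hin : forall s i, In (s, i) Lc -> s = s0 /\ i < m).
  { intros s i Hin. apply in_map_iff in Hin as [k [E Hk]]. injection E as <- <-. apply in_seq in Hk. lia. }
  assert (Hlen : length Lc = m) by (unfold Lc; now rewrite length_map, length_seq).
  set (delta := INR ((2 + c) * D + length Lc * ((4 + 4 * 2 ^ m) * D))).
  assert (Hdelta : delta = (INR a * INR D)%R).
  { unfold delta, a. rewrite <- mult_INR, Hlen. f_equal. ring. }
  assert (Ha : (1 <= INR a)%R) by (apply (le_INR 1); unfold a; lia).
  assert (Hn : (1 <= INR n)%R) by (apply (le_INR 1); unfold n; lia).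
  assert (HDr : (r0 <= INR D)%R).
  { eapply Rle_trans; [apply Hr1|]. apply le_INR. unfold s0 in HD. lia. }
  assert (Hda : (INR D <= delta)%R) by (rewrite Hdelta; nra).
  destruct (H (2 * INR n * delta)%R) as [F [F1 [F2 F3]]]; [nra|].
  (* The noncentral directions advance by [D] per unit, so that [delta] is at least [D] also for
     [m = 0]. *)
  apply (grid_lower c p N B HN Hp X dle rp HM Lc (fun _ i => 2 + c + i) D ((4 + 4 * 2 ^ m) * D)) with
    (n := n) (Lg := A * D * (A * D) + 1) (Tn := A * D) (Dm := (C * (2 * INR n * delta))%R) (F := F); auto; fold delta.
  - apply FinFun.Injective_map_NoDup; [intros x y Hxy; now injection Hxy | apply seq_NoDup].
  - intros s i Hsi. apply Hin in Hsi as [-> Hi]. split; [unfold s0; lia|]. unfold slot. fold D.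
    assert (H1 : 2 ^ i <= 2 ^ m) by (apply Nat.pow_le_mono_r; lia). nia.
  - intros s i Hsi. apply Hin in Hsi as [_ Hi]. now apply Hf.
  - intros k Hk. rewrite Hlen in Hk. exists s0, (k - 2 - c). split; [|lia]. apply in_map_iff.
    exists (k - 2 - c). split; [reflexivity | apply in_seq; lia].
  - intros s i Hsi. apply Hin in Hsi. lia.
  - unfold n. lia.
  - lia.
  - rewrite Hdelta, mult_INR. assert (H1 := pos_INR D). nra.
  - nia.
  - intros s i y Hsi. apply Hin in Hsi as [-> Hi]. rewrite Hbig; [|unfold s0; lia | exact Hi]. fold D.
    assert (HDA : 2 * A + 3 <= D) by (unfold s0 in HD; lia). clearbody D. clear - HDA.
    set (d := Z.of_nat D). set (t := Z.of_nat (A * D)).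
    replace (Z.of_nat (A * D * (A * D) + 1)) with (t * t + 1)%Z by lia.
    assert (Hd : (2 * (t * t) + 1 < d ^ 4)%Z).
    { replace (d ^ 4)%Z with ((d * d) * (d * d))%Z by ring.
      replace (t * t)%Z with (Z.of_nat A * Z.of_nat A * (d * d))%Z by (unfold t, d; lia).
      assert (H1 : (2 * (Z.of_nat A * Z.of_nat A) + 1 <= d * d)%Z) by nia.
      assert (H2 : (1 < d * d)%Z) by nia.
      assert (H3 := Z.mul_le_mono_nonneg_r _ _ (d * d) ltac:(lia) H1). lia. }
    generalize dependent (d ^ 4)%Z. intros M HM. assert (0 <= t * t)%Z by nia.
    generalize dependent (t * t)%Z. intros T HT HT0.
    destruct (Z_le_gt_dec y 0); [rewrite Z.abs_eq; nia | rewrite Z.abs_neq; nia].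
  - apply (mult_le_weaken _ _ j); [unfold n; lia | exact F3].
Qed.

End Lower.

(** * The three dimensions *)

Definition below (i : nat) (l : enat) : bool := match l with Some n => i <? n | None => true end.

Section Dimensions.
Variables (c p : nat) (N B : nat -> nat -> Z).
Hypothesis Hp : 3 + c <= p.
Hypothesis HN : forall s i, s <= i -> N s i = 1%Z.
Hypothesis HNb : forall s i, N s i = 1%Z \/ N s i = (Z.of_nat (Dn s) ^ 4)%Z.
Variables (X : Type) (dle : X -> X -> R -> Prop) (rp : X -> word).
Hypothesis HM : word_model (weq c N B) X dle p rp.

Lemma asdim_value : dim_is (asdim_le dle) (Some (2 + c)).
Proof.
  split; [|intros j; now apply (asdim_lower_base c p N B Hp HN X dle rp HM)].
  set (Vf := fun rho => proj1_sig (constructive_indefinite_description _ (central_scale_finite c p N B Hp HN HNb rho))).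
  rewrite <- (Nat.add_0_r (2 + c)). apply (upper_asdim c p N B Hp X dle rp HM 0 Vf).
  intros rho _. apply (proj2_sig (constructive_indefinite_description _ (central_scale_finite c p N B Hp HN HNb rho))).
Qed.

(** For infinite [mu] every finite number of coordinates gives a lower bound, so none of the
    inequalities can hold. *)
Lemma asdimAN_value (mu : enat) :
  (forall s i, i < s -> below i mu = true -> N s i = (Z.of_nat (Dn s) ^ 4)%Z) ->
  (forall s i, below i mu = true -> fbounded c p (fsi B s i)) ->
  (forall s i, below i mu = false -> N s i = 1%Z) \/
    (p = 4 + c /\ forall s i, below i mu = false -> B s i = Z.of_nat (Dn s)) ->
  dim_is (asdimAN_le dle) (option_map (Nat.add (2 + c)) mu).
Proof.
  intros Hbig Hf Hshort.
  assert (Hlow : forall m, (forall i, i < m -> below i mu = true) -> forall j, j < 2 + c + m -> ~ asdimAN_le dle j).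
  { intros m Hm. apply (asdimAN_lower c p N B Hp HN X dle rp HM m).
    - intros s i Hs Hi. apply Hbig; [lia | auto].
    - intros s i Hi. auto. }
  destruct mu as [mu|].
  - assert (Hin : forall i, i < mu -> below i (Some mu) = true) by (intros i; apply Nat.ltb_lt).
    assert (Hout : forall i, mu <= i -> below i (Some mu) = false) by (intros i; apply Nat.ltb_ge).
    split; [|now apply Hlow].
    destruct (central_scale_linear c p N B Hp HN HNb mu) as [C HC].
    + auto.
    + destruct Hshort as [H|[H H']]; [left | right]; auto.
    + apply (upper_asdimAN c p N B Hp X dle rp HM mu (fun rho => C * rho) HC C). auto.
  - intros j. apply (Hlow (S j)); [reflexivity | lia].
Qed.

End Dimensions.

Lemma group_and_subgroup c p p' Nn Bn : p' <= p -> (forall s i, s <= i -> Nn s i = 1) -> PR2 Nn -> PR2 Bn ->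
  let E := weq c (fun s i => Z.of_nat (Nn s i)) (fun s i => Z.of_nat (Bn s i)) in
  exists (G : group) (S : list G) (P : G -> Prop) (T : list G),
    (generates S (fun _ => True) /\ rec_presented S /\ subgroup P /\ generates T P /\ rec_presented T) /\
    (exists rp, word_model E G (word_dle S) p rp) /\
    (exists rp, word_model E {g : G | P g} (sub_word_dle P T) p' rp).
Proof.
  intros Hp HN HNr HBr E. assert (HE : word_congruence E) by apply weq_congruence.
  exists (qgroup E HE p), (qgens E HE p p), (qsub E HE p p'), (qgens E HE p p').
  split; [split; [|split; [|split; [|split]]]|split].
  - apply qgens_generate.
  - apply qgens_rec_presented; [lia|]. now apply weq_re_words.
  - apply qsub_subgroup.
  - now apply qsub_generate.
  - apply qgens_rec_presented; [exact Hp|]. now apply weq_re_words.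
  - apply qgroup_model.
  - now apply qsub_model.
Qed.

Definition moduli (l : enat) (s i : nat) : nat := if (i <? s) && below i l then Dn s ^ 4 else 1.
Definition bases (l : enat) (s i : nat) : nat := if below i l then 0 else Dn s.

Lemma PR2_ite_lt a f g : PR2 a -> PR2 f -> PR2 g -> PR2 (fun s i => if i <? a s i then f s i else g s i).
Proof.
  intros Ha Hf Hg. apply (isPR_ext 2 (fun xs => ite (a (nth 0 xs 0) (nth 1 xs 0) - nth 1 xs 0)
    (f (nth 0 xs 0) (nth 1 xs 0)) (g (nth 0 xs 0) (nth 1 xs 0)))).
  - intros xs _. rewrite ite_spec. destruct (Nat.ltb_spec (nth 1 xs 0) (a (nth 0 xs 0) (nth 1 xs 0)));
      destruct (Nat.eqb_spec (a (nth 0 xs 0) (nth 1 xs 0) - nth 1 xs 0) 0); try lia; reflexivity.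
  - apply isPR_ite; [|exact Hf | exact Hg]. apply (isPR_app2 Nat.sub); [apply PR2_sub | exact Ha | apply isPR_var].
Qed.

Lemma PR2_below l f g : PR2 f -> PR2 g -> PR2 (fun s i => if below i l then f s i else g s i).
Proof.
  intros Hf Hg. destruct l as [n|]; [|exact Hf].
  apply (PR2_ite_lt (fun _ _ => n)); auto. exact (isPR_const 2 n).
Qed.

Lemma PR2_Dn : PR2 (fun s _ => Dn s).
Proof. apply (isPR_app1 Dn); [apply PR1_Dn | apply isPR_var]. Qed.

Lemma PR2_moduli l : PR2 (moduli l).
Proof.
  apply (isPR_ext 2 (fun xs => if nth 1 xs 0 <? nth 0 xs 0
    then (if below (nth 1 xs 0) l then Dn (nth 0 xs 0) ^ 4 else 1) else 1)).
  - intros xs _. unfold moduli. now destruct (nth 1 xs 0 <? nth 0 xs 0).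
  - apply (PR2_ite_lt (fun s _ => s) (fun s i => if below i l then Dn s ^ 4 else 1) (fun _ _ => 1));
      [exact (isPR_var 2 0) | | exact (isPR_const 2 1)].
    apply (PR2_below l (fun s _ => Dn s ^ 4) (fun _ _ => 1)); [|exact (isPR_const 2 1)].
    apply (isPR_app2 Nat.pow); [apply PR2_pow | apply PR2_Dn | apply isPR_const].
Qed.

Lemma PR2_bases l : PR2 (bases l).
Proof. apply (PR2_below l (fun _ _ => 0) (fun s _ => Dn s)); [exact (isPR_const 2 0) | apply PR2_Dn]. Qed.

Lemma option_map_sub k (l : enat) : enat_le (Some k) l -> option_map (Nat.add k) (option_map (fun x => x - k) l) = l.
Proof. destruct l as [l|]; [|reflexivity]. simpl. intros H. f_equal. lia. Qed.

(** All three dimensions are infinite, so the group can serve as its own subgroup: both use the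
    letters a, b, t, and infinite [asdim] forces the other values. *)
Lemma infinite_case : exists (G : group) (S : list G) (P : G -> Prop) (T : list G),
  generates S (fun _ => True) /\ rec_presented S /\ subgroup P /\ generates T P /\ rec_presented T /\
  dim_is (asdim_le (word_dle S)) None /\ dim_is (asdimAN_le (word_dle S)) None /\
  dim_is (asdimAN_le (sub_word_dle P T)) None.
Proof.
  assert (HN : forall s i, s <= i -> (fun s i => if i <? s then 0 else 1) s i = 1).
  { intros s i Hi. simpl. destruct (Nat.ltb_spec i s); lia. }
  destruct (group_and_subgroup 0 3 3 (fun s i => if i <? s then 0 else 1) (fun _ _ => 0))
    as [G [S [P [T [H [[rp HM] [rp' HM']]]]]]]; auto.
  - apply (PR2_ite_lt (fun s _ => s) (fun _ _ => 0) (fun _ _ => 1)); [exact (isPR_var 2 0) | exact (isPR_const 2 0) | exact (isPR_const 2 1)].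
  - exact (isPR_const 2 0).
  - exists G, S, P, T.
    assert (HNZ : forall s i, s <= i -> (fun s i => Z.of_nat (if i <? s then 0 else 1)) s i = 1%Z).
    { intros s i Hi. cbv beta. now rewrite HN. }
    assert (Hinf : forall X dle rp, word_model (weq 0 (fun s i => Z.of_nat (if i <? s then 0 else 1))
        (fun _ _ => Z.of_nat 0)) X dle 3 rp -> forall j, ~ asdim_le dle j).
    { intros X dle r HX. apply (asdim_infinite 0 3 _ _ (le_n 3) HNZ X dle r HX).
      - intros s i Hi. now rewrite (proj2 (Nat.ltb_lt i s) Hi).
      - intros s i. now apply fbounded_zero. }
    destruct H as [H1 [H2 [H3 [H4 H5]]]]. do 5 (split; [assumption|]). split; [|split].
    + exact (Hinf _ _ _ HM).
    + intros j Hj. apply (asdimAN_asdim _ _ _ _ _ HM) in Hj. exact (Hinf _ _ _ HM j Hj).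
    + intros j Hj. apply (asdimAN_asdim _ _ _ _ _ HM') in Hj. exact (Hinf _ _ _ HM' j Hj).
Qed.

Theorem mainTheorem1 :
  forall k m n : enat,
    enat_le (Some 4%nat) k -> enat_le k m -> enat_le m n ->
    exists (G : group) (S : list G) (P : G -> Prop) (T : list G),
      generates S (fun _ => True) /\ rec_presented S /\
      subgroup P /\ generates T P /\ rec_presented T /\
      dim_is (asdim_le (word_dle S)) k /\
      dim_is (asdimAN_le (word_dle S)) m /\
      dim_is (asdimAN_le (sub_word_dle P T)) n.
Proof.
  intros [k|] m n Hk Hm Hn.
  2:{ destruct m; [contradiction|]. destruct n; [contradiction|]. exact infinite_case. }
  simpl in Hk. set (c := k - 2). assert (Ec : 2 + c = k) by (unfold c; lia).
  assert (Hkn : enat_le (Some k) n) by (destruct m, n; simpl in *; try tauto; lia).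
  set (j := option_map (fun x => x - k) m). set (l := option_map (fun x => x - k) n).
  assert (Ej : option_map (Nat.add k) j = m) by now apply option_map_sub.
  assert (El : option_map (Nat.add k) l = n) by now apply option_map_sub.
  assert (Hjl : forall i, below i j = true -> below i l = true).
  { unfold j, l. intros i. destruct m as [m|], n as [n|]; simpl in *; try tauto.
    rewrite !Nat.ltb_lt. lia. }
  clearbody j l. rewrite <- Ej, <- El, <- Ec. clear - Hjl.
  assert (HN1 : forall s i, s <= i -> moduli l s i = 1).
  { intros s i Hi. unfold moduli. destruct (Nat.ltb_spec i s); [lia | reflexivity]. }
  destruct (group_and_subgroup c (4 + c) (3 + c) (moduli l) (bases j))
    as [G [S [P [T [H [[rp HM] [rp' HM']]]]]]]; [lia | exact HN1 | apply PR2_moduli | apply PR2_bases |].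
  set (N := fun s i => Z.of_nat (moduli l s i)) in *. set (B := fun s i => Z.of_nat (bases j s i)) in *.
  assert (HN : forall s i, s <= i -> N s i = 1%Z) by (intros s i Hi; unfold N; now rewrite HN1).
  assert (HNb : forall s i, N s i = 1%Z \/ N s i = (Z.of_nat (Dn s) ^ 4)%Z).
  { intros s i. unfold N, moduli. destruct ((i <? s) && below i l); [right|now left].
    now rewrite Nat2Z.inj_pow. }
  assert (HNl : forall s i, i < s -> below i l = true -> N s i = (Z.of_nat (Dn s) ^ 4)%Z).
  { intros s i Hi Hl. unfold N, moduli. rewrite (proj2 (Nat.ltb_lt i s) Hi), Hl. cbn [andb]. now rewrite Nat2Z.inj_pow. }
  exists G, S, P, T. destruct H as [H1 [H2 [H3 [H4 H5]]]].
  do 5 (split; [assumption|]). split; [|split].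
  - exact (asdim_value c (4 + c) N B ltac:(lia) HN HNb G (word_dle S) rp HM).
  (* In the group only the coordinates below [j] resist; base [Dn s] digits shorten all others. *)
  - apply (asdimAN_value c (4 + c) N B ltac:(lia) HN HNb G (word_dle S) rp HM j).
    + auto.
    + intros s i Hi. apply fbounded_zero. unfold B, bases. now rewrite Hi.
    + right. split; [reflexivity|]. intros s i Hi. unfold B, bases. now rewrite Hi.
  (* Without q every reachable position is a multiple of 4, so no base shortens a coordinate and all
     those below [l] count. *)
  - apply (asdimAN_value c (3 + c) N B ltac:(lia) HN HNb _ (sub_word_dle P T) rp' HM' l).
    + auto.
    + intros s i _. now apply fbounded_without_q.
    + left. intros s i Hi. unfold N, moduli. rewrite Hi. now destruct (i <? s).
Qed.
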